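(* Let $M$ be a compact $C^k$ manifold with $k\geq 2$, and let $i\in\mathrm{Emb}^2(M,\mathbb{R}^D)$ be an embedding such that $\mathsf M=i(M)$ satisfies conditions (P1), (P2), (P3) and (P4). Then, for all $\varepsilon>0$ small enough, there exists a neighborhood $\mathcal U$ of $i$ in $\mathrm{Emb}^2(M,\mathbb{R}^D)$ equipped with the Whitney $C^2$-topology such that for every $i'\in\mathcal U$, with $\mathsf M'=i'(M)$: 1. $\mathsf M'$ satisfies (P1), (P2), (P3) and (P4). 2. There is a bijection $\Psi:Z(\mathsf M)\to Z(\mathsf M')$ satisfying 3 and 4 below. 3. For every $z_0\in Z(\mathsf M)$, $\Psi(z_0)\in B(z_0,\varepsilon)$. 4. For every $z_0\in Z(\mathsf M)$ with $\pi_{\mathsf M}(z_0)=\{x_1,\dots,x_s\}$, the set $\pi_{\mathsf M'}(\Psi(z_0))$ is included in the union of the balls of radius $\varepsilon$ centered at the points $x_j$, with exactly one point in each ball.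
   Context: Standing assumptions: $\dim M=m\geq 1$ and $D\geq 2$. ''$\varepsilon$ small enough'' only means small enough that the balls of point 4 do not intersect. Distance function. For a nonempty compact set $\mathsf{S}\subset\mathbb{R}^D$, let $d_{\mathsf S}(x)=\min_{y\in \mathsf S}\|x-y\|$ and $\pi_{\mathsf S}(x)=\{y\in\mathsf S: \|x-y\|=d_{\mathsf S}(x)\}$. For a nonempty bounded set $\sigma$, $m(\sigma)$ is the center of its smallest enclosing ball. The generalized gradient is $\nabla d_{\mathsf S}(x)=\frac{x-m(\pi_{\mathsf S}(x))}{d_{\mathsf S}(x)}$ for $x\notin\mathsf S$ and $0$ for $x\in\mathsf S$. The set of critical points is $Z(\mathsf S)=\{z\in\mathbb{R}^D\setminus\mathsf S:\nabla d_{\mathsf S}(z)=0\}$, and for $\mu\in[0,1]$ the set of $\mu$-critical points is $Z_\mu(\mathsf S)=\{z\in\mathbb{R}^D\setminus \mathsf S:\|\nabla d_{\mathsf S}(z)\|\leq\mu\}$. Conditions on a compact submanifold $\mathsf M\subset\mathbb{R}^D$ ($B(x,r)$ is the open ball): (P1) For every $z_0\in Z(\mathsf M)$, the projections $\pi_{\mathsf M}(z_0)$ are the vertices of a non-degenerate simplex (i.e. form a finite affinely independent set; in particular there are at most $D+1$ of them), and $z_0$ belongs to the relative interior of the convex hull of $\pi_{\mathsf M}(z_0)$. (P2) $Z(\mathsf M)$ is finite. (P3) For every $z_0\in Z(\mathsf M)$ and every $x_0\in\pi_{\mathsf M}(z_0)$, there exist $\delta>0$ and $\alpha>0$ such that for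 all $y\in\mathsf M\cap B(x_0,\delta)$, $\|y-z_0\|^2\geq\|x_0-z_0\|^2+\alpha\|y-x_0\|^2$. (P4) There exist $C>0$ and $\mu_0\in(0,1)$ such that for every $\mu\in[0,\mu_0)$, every point of $Z_\mu(\mathsf M)$ is at distance at most $C\mu$ from $Z(\mathsf M)$. Whitney $C^2$-topology. Fix a finite atlas $(\phi_j,U_j)_{j\in J}$ of $M$ with $U_j\subset\mathbb{R}^m$, $\phi_j:U_j\to M$ (charts restricted to slightly smaller domains so that the quantities below are finite). For $f\in C^2(M,\mathbb{R}^D)$ let $\|f\|_{C^2}=\max_{0\leq r\leq 2}\max_{j\in J}\sup_{u\in U_j}\|d^r(f\circ\phi_j)_u\|_{\mathrm{op}}$; the Whitney $C^2$-topology is the one defined by this norm. $\mathrm{Emb}^2(M,\mathbb{R}^D)\subset C^2(M,\mathbb{R}^D)$ is the set of $C^2$ embeddings (immersions that are homeomorphisms onto their image). *)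

(* Defs.v *)
From HB Require Import structures.
From mathcomp Require Import all_boot all_order all_algebra.
From mathcomp Require Import all_classical all_reals all_analysis.

Set Implicit Arguments.
Unset Strict Implicit.
Unset Printing Implicit Defensive.

Import Order.TTheory GRing.Theory Num.Theory.
Import numFieldNormedType.Exports.

Local Open Scope classical_set_scope.
Local Open Scope ring_scope.

(* The library norm `|x| on 'rV[R]_n is the sup norm: it is used only through
   the topology and the differential, which do not depend on the norm. All
   metric notions below use the Euclidean norm [enorm]. *)

Section Euclidean.
Variables (R : realType) (n : nat).
Implicit Types (x y c z : 'rV[R]_n) (r : R) (S A : set 'rV[R]_n).

Definition enorm x : R := Num.sqrt (\sum_(i < n) x ord0 i ^+ 2).

Definition eball c r : set 'rV[R]_n := [set x | enorm (x - c) < r].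

Definition ecball c r : set 'rV[R]_n := [set x | enorm (x - c) <= r].

(* All the notions depending on S below are meant for S nonempty and compact;
   the infimum is then a minimum. *)
Definition dist_set S x : R := inf [set enorm (x - y) | y in S].

Definition proj_set S x : set 'rV[R]_n :=
  [set y | S y /\ enorm (x - y) = dist_set S x].

(* [seb_center A] is the unique such c when A is nonempty and bounded. *)
Definition is_seb_center A c : Prop :=
  exists r, A `<=` ecball c r /\
    forall c' r', A `<=` ecball c' r' -> r <= r'.

Definition seb_center A : 'rV[R]_n := xget 0 [set c | is_seb_center A c].

Definition grad_dist S x : 'rV[R]_n :=
  if x \in S then 0 else (dist_set S x)^-1 *: (x - seb_center (proj_set S x)).

Definition critical S : set 'rV[R]_n :=
  [set z | ~ S z /\ grad_dist S z = 0].

Definition mu_critical (mu : R) S : set 'rV[R]_n :=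
  [set z | ~ S z /\ enorm (grad_dist S z) <= mu].

Definition affinely_independent (s : seq 'rV[R]_n) : bool :=
  if s is x0 :: s' then free [seq x - x0 | x <- s'] else true.

Definition convex_hull A : set 'rV[R]_n :=
  smallest (@convex_set R 'rV[R]_n) A.

Definition affine_set A : Prop :=
  forall x y (t : R), A x -> A y -> A ((1 - t) *: x + t *: y).

Definition affine_hull A : set 'rV[R]_n := smallest affine_set A.

Definition relative_interior A : set 'rV[R]_n :=
  [set x | A x /\
     exists2 r, 0 < r & eball x r `&` affine_hull A `<=` A].

Definition P1 S : Prop :=
  forall z0, critical S z0 ->
    (exists s : seq 'rV[R]_n,
        proj_set S z0 = [set` s] /\ affinely_independent s) /\
    relative_interior (convex_hull (proj_set S z0)) z0.

Definition P2 S : Prop := finite_set (critical S).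

Definition P3 S : Prop :=
  forall z0 x0, critical S z0 -> proj_set S z0 x0 ->
    exists delta alpha : R, 0 < delta /\ 0 < alpha /\
      forall y, (S `&` eball x0 delta) y ->
        enorm (x0 - z0) ^+ 2 + alpha * enorm (y - x0) ^+ 2
          <= enorm (y - z0) ^+ 2.

Definition P4 S : Prop :=
  exists C mu0 : R, 0 < C /\ 0 < mu0 < 1 /\
    forall mu : R, 0 <= mu < mu0 -> forall z, mu_critical mu S z ->
      exists2 z0, critical S z0 & enorm (z - z0) <= C * mu.

End Euclidean.

Section Differentiability.
Variables (R : realType) (m n : nat).
Implicit Types (f : 'rV[R]_m -> 'rV[R]_n) (U : set 'rV[R]_m).

(* f is of class C^k on U; U is meant to be open. *)
Fixpoint Ck (k : nat) U f : Prop :=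
  if k is k'.+1 then
    (forall u, U u -> differentiable f u) /\
    (forall v, Ck k' U (fun u => 'D_v f u))
  else forall u, U u -> {for u, continuous f}.

(* For f of class C^r,
   d^r f_u (v_1, ..., v_r) = D_{v_1} ( ... (D_{v_r} f)) u. *)
Definition iter_derive (vs : seq 'rV[R]_m) f : 'rV[R]_m -> 'rV[R]_n :=
  foldr (fun v g => (fun u => 'D_v g u)) f vs.

(* Operator norm of the r-linear map d^r f_u, for the Euclidean norms. *)
Definition diff_opnorm (r : nat) f (u : 'rV[R]_m) : \bar R :=
  ereal_sup [set (enorm (iter_derive vs f u))%:E |
             vs in [set vs : r.-tuple 'rV[R]_m |
                    forall v : 'rV[R]_m, v \in tval vs -> enorm v <= 1]].

End Differentiability.

Section Manifold.
Variables (R : realType) (m : nat) (M : topologicalType).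

(* A chart (in the sense of a local parametrization) of M: a homeomorphism
   from an open subset of R^m onto an open subset of M. The values of the two
   maps outside of these open sets are irrelevant. *)
Record chart := Chart {
  chart_dom : set 'rV[R]_m ;
  chart_map :> 'rV[R]_m -> M ;
  chart_inv : M -> 'rV[R]_m ;
  chart_dom_open : open chart_dom ;
  chart_img_open : open (chart_map @` chart_dom) ;
  chart_mapK : {in chart_dom, cancel chart_map chart_inv} ;
  chart_map_cont : forall u, chart_dom u -> {for u, continuous chart_map} ;
  chart_inv_cont : forall x, (chart_map @` chart_dom) x ->
    {for x, continuous chart_inv} }.

Definition chart_img (c : chart) : set M := c @` chart_dom c.

Definition Ck_transition (k : nat) (c c' : chart) : Prop :=
  Ck k (chart_dom c `&` c @^-1` chart_img c') (chart_inv c' \o c).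

Definition Ck_compatible (k : nat) (c c' : chart) : Prop :=
  Ck_transition k c c' /\ Ck_transition k c' c.

(* A C^k manifold of dimension m, without boundary; the C^k structure is given
   by the C^k atlas A. *)
Record Ck_manifold (k : nat) (A : set chart) : Prop := {
  manifold_hausdorff : hausdorff_space M ;
  manifold_countable : @second_countable M ;
  manifold_cover : \bigcup_(c in A) chart_img c = [set: M] ;
  manifold_compat : forall c c', A c -> A c' -> Ck_compatible k c c' }.

(* Membership in the maximal C^k atlas generated by A. *)
Definition Ck_chart (k : nat) (A : set chart) (c : chart) : Prop :=
  forall c', A c' -> Ck_compatible k c c'.

(* A finite atlas (phi_j, U_j), where phi_j is the restriction to U_j of a
   chart of the C^k structure whose domain contains the compact closure
   of U_j. *)
Record finite_atlas (k : nat) (A : set chart) (J : finType)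
    (phi : J -> chart) (U : J -> set 'rV[R]_m) : Prop := {
  finite_atlas_chart : forall j, Ck_chart k A (phi j) ;
  finite_atlas_open : forall j, open (U j) ;
  finite_atlas_compact : forall j, compact (closure (U j)) ;
  finite_atlas_sub : forall j, closure (U j) `<=` chart_dom (phi j) ;
  finite_atlas_cover : \bigcup_j (phi j @` U j) = [set: M] }.

Variable D : nat.
Implicit Types f : M -> 'rV[R]_D.

Definition C2 (A : set chart) : set (M -> 'rV[R]_D) :=
  [set f : M -> 'rV[R]_D | forall c, A c -> Ck 2 (chart_dom c) (f \o c)].

Definition immersion (A : set chart) f : Prop :=
  forall c u, A c -> chart_dom c u -> injective ('d (f \o c) u).

Definition homeo_onto_image f : Prop :=
  [/\ injective f, continuous f &
      forall O, open O -> exists2 V, open V & f @` O = V `&` range f].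

Definition Emb2 (A : set chart) : set (M -> 'rV[R]_D) :=
  [set f : M -> 'rV[R]_D | [/\ C2 A f, immersion A f & homeo_onto_image f]].

Definition C2norm (J : finType) (phi : J -> chart) (U : J -> set 'rV[R]_m) f :
    \bar R :=
  \big[maxe/0%E]_(r < 3) \big[maxe/0%E]_(j : J)
    ereal_sup [set diff_opnorm r (f \o phi j) u | u in U j].

(* Neighborhoods of i in Emb2, for the topology induced by C2norm. *)
Definition Emb2_nbhs (A : set chart) (J : finType) (phi : J -> chart)
    (U : J -> set 'rV[R]_m) (i : M -> 'rV[R]_D) (N : set (M -> 'rV[R]_D)) :
    Prop :=
  N `<=` Emb2 A /\
  exists2 eta : R, 0 < eta &
    forall f, Emb2 A f -> (C2norm phi U (f \- i)%R < eta%:E)%E -> N f.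

End Manifold.

(* Main.v *)
Require Import Defs.
From HB Require Import structures.
From mathcomp Require Import all_boot all_order all_algebra.
From mathcomp Require Import all_classical all_reals all_analysis.
From mathcomp Require Import ring lra.

(* A critical point z of i with projections x_1, ..., x_n solves a square
   system in z, the parameters u_j of the x_j, barycentric weights l_j and the
   squared radius rho: z - f(u_j) is normal to the manifold, |z - f(u_j)|^2 = rho,
   z = sum_j l_j f(u_j) and sum_j l_j = 1. Conversely, by (P3), which makes the
   Hessian of the squared distance positive definite at the projections, the
   solutions of the system near a critical point of i are critical points, also
   for the embeddings C^2-close to i, and a mu-critical point is a solution up
   to an error O(mu). The derivative of the system is invertible, because (P1)
   and (P3) make the equations other than the barycenter equation submersive,
   and a kernel vector would then yield points contradicting (P4). As the system
   is strictly differentiable uniformly over the nearby embeddings, each critical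
   point of i has exactly one counterpart nearby, at distance O(mu) from all
   mu-critical points of this neighborhood. Away from the critical points of i
   the gradient stays bounded below, by compactness. *)

Set Implicit Arguments.
Unset Strict Implicit.
Unset Printing Implicit Defensive.

Import Order.TTheory GRing.Theory Num.Theory.
Import numFieldNormedType.Exports.
Local Open Scope classical_set_scope.
Local Open Scope ring_scope.

(** The embeddings range over an infinite-dimensional set, while the radii and constants must not
    depend on them. The implicit function theorem is therefore replaced by its quantitative core: if
    all members of a family have, near one point, the same strict derivative up to a small error,
    then inverting that single matrix gives injectivity and solvability with common radii and
    constants. The system contains first derivatives of the embedding, so it is only of class C^1;
    C^2-closeness is what makes its strict derivative uniform. The equations other than the
    barycenter one are isolated because their zeros are centers z whose projections are known
    explicitly, one on each patch, whether or not z is critical. Such points occur twice: the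
    mu-critical points are of this kind, and so are the test points to which (P4) is applied. A
    degenerate barycenter equation is excluded by the linear bound in (P4): a direction of
    degeneracy for z would produce gradients that are negligible compared with the distance to
    z0. *)

Section EuclideanNorm.
Variables (R : realType) (n : nat).
Implicit Types (x y z w : 'rV[R]_n) (a : R).

Definition dot x y : R := \sum_(i < n) x ord0 i * y ord0 i.

Lemma dotC x y : dot x y = dot y x.
Proof. by apply: eq_bigr => i _; rewrite mulrC. Qed.

Lemma dotDl x y z : dot (x + y) z = dot x z + dot y z.
Proof. by rewrite -big_split; apply: eq_bigr => i _; rewrite mxE mulrDl. Qed.

Lemma dotZl a x y : dot (a *: x) y = a * dot x y.
Proof. by rewrite mulr_sumr; apply: eq_bigr => i _; rewrite mxE mulrA. Qed.

Lemma dotDr x y z : dot x (y + z) = dot x y + dot x z.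
Proof. by rewrite dotC dotDl !(dotC x). Qed.

Lemma dotZr a x y : dot x (a *: y) = a * dot x y.
Proof. by rewrite dotC dotZl dotC. Qed.

Lemma dotNl x y : dot (- x) y = - dot x y.
Proof. by rewrite -scaleN1r dotZl mulN1r. Qed.

Lemma dotNr x y : dot x (- y) = - dot x y.
Proof. by rewrite dotC dotNl dotC. Qed.

Lemma dotBl x y z : dot (x - y) z = dot x z - dot y z.
Proof. by rewrite dotDl dotNl. Qed.

Lemma dotBr x y z : dot x (y - z) = dot x y - dot x z.
Proof. by rewrite dotDr dotNr. Qed.

Lemma dot0l x : dot 0 x = 0.
Proof. by rewrite -(scale0r x) dotZl mul0r. Qed.

Lemma dot_suml (I : Type) (r : seq I) (F : I -> 'rV[R]_n) y :
  dot (\sum_(i <- r) F i) y = \sum_(i <- r) dot (F i) y.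
Proof. by elim/big_rec2: _ => [|i u v _ <-]; rewrite ?dot0l ?dotDl. Qed.

Lemma dot_ge0 x : 0 <= dot x x.
Proof. by apply: sumr_ge0 => i _; rewrite -expr2 sqr_ge0. Qed.

Lemma enorm_ge0 x : 0 <= enorm x.
Proof. exact: sqrtr_ge0. Qed.

Lemma enorm_sqr x : enorm x ^+ 2 = dot x x.
Proof.
rewrite sqr_sqrtr; first by apply: eq_bigr => i _; rewrite expr2.
by apply: sumr_ge0 => i _; rewrite sqr_ge0.
Qed.

Lemma enorm0 : enorm (0 : 'rV[R]_n) = 0.
Proof. by apply/eqP; rewrite -sqrf_eq0 enorm_sqr dot0l. Qed.

Lemma enormZ a x : enorm (a *: x) = `|a| * enorm x.
Proof.
apply/eqP; rewrite -(@eqrXn2 _ 2) ?mulr_ge0 ?enorm_ge0//.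
by rewrite exprMn !enorm_sqr dotZl dotZr mulrA -expr2 real_normK ?num_real.
Qed.

Lemma enormN x : enorm (- x) = enorm x.
Proof. by rewrite -scaleN1r enormZ normrN1 mul1r. Qed.

Lemma enormBC x y : enorm (x - y) = enorm (y - x).
Proof. by rewrite -enormN opprB. Qed.

Lemma enorm_eq0 x : enorm x = 0 -> x = 0.
Proof.
move=> x0; apply/rowP => i; rewrite mxE; apply/eqP; rewrite -sqrf_eq0.
have := enorm_sqr x; rewrite x0 expr0n /= => /esym/eqP.
rewrite /dot psumr_eq0; last by move=> j _; rewrite -expr2 sqr_ge0.
by move=> /allP/(_ i (mem_index_enum i)); rewrite -expr2.
Qed.

Lemma enorm_gt0 x : x <> 0 -> 0 < enorm x.
Proof. by move=> x0; rewrite lt_neqAle enorm_ge0 andbT eq_sym; apply/eqP => /enorm_eq0. Qed.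

Lemma dot_le_enorm x y : dot x y <= enorm x * enorm y.
Proof.
have [/enorm_eq0->|x0] := eqVneq (enorm x) 0; first by rewrite enorm0 dot0l mul0r.
have x_gt0 : 0 < enorm x by rewrite lt_neqAle eq_sym x0 enorm_ge0.
have := dot_ge0 (enorm y *: x - enorm x *: y).
rewrite dotBl !dotBr !dotZl !dotZr (dotC y x) -!enorm_sqr.
set X := enorm x; set Y := enorm y => h.
have [Y0|Y0] := eqVneq Y 0.
  by rewrite (enorm_eq0 Y0) dotC dot0l Y0 mulr0.
have Y_gt0 : 0 < Y by rewrite lt_neqAle eq_sym Y0 enorm_ge0.
have XY : 0 < X * Y by rewrite mulr_gt0.
by rewrite -subr_ge0 -(pmulr_rge0 _ XY); nra.
Qed.

Lemma enormD x y : enorm (x + y) <= enorm x + enorm y.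
Proof.
rewrite -(@ler_pXn2r _ 2) ?nnegrE ?addr_ge0 ?enorm_ge0//.
rewrite enorm_sqr dotDl !dotDr (dotC y x) -!enorm_sqr.
by have := dot_le_enorm x y; nra.
Qed.

Lemma enormB_le x y z : enorm (x - z) <= enorm (x - y) + enorm (y - z).
Proof. by rewrite (le_trans _ (enormD _ _))// addrA subrK. Qed.

Lemma enorm_sub x y : enorm x - enorm y <= enorm (x - y).
Proof. by have := enormB_le x y 0; rewrite !subr0 lerBlDr. Qed.

Lemma enorm_sum_le (I : Type) (r : seq I) (F : I -> 'rV[R]_n) :
  enorm (\sum_(i <- r) F i) <= \sum_(i <- r) enorm (F i).
Proof.
elim/big_rec2: _ => [|i u v _ h]; first by rewrite enorm0.
by rewrite (le_trans (enormD _ _))// lerD2l.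
Qed.

Lemma enorm_sqrB x y :
  enorm (x - y) ^+ 2 = enorm x ^+ 2 - 2 * dot x y + enorm y ^+ 2.
Proof. rewrite !enorm_sqr dotBl !dotBr (dotC y x); ring. Qed.

Lemma coord_le_norm (p q : nat) (x : 'M[R]_(p, q)) i j : `|x i j| <= `|x|.
Proof.
rewrite [leRHS]/Num.norm /= mx_normrE.
exact: (le_bigmax _ (fun ij => `|x ij.1 ij.2|) (i, j)).
Qed.

Lemma norm_le_coord (p q : nat) (x : 'M[R]_(p, q)) e :
  0 <= e -> (forall i j, `|x i j| <= e) -> `|x| <= e.
Proof.
move=> e0 h; rewrite [leLHS]/Num.norm /= mx_normrE.
by apply/bigmax_leP; split.
Qed.

Lemma coord_le_enorm x i : `|x ord0 i| <= enorm x.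
Proof.
rewrite -(@ler_pXn2r _ 2) ?nnegrE ?enorm_ge0 ?normr_ge0//.
rewrite enorm_sqr real_normK ?num_real// /dot (bigD1 i)//= -expr2 lerDl.
by apply: sumr_ge0 => j _; rewrite -expr2 sqr_ge0.
Qed.

Lemma norm_le_enorm x : `|x| <= enorm x.
Proof.
apply: norm_le_coord; first exact: enorm_ge0.
by move=> i j; rewrite (ord1 i) coord_le_enorm.
Qed.

Lemma enorm_le_norm x : enorm x <= n%:R * `|x|.
Proof.
rewrite -(@ler_pXn2r _ 2) ?nnegrE ?enorm_ge0 ?mulr_ge0//.
rewrite enorm_sqr (@le_trans _ _ (\sum_(i < n) `|x| ^+ 2))//.
  apply: ler_sum => i _; rewrite -expr2 -[leLHS]real_normK ?num_real//.
  by rewrite ler_pXn2r ?nnegrE// coord_le_norm.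
rewrite sumr_const card_ord exprMn -[leLHS]mulr_natl ler_wpM2r ?sqr_ge0//.
by rewrite expr2 -natrM ler_nat; case: (n) => // k; rewrite leq_pmulr.
Qed.

Lemma continuous_enorm : continuous (@enorm R n).
Proof.
move=> x; apply/(@cvgrPdist_lt _ _ _ _ (nbhs_filter x)) => e e0; near=> y.
have : enorm (x - y) < e.
  rewrite (le_lt_trans (enorm_le_norm _))//.
  rewrite (@le_lt_trans _ _ (n.+1%:R * `|x - y|)) ?ler_wpM2r ?ler_nat//.
  rewrite mulrC -ltr_pdivlMr ?ltr0n//; near: y.
  by apply: cvgr_dist_lt => //; rewrite divr_gt0 ?ltr0n.
apply: le_lt_trans; rewrite ler_norml enorm_sub andbT lerNl opprB.
by rewrite enormBC enorm_sub.
Unshelve. all: by end_near. Qed.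

Lemma continuous_dist (T : topologicalType) (f : T -> 'rV[R]_n) z :
  continuous f -> continuous (fun t => enorm (z - f t)).
Proof.
move=> cf t; apply: (@continuous_comp _ _ _ (fun t => z - f t) (@enorm R n)).
  by apply: cvgB; [exact: cvg_cst|exact: cf].
exact: continuous_enorm.
Qed.

Lemma continuous_enormB z : continuous (fun y => enorm (z - y)).
Proof. by apply: continuous_dist => y; exact: cvg_id. Qed.

Lemma enorm_le_sqrt x a : enorm x ^+ 2 <= a -> enorm x <= Num.sqrt a.
Proof.
by move=> h; rewrite -(ger0_norm (enorm_ge0 x)) -sqrtr_sqr ler_wsqrtr.
Qed.

Lemma continuous_dot w : continuous (dot ^~ w).
Proof.
apply: continuous_big => [|i _ x]; first exact: add_continuous.
apply: (@continuousM _ _ (fun v : 'rV[R]_n => v ord0 i) (cst (w ord0 i))).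
  exact: coord_continuous.
exact: cst_continuous.
Qed.

Lemma nbhs_eball x e : 0 < e -> nbhs x (eball x e).
Proof.
move=> e0; near=> y; rewrite /eball /= enormBC (le_lt_trans (enorm_le_norm _))//.
rewrite (@le_lt_trans _ _ (n.+1%:R * `|x - y|)) ?ler_wpM2r ?ler_nat//.
rewrite mulrC -ltr_pdivlMr ?ltr0n//; near: y.
by apply: cvgr_dist_lt => //; rewrite divr_gt0 ?ltr0n.
Unshelve. all: by end_near. Qed.

End EuclideanNorm.

(** * The generalized gradient of a distance function *)

Section DistanceFunction.
Variables (R : realType) (n : nat).
Implicit Types (x y z w c : 'rV[R]_n) (S A : set 'rV[R]_n).

Lemma dist_set_le S x y : S y -> dist_set S x <= enorm (x - y).
Proof.
move=> Sy; apply: ge_inf; last by exists y.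
by exists 0 => _ [y' _ <-]; exact: enorm_ge0.
Qed.

Lemma proj_set_intro S x y : S y ->
  (forall y', S y' -> enorm (x - y) <= enorm (x - y')) -> proj_set S x y.
Proof.
move=> Sy ymin; split => //; apply/eqP; rewrite eq_le dist_set_le// andbT.
by apply: lb_le_inf => [|_ [y' Sy' <-]]; [exists (enorm (x - y)); exists y|exact: ymin].
Qed.

Lemma proj_set_exists S x : compact S -> S !=set0 -> proj_set S x !=set0.
Proof.
move=> cS S0; have /(compact_EVT_min S0 cS)[y] :
    {within S, continuous (fun y => enorm (x - y))}.
  apply: continuous_subspaceT; exact: continuous_enormB.
rewrite inE => Sy ymin; exists y; apply: proj_set_intro => // y' Sy'.
by apply: ymin; rewrite inE.
Qed.

Lemma dist_set_gt0 S x : compact S -> S !=set0 -> ~ S x -> 0 < dist_set S x.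
Proof.
move=> cS S0 Sx; have [y [Sy <-]] := proj_set_exists x cS S0.
by apply: enorm_gt0 => /eqP; rewrite subr_eq0 => /eqP xy; apply: Sx; rewrite xy.
Qed.

Lemma closed_le_fun (T : topologicalType) (f : T -> R) a :
  continuous f -> closed [set t | f t <= a].
Proof.
by move=> cf; apply: (@preimage_closed _ _ f [set r | r <= a]) => //; exact: closed_le.
Qed.

Lemma closed_eq_fun (T : topologicalType) (f : T -> R) a :
  continuous f -> closed [set t | f t = a].
Proof.
by move=> cf; apply: (@preimage_closed _ _ f [set a]) => //; exact: closed_eq.
Qed.

Lemma proj_set_compact S x : compact S -> compact (proj_set S x).
Proof.
move=> cS; rewrite (_ : proj_set S x =
  S `&` [set y | enorm (x - y) = dist_set S x]) //.
apply: compact_closedI => //; apply: closed_eq_fun.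
by exact: continuous_enormB.
Qed.

(** On the compact set S minus V the distance to z attains a minimum, which exceeds the distance to
    S because no projection lies there; k is the gap. *)
Lemma near_proj_set S V z : compact S -> open V -> proj_set S z `<=` V ->
  exists2 k, 0 < k & forall y, S y -> enorm (z - y) < dist_set S z + k -> V y.
Proof.
move=> cS oV pV; have cSV : compact (S `&` ~` V).
  by apply: compact_closedI => //; exact: open_closedC.
have [SV0|/set0P SV0] := eqVneq (S `&` ~` V) set0.
  exists 1 => // y Sy _; apply: contrapT => Vy.
  by have : (S `&` ~` V) y by []; rewrite SV0.
have /(compact_EVT_min SV0 cSV)[y] :
    {within S `&` ~` V, continuous (fun y => enorm (z - y))}.
  apply: continuous_subspaceT; exact: continuous_enormB.
rewrite inE => -[Sy Vy] ymin; exists (enorm (z - y) - dist_set S z).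
  rewrite subr_gt0 lt_neqAle dist_set_le// andbT; apply/eqP => zy.
  by apply: Vy; apply: pV; split.
move=> y' Sy'; rewrite addrCA subrr addr0 => lty'; apply: contrapT => Vy'.
by have := ymin y'; rewrite inE => /(_ (conj Sy' Vy')); rewrite leNgt lty'.
Qed.

Lemma ecball_compact c r : compact (ecball c r).
Proof.
apply: bounded_closed_compact.
  exists (r + enorm c); split; first exact: num_real.
  move=> M ltM x; rewrite /ecball /= => xc; rewrite (le_trans (norm_le_enorm _))//.
  by have := enormD (x - c) c; rewrite subrK => h;
    rewrite (le_trans h)// ltW// (le_lt_trans _ ltM)// lerD2r.
rewrite (_ : ecball c r = [set x | enorm (c - x) <= r]); last first.
  by apply/seteqP; split => x; rewrite /ecball /= enormBC.
apply: closed_le_fun; exact: continuous_enormB.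
Qed.

Lemma is_seb_center_exists A : compact A -> A !=set0 ->
  exists c, is_seb_center A c.
Proof.
move=> cA [y0 Ay0].
pose rho c := sup [set enorm (c - y) | y in A].
have rhoP c : has_sup [set enorm (c - y) | y in A].
  split; first by exists (enorm (c - y0)); exists y0.
  have A0 : A !=set0 by exists y0.
  have /(compact_EVT_max A0 cA)[y1 _ y1max] :
      {within A, continuous (fun y => enorm (c - y))}.
    apply: continuous_subspaceT; exact: continuous_enormB.
  by exists (enorm (c - y1)) => _ [y Ay <-]; apply: y1max; rewrite inE.
have le_rho c y : A y -> enorm (c - y) <= rho c.
  by move=> Ay; apply: sup_upper_bound => //; exists y.
have rho_le c r : A `<=` ecball c r -> rho c <= r.
  move=> Ac; apply: ge_sup; first exact: (rhoP c).1.
  by move=> _ [y Ay <-]; rewrite enormBC; exact: Ac.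
have rho_lip c c' : rho c <= rho c' + enorm (c - c').
  apply: rho_le => y Ay; rewrite /ecball /= (enormBC y c).
  by have := enormB_le c c' y; rewrite (enormBC c c'); have := le_rho c' y Ay; lra.
have crho : continuous rho.
  move=> c; apply/(@cvgrPdist_lt _ _ _ _ (nbhs_filter c)) => e e0.
  apply: filterS (nbhs_eball c e0) => c'; rewrite /eball /=; apply: le_lt_trans.
  rewrite ler_norml; have := rho_lip c c'; have := rho_lip c' c.
  rewrite (enormBC c c'); lra.
(* A center outside K is farther than [rho y0] from the point y0 of A, so it is no better than y0
   itself: minimizing over K is enough. *)
pose K := ecball y0 (rho y0).
have K0 : K !=set0.
  by exists y0; rewrite /K /ecball /= subrr enorm0 (le_trans _ (le_rho _ _ Ay0))// enorm_ge0.
have /(compact_EVT_min K0 (@ecball_compact _ _))[c] : {within K, continuous rho}.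
  exact: continuous_subspaceT.
rewrite inE => Kc cmin; exists c; exists (rho c); split.
  by move=> y Ay; rewrite /ecball /= enormBC le_rho.
move=> c' r' Ac'; have [Kc'|Kc'] := pselect (K c').
  by rewrite (le_trans _ (rho_le _ _ Ac'))// cmin// inE.
have := cmin y0; rewrite inE => /(_ _)/le_trans; apply.
  by rewrite /K /ecball /= subrr enorm0 (le_trans _ (le_rho _ _ Ay0))// enorm_ge0.
move/negP: Kc'; rewrite -ltNge => /ltW/le_trans; apply.
by rewrite enormBC; exact: Ac'.
Qed.

Lemma seb_centerP A : compact A -> A !=set0 -> is_seb_center A (seb_center A).
Proof.
move=> cA A0; have [c Ac] := is_seb_center_exists cA A0.
by rewrite /seb_center; apply: xgetPex; exists c.
Qed.

Lemma seb_center1 y : seb_center [set y] = y.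
Proof.
have [||r [Ar rmin]] := @seb_centerP [set y]; [exact: compact_set1|by exists y|].
have : r <= 0.
  by apply: (rmin y) => _ ->; rewrite /ecball /= subrr enorm0.
move=> r0; have := Ar y erefl; rewrite /ecball /= => /le_trans/(_ r0) h.
apply/esym/eqP; rewrite -subr_eq0; apply/eqP/enorm_eq0/eqP.
by rewrite eq_le h enorm_ge0.
Qed.

(** The smallest radius is at most d, so y, which lies on the sphere of radius d around z, is no
    farther from c than from z; expanding the squares gives the bound. *)
Lemma seb_center_dot A z d c y : is_seb_center A c ->
  A `<=` ecball z d -> A y -> enorm (y - z) = d ->
  enorm (c - z) ^+ 2 <= 2 * dot (y - z) (c - z).
Proof.
move=> [r [Ar rmin]] /rmin rd Ay yd; have := Ar y Ay; rewrite /ecball /=.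
rewrite (_ : y - c = (y - z) - (c - z)); last by rewrite opprB addrA subrK.
have := enorm_sqrB (y - z) (c - z); rewrite yd.
have := enorm_ge0 (y - z - (c - z)); rewrite -yd in rd *; move: rd.
have := enorm_ge0 (y - z).
set a := enorm (y - z - _); set b := enorm (y - z); set u := enorm (c - z) => h1 h2 h3 h4 h5.
have : a ^+ 2 <= b ^+ 2 by rewrite ler_pXn2r ?nnegrE// (le_trans h5).
by rewrite h4; lra.
Qed.

(* A positive slope [k] in the direction [w] lets the ball slide from [z], so
   the smallest enclosing ball is definitely smaller than the one at [z]. *)
Lemma seb_center_gap A z d c w k mu : is_seb_center A c -> A !=set0 ->
  (forall y, A y -> enorm (y - z) = d) ->
  0 < k -> (forall y, A y -> k <= dot (y - z) w) ->
  0 <= mu <= 1 -> enorm (c - z) <= mu * d ->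
  k ^+ 2 <= 2 * mu * d ^+ 2 * enorm w ^+ 2.
Proof.
move=> [r [Ar rmin]] [y Ay] Ad k0 Ak /andP[mu0 mu1] cz.
have w0 : 0 < enorm w.
  apply: enorm_gt0 => w0; have := Ak y Ay.
  by rewrite w0 dotC dot0l leNgt k0.
have d0 : 0 <= d by rewrite -(Ad y Ay) enorm_ge0.
(* This t minimizes d^2 - 2 t k + t^2 W^2, which bounds the squared distances from A to z + t w. *)
set W := enorm w in w0 *; pose t := k / W ^+ 2.
have key y' : A y' -> enorm (y' - (z + t *: w)) ^+ 2 <= d ^+ 2 - k ^+ 2 / W ^+ 2.
  move=> Ay'; rewrite opprD addrA enorm_sqrB dotZr enormZ (Ad _ Ay')
    exprMn real_normK ?num_real//.
  rewrite -/W; have := Ak _ Ay'; set s := dot _ _ => ks.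
  have t0 : 0 < t by rewrite divr_gt0// exprn_gt0.
  have -> : k ^+ 2 / W ^+ 2 = t * k by rewrite /t; field; rewrite gt_eqF.
  have -> : t ^+ 2 * W ^+ 2 = t * k by rewrite /t; field; rewrite gt_eqF.
  by nra.
have e0 : 0 <= d ^+ 2 - k ^+ 2 / W ^+ 2 by rewrite (le_trans _ (key y Ay))// sqr_ge0.
have : r <= Num.sqrt (d ^+ 2 - k ^+ 2 / W ^+ 2).
  apply: (rmin (z + t *: w)) => y' Ay'; rewrite /ecball /=.
  by apply: enorm_le_sqrt; exact: key.
have : (1 - mu) * d <= r.
  have := Ar y Ay; rewrite /ecball /=; have := enormB_le y c z.
  by rewrite (Ad y Ay); lra.
move=> h1 h2; have h3 : ((1 - mu) * d) ^+ 2 <= d ^+ 2 - k ^+ 2 / W ^+ 2.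
  rewrite -(sqr_sqrtr e0) ler_pXn2r ?nnegrE ?sqrtr_ge0 ?mulr_ge0 ?subr_ge0//.
  exact: le_trans h2.
have : k ^+ 2 / W ^+ 2 <= 2 * mu * d ^+ 2.
  have : 0 <= (mu * d) ^+ 2 by rewrite sqr_ge0.
  by move: h3; rewrite !exprMn; nra.
by rewrite ler_pdivrMr ?exprn_gt0.
Qed.

Definition comb (p : nat) (y : 'I_p -> 'rV[R]_n) (l : 'I_p -> R) : 'rV[R]_n :=
  \sum_j l j *: y j.

Lemma continuous_comb p (y : 'I_p -> 'rV[R]_n) :
  continuous (fun l : 'rV[R]_p => comb y (l ord0)).
Proof.
apply: continuous_big => [|j _ l]; first exact: add_continuous.
apply: (@continuousZl _ _ _ (fun v : 'rV[R]_p => v ord0 j)).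
exact: coord_continuous.
Qed.

(** Let q be the point of the convex hull nearest to c. The angles at q between c and the points are
    not acute, so moving the center from c to q brings all of them closer, strictly if c <> q,
    against minimality. The predicate P keeps one index type when some of the points are
    discarded. *)
Lemma seb_center_comb p (y : 'I_p -> 'rV[R]_n) (P : pred 'I_p) c :
  (exists j, P j) -> is_seb_center [set y j | j in [set j | P j]] c ->
  exists l : 'I_p -> R, [/\ forall j, 0 <= l j, \sum_j l j = 1,
    forall j, ~~ P j -> l j = 0 & c = comb y l].
Proof.
move=> [j0 Pj0] [r [Ar rmin]].
pose K := [set l : 'rV[R]_p | [/\ forall j, 0 <= l ord0 j, \sum_j l ord0 j = 1 &
  forall j, ~~ P j -> l ord0 j = 0]].
have cco j : continuous (fun l : 'rV[R]_p => l ord0 j) by exact: coord_continuous.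
have cK : compact K.
  apply: bounded_closed_compact.
    exists 1; split; first exact: num_real.
    move=> M ltM l [l0 l1 _]; apply: norm_le_coord; first by rewrite (le_trans ler01)// ltW.
    move=> i j; rewrite (ord1 i) ger0_norm// (le_trans _ (ltW ltM))// -l1.
    by rewrite (bigD1 j)//= lerDl sumr_ge0.
  rewrite (_ : K = \bigcap_j [set l | - l ord0 j <= 0] `&`
    [set l | \sum_j l ord0 j = 1] `&` \bigcap_(j in [set j | ~~ P j]) [set l | l ord0 j = 0]).
    apply: closedI; first apply: closedI.
    - apply: closed_bigI => j _; apply: closed_le_fun => l.
      by apply: (@continuousN _ _ _ (fun v : 'rV[R]_p => v ord0 j)); exact: cco.
    - apply: closed_eq_fun; apply: continuous_big => [|j _]; last exact: cco.
      exact: add_continuous.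
    - by apply: closed_bigI => j _; apply: closed_eq_fun; exact: cco.
  apply/seteqP; split => l.
    by move=> [l0 l1 lP]; split; [split => //|] => j /=; rewrite ?oppr_le0// => /lP.
  by move=> [[l0 l1] lP]; split => // j; rewrite -oppr_le0; exact: l0.
have K0 : K !=set0.
  exists (delta_mx ord0 j0); split => [j||j Pj].
  - by rewrite mxE; case: (_ && _).
  - rewrite (bigD1 j0)//= mxE !eqxx big1 ?addr0// => j /negPf jj0.
    by rewrite mxE jj0 andbF.
  - by rewrite mxE /=; case: eqP Pj => // ->; rewrite Pj0.
have /(compact_EVT_min K0 cK)[l] :
    {within K, continuous (fun l : 'rV[R]_p => enorm (c - comb y (l ord0)))}.
  apply: continuous_subspaceT; apply: continuous_dist; exact: continuous_comb.
rewrite inE => -[l0 l1 lP] lmin; exists (l ord0); split => //.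
set q := comb y (l ord0) in lmin *.
have obt j : P j -> dot (c - q) (y j - q) <= 0.
  move=> Pj; rewrite leNgt; apply/negP => dp.
  have step t : 0 <= t <= 1 -> enorm (c - q) ^+ 2 <= enorm (c - q - t *: (y j - q)) ^+ 2.
    move=> /andP[t0 t1].
    have := lmin ((1 - t) *: l + t *: delta_mx ord0 j); rewrite inE.
    have -> : comb y (((1 - t) *: l + t *: delta_mx ord0 j : 'rV_p) ord0) = q + t *: (y j - q).
      rewrite /comb (eq_bigr (fun i => (1 - t) *: (l ord0 i *: y i) +
          (t * (i == j)%:R) *: y i)); last first.
        by move=> i _; rewrite !mxE eqxx /= [LHS]scalerDl -[in LHS]scalerA.
      rewrite big_split /= -scaler_sumr -/(comb y (l ord0)) -/q (bigD1 j)//= big1 ?addr0.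
        by rewrite eqxx mulr1 scalerBl scale1r scalerBr addrAC addrA.
      by move=> i /negPf ->; rewrite mulr0 scale0r.
    rewrite opprD addrA => h; rewrite ler_pXn2r ?nnegrE ?enorm_ge0//; apply: h.
    split => [i||i Pi].
    - by rewrite !mxE addr_ge0 ?mulr_ge0 ?subr_ge0//; case: (_ && _).
    - rewrite (eq_bigr (fun i => (1 - t) * l ord0 i + t * (i == j)%:R)); last first.
        by move=> i _; rewrite !mxE eqxx.
      rewrite big_split /= -!mulr_sumr l1 (bigD1 j)//= eqxx big1 ?addr0 ?mulr1 ?subrK//.
      by move=> i /negPf ->.
    - rewrite !mxE (lP i Pi) mulr0 add0r.
      have [ij|_] := eqVneq i j; last by rewrite andbF mulr0.
      by move: Pi; rewrite ij Pj.
  have yq : 0 < enorm (y j - q).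
    by apply: enorm_gt0 => yq; move: dp; rewrite yq dotC dot0l ltxx.
  set s := dot _ _ in dp; set N := enorm (y j - q) in yq.
  (* The minimizer s / N^2 along the line may exceed 1; this shorter step stays on the segment and
     still decreases the distance to c. *)
  pose t := s / (s + N ^+ 2).
  have N2 : 0 < N ^+ 2 by rewrite exprn_gt0.
  have sN : 0 < s + N ^+ 2 by rewrite addr_gt0.
  have t0 : 0 < t by rewrite divr_gt0.
  have t1 : t <= 1 by rewrite ler_pdivrMr// mul1r lerDl ltW.
  have := step t; rewrite (ltW t0) t1 => /(_ isT).
  rewrite [leRHS]enorm_sqrB dotZr enormZ exprMn real_normK ?num_real// -/s -/N.
  have : t * (s + N ^+ 2) = s by rewrite /t divfK// gt_eqF.
  by nra.
have r_ge0 : 0 <= r by apply: le_trans (enorm_ge0 _) (Ar (y j0) _); exists j0.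
have key j : P j -> enorm (y j - q) ^+ 2 <= r ^+ 2 - enorm (c - q) ^+ 2.
  move=> Pj; have := Ar (y j); rewrite /ecball /= => /(_ (ex_intro2 _ _ j Pj erefl)).
  rewrite -(@ler_pXn2r _ 2) ?nnegrE ?enorm_ge0//.
  rewrite (_ : y j - c = (y j - q) - (c - q)); last by rewrite opprB addrA subrK.
  by rewrite (enorm_sqrB (y j - q) (c - q)) (dotC (y j - q)); have := obt _ Pj; lra.
have e0 : 0 <= r ^+ 2 - enorm (c - q) ^+ 2 by rewrite (le_trans _ (key j0 Pj0))// sqr_ge0.
have : r <= Num.sqrt (r ^+ 2 - enorm (c - q) ^+ 2).
  apply: (rmin q) => _ [j Pj <-]; rewrite /ecball /=.
  by apply: enorm_le_sqrt; exact: key.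
rewrite -(@ler_pXn2r _ 2) ?nnegrE ?sqrtr_ge0// sqr_sqrtr// => h.
have : enorm (c - q) ^+ 2 == 0 by rewrite eq_le sqr_ge0 andbT; lra.
by rewrite sqrf_eq0 => /eqP/enorm_eq0/eqP; rewrite subr_eq0 => /eqP.
Qed.

Lemma enorm_grad_dist S z : ~ S z ->
  enorm (grad_dist S z) = `|dist_set S z|^-1 * enorm (seb_center (proj_set S z) - z).
Proof.
by move=> Sz; rewrite /grad_dist memNset// enormZ normfV enormBC.
Qed.

Lemma mu_criticalP S mu z : compact S -> S !=set0 -> mu_critical mu S z ->
  ~ S z /\ enorm (seb_center (proj_set S z) - z) <= mu * dist_set S z.
Proof.
move=> cS S0 [Sz]; rewrite enorm_grad_dist// => h; split => //.
have d0 := dist_set_gt0 cS S0 Sz.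
by rewrite mulrC -ler_pdivrMl// -(gtr0_norm d0).
Qed.

Lemma mu_critical_intro S mu z : compact S -> S !=set0 -> ~ S z ->
  enorm (seb_center (proj_set S z) - z) <= mu * dist_set S z ->
  mu_critical mu S z.
Proof.
move=> cS S0 Sz h; split => //; rewrite enorm_grad_dist//.
have d0 := dist_set_gt0 cS S0 Sz.
by rewrite (gtr0_norm d0) ler_pdivrMl// mulrC.
Qed.

Lemma critical_mu0 S z : critical S z <-> mu_critical 0 S z.
Proof.
split => -[Sz h]; split => //; first by rewrite h enorm0.
by apply/enorm_eq0/eqP; rewrite eq_le h enorm_ge0.
Qed.

End DistanceFunction.

Lemma norm_mulmx_le (R : realType) (p q : nat) (v : 'rV[R]_p) (A : 'M[R]_(p, q)) :
  `|v *m A| <= p%:R * `|A| * `|v|.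
Proof.
apply: norm_le_coord => [|i j]; first by rewrite !mulr_ge0.
rewrite mxE (le_trans (ler_norm_sum _ _ _))//.
rewrite (@le_trans _ _ (\sum_(k < p) `|A| * `|v|))//.
  by apply: ler_sum => k _; rewrite normrM mulrC ler_pM// coord_le_norm.
by rewrite sumr_const card_ord -mulrA mulr_natl.
Qed.

(** * Affinely independent families *)

Section AffineFamilies.
Variables (R : realType) (n : nat).
Implicit Types (p : nat) (x z : 'rV[R]_n).

Definition affine_free p (y : 'I_p -> 'rV[R]_n) : Prop :=
  forall a : 'I_p -> R, \sum_j a j = 0 -> comb y a = 0 -> forall j, a j = 0.

(** Weights of sum zero are determined by those of all points but the first, so affine relations
    among the points are the linear relations among the differences with the first point. *)
Lemma affinely_independentP p (y : 'I_p -> 'rV[R]_n) (s : seq 'rV[R]_n) :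
  size s = p -> (forall j : 'I_p, nth 0 s j = y j) ->
  affinely_independent s <-> affine_free y.
Proof.
case: s => [|x0 s] /=.
  by move=> p0 _; split => // _ a _ _ j; have := ltn_ord j; rewrite -{2}p0.
case: p y => // p y [sp] ys.
have y0 : y ord0 = x0 by rewrite -ys.
have size_t : size [seq x - x0 | x <- s] == p by rewrite size_map sp.
pose X : p.-tuple 'rV[R]_n := Tuple size_t.
have XE (i : 'I_p) : X`_i = y (lift ord0 i) - y ord0.
  by rewrite /X /= (nth_map 0) ?sp// y0 -ys.
have combE (a : 'I_p.+1 -> R) : \sum_j a j = 0 ->
    comb y a = \sum_(i < p) a (lift ord0 i) *: X`_i.
  rewrite !big_ord_recl => /eqP; rewrite addr_eq0 => /eqP a0.
  rewrite /comb big_ord_recl a0 scaleNr scaler_suml -sumrN -big_split /=.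
  by apply: eq_bigr => i _; rewrite XE scalerBr addrC.
split => [/(@vector.freeP _ _ _ X) fX a a0|fy].
  rewrite combE// => /fX h; suff al i : a (lift ord0 i) = 0.
    move=> j; have [i ->|->] := unliftP ord0 j; first exact: al.
    by move: a0; rewrite big_ord_recl big1 ?addr0// => i _; exact: al.
  exact: (h i).
apply/(@vector.freeP _ _ _ X) => k k0 i.
pose a (j : 'I_p.+1) := if unlift ord0 j is Some i then k i else - \sum_i k i.
have al i' : a (lift ord0 i') = k i' by rewrite /a liftK.
have a0 : \sum_j a j = 0.
  rewrite big_ord_recl {1}/a unlift_none addrC.
  by apply/eqP; rewrite subr_eq0; apply/eqP; apply: eq_bigr => i' _; rewrite al.
rewrite -al; apply: fy => //; rewrite combE// -[RHS]k0.
by apply: eq_bigr => i' _; rewrite al.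
Qed.

Lemma affine_free_inj p (y : 'I_p -> 'rV[R]_n) : affine_free y -> injective y.
Proof.
move=> fy i j yij; apply/eqP/negPn/negP => ij.
pose a k : R := (k == i)%:R - (k == j)%:R.
have : a i = 0.
  apply: fy.
    rewrite sumrB (bigD1 i)//= big1; last by move=> k /negPf ->.
    by rewrite (bigD1 j)//= big1 ?eqxx ?subrr// => k /negPf ->.
  rewrite /comb; under eq_bigr do rewrite scalerBl.
  rewrite sumrB (bigD1 i)//= big1; last by move=> k /negPf ->; rewrite scale0r.
  rewrite (bigD1 j)//= big1; last by move=> k /negPf ->; rewrite scale0r.
  by rewrite !eqxx !addr0 yij subrr.
by rewrite /a eqxx (negPf ij) subr0 => /eqP; rewrite oner_eq0.
Qed.

Lemma combB p (y : 'I_p -> 'rV[R]_n) a b :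
  comb y a - comb y b = comb y (fun j => a j - b j).
Proof. by rewrite -sumrB; apply: eq_bigr => j _; rewrite scalerBl. Qed.

(** A column of ones beside the matrix of the points records the sum of the weights. Affine
    independence makes the resulting matrix row free, and its pseudo-inverse recovers the weights
    with a linear bound. *)
Lemma affine_free_bound p (y : 'I_p -> 'rV[R]_n) : affine_free y ->
  exists2 C, 0 < C & forall a j,
    `|a j| <= C * (enorm (comb y a) + `|\sum_j a j|).
Proof.
move=> fy; pose Y := \matrix_(j < p) y j.
pose B := row_mx Y (const_mx 1 : 'cV[R]_p).
have BE (a : 'rV[R]_p) : a *m B = row_mx (comb y (a ord0)) (\sum_j a ord0 j)%:M.
  rewrite mul_mx_row; congr row_mx.
    by rewrite mulmx_sum_row; apply: eq_bigr => j _; rewrite rowK.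
  apply/matrixP => i j; rewrite !ord1 !mxE eqxx mulr1n.
  by apply: eq_bigr => k _; rewrite mxE mulr1.
have Bfree : row_free B.
  rewrite -kermx_eq0; apply/eqP/row_matrixP => i; rewrite row0.
  set a := row i _; have : a *m B = 0 by rewrite -row_mul mulmx_ker row0.
  rewrite BE -[RHS]row_mx0 => /eq_row_mx [c0 /matrixP/(_ ord0 ord0)].
  rewrite !mxE eqxx mulr1n => s0; apply/rowP => j; rewrite [RHS]mxE.
  exact: (fy (a ord0)).
have C0 : 0 <= (n + 1)%:R * `|pinvmx B| by rewrite mulr_ge0.
exists ((n + 1)%:R * `|pinvmx B| + 1); first by rewrite ltr_wpDl.
move=> a j; pose v : 'rV[R]_p := \row_j a j.
have av : v ord0 = a by apply/funext => k; rewrite mxE.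
have vB : v = (v *m B) *m pinvmx B by rewrite -mulmxA mulmxVp// mulmx1.
rewrite -[X in `|X j|]av (le_trans (coord_le_norm _ _ _))// {1}vB.
rewrite (le_trans (norm_mulmx_le _ _))// ler_pM ?lerDl//.
have h0 : 0 <= enorm (comb y a) + `|\sum_j a j| by rewrite addr_ge0 ?enorm_ge0.
apply: norm_le_coord => // i k; rewrite (ord1 i) BE mxE av.
case: (fintype.split k) => l.
  by rewrite (le_trans (coord_le_enorm _ _))// lerDl.
by rewrite ord1 mxE eqxx mulr1n lerDr enorm_ge0.
Qed.

(** A relation among the y' is a relation among the y up to s * d, where s is the sum of the
    absolute weights. Then s <= p * C * d * s <= s / 2, hence s = 0. *)
Lemma affine_free_near p (y : 'I_p -> 'rV[R]_n) : affine_free y ->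
  exists2 d, 0 < d &
    forall y' : 'I_p -> 'rV[R]_n, (forall j, enorm (y' j - y j) <= d) -> affine_free y'.
Proof.
move=> /affine_free_bound[C C0 yC]; pose d := (2 * C * p.+1%:R)^-1.
have d0 : 0 < d by rewrite invr_gt0 !mulr_gt0 ?ltr0n.
exists d => // y' yd a a0 ya0.
pose s : R := \sum_j `|a j|.
have cs : enorm (comb y a) <= s * d.
  have -> : comb y a = - comb (fun j => y' j - y j) a.
    rewrite -[LHS]subr0 -ya0 -sumrB -sumrN; apply: eq_bigr => j _.
    by rewrite scalerBr opprB.
  rewrite enormN mulr_suml (le_trans (enorm_sum_le _ _))//.
  by apply: ler_sum => j _; rewrite enormZ ler_wpM2l.
have as_ j : `|a j| <= C * (s * d).
  by rewrite (le_trans (yC a j))// a0 normr0 addr0 ler_pM2l.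
have s0 : 0 <= s by apply: sumr_ge0.
have : s <= p%:R * (C * (s * d)).
  rewrite (le_trans (ler_sum _ (fun j _ => as_ j)))//.
  by rewrite sumr_const card_ord mulr_natl.
have -> : p%:R * (C * (s * d)) = s * (p%:R / p.+1%:R / 2).
  by rewrite /d; field; rewrite !gt_eqF ?ltr0n.
have pp : p%:R / p.+1%:R / 2 <= (1/2 : R).
  rewrite ler_pM2r ?invr_gt0// ler_pdivrMr ?ltr0n// mul1r ler_nat; exact: leqnSn.
move=> hs; have h2 := le_trans hs (ler_wpM2l s0 pp); clear hs.
have s00 : s = 0 by apply/eqP; rewrite eq_le s0 andbT; lra.
move=> j; apply/eqP; rewrite -normr_eq0 eq_le normr_ge0 andbT.
by rewrite (le_trans (as_ j))// s00 mul0r mulr0.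
Qed.

Lemma convex_setP (C : set 'rV[R]_n) : convex_set C <->
  forall x y (t : R), 0 <= t <= 1 -> C x -> C y -> C (t *: x + (1 - t) *: y).
Proof.
split=> [cC x y t t01 Cx Cy|cC x y l].
  pose tt := Itv01 (andP t01).1 (andP t01).2.
  by have := cC x y tt; rewrite !inE => /(_ Cx Cy).
by rewrite !inE => Cx Cy; apply: cC => //; apply/andP; split.
Qed.

Lemma convex_hull_comb p (y : 'I_p -> 'rV[R]_n) l :
  (forall j, 0 <= l j) -> \sum_j l j = 1 -> convex_hull (range y) (comb y l).
Proof.
move=> l0 l1 C [/convex_setP cC yC].
(* Dropping a point leaves weights whose sum is no longer 1, so the induction runs on normalized
   combinations; a vanishing partial sum is treated apart. *)
suff gen q (y' : 'I_q -> 'rV[R]_n) (l' : 'I_q -> R) : (forall j, C (y' j)) ->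
    (forall j, 0 <= l' j) -> 0 < \sum_j l' j ->
    C ((\sum_j l' j)^-1 *: comb y' l').
  have := gen p y l; rewrite l1 invr1 scale1r; apply => // j.
  by apply: yC; exists j.
elim: q y' l' => [|q IH] y' l' Cy' l'0; first by rewrite big_ord0 ltxx.
rewrite /comb !big_ord_recr /=; set s := \sum_(i < q) l' _; set c := \sum_(i < q) _.
set b := l' ord_max; have b0 : 0 <= b by exact: l'0.
have s_ge0 : 0 <= s by apply: sumr_ge0.
have [s0|s0] := eqVneq s 0.
  have -> : c = 0.
    apply: big1 => i _; suff -> : l' (widen_ord (leqnSn q) i) = 0 by rewrite scale0r.
    move/eqP: s0; rewrite psumr_eq0// => /allP/(_ i (mem_index_enum i))/eqP.
    exact.
  by rewrite s0 !add0r => b1; rewrite scalerA mulVf ?gt_eqF// scale1r.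
have s1 : 0 < s by rewrite lt_neqAle eq_sym s0.
move=> sb; have -> : (s + b)^-1 *: (c + b *: y' ord_max) =
    (s / (s + b)) *: (s^-1 *: c) + (1 - s / (s + b)) *: y' ord_max.
  rewrite scalerDr !scalerA; congr (_ *: _ + _ *: _); field; rewrite ?s0 ?gt_eqF//.
apply: cC => //; last exact: IH.
by rewrite divr_ge0 ?(ltW sb)//= ler_pdivrMr// mul1r lerDl.
Qed.

Lemma convex_hull_sub p (y : 'I_p -> 'rV[R]_n) x : convex_hull (range y) x ->
  exists l : 'I_p -> R, [/\ forall j, 0 <= l j, \sum_j l j = 1 & x = comb y l].
Proof.
move: x; apply: smallest_sub => [|_ [j _ <-]].
  apply/convex_setP => _ _ t /andP[t0 t1] [l [l0 l1 ->]] [k [k0 k1 ->]].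
  exists (fun j => t * l j + (1 - t) * k j); split.
  - by move=> j; rewrite addr_ge0 ?mulr_ge0// subr_ge0.
  - by rewrite big_split /= -!mulr_sumr l1 k1 !mulr1 addrC subrK.
  - rewrite /comb !scaler_sumr -big_split; apply: eq_bigr => j _.
    by rewrite [RHS]scalerDl !scalerA.
exists (fun i => (i == j)%:R); split => //.
- by rewrite (bigD1 j)//= eqxx big1 ?addr0// => i /negPf ->.
- rewrite /comb (bigD1 j)//= eqxx scale1r big1 ?addr0// => i /negPf ->.
  by rewrite scale0r.
Qed.

Lemma affine_hull_sub p (y : 'I_p -> 'rV[R]_n) x :
  affine_hull (convex_hull (range y)) x ->
  exists2 a : 'I_p -> R, \sum_j a j = 1 & x = comb y a.
Proof.
move: x; apply: smallest_sub => [_ _ t [a a1 ->] [b b1 ->]|z /convex_hull_sub[l [_ l1 ->]]].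
  exists (fun j => (1 - t) * a j + t * b j).
    by rewrite big_split /= -!mulr_sumr a1 b1 !mulr1 subrK.
  rewrite /comb !scaler_sumr -big_split; apply: eq_bigr => j _.
  by rewrite [RHS]scalerDl !scalerA.
by exists l.
Qed.

(** On the affine hull the weights are Lipschitz functions of the point, so they remain nonnegative
    on a ball whose radius is the least weight over the Lipschitz constant. *)
Lemma relative_interior_comb p (y : 'I_p -> 'rV[R]_n) l : affine_free y ->
  (forall j, 0 < l j) -> \sum_j l j = 1 ->
  relative_interior (convex_hull (range y)) (comb y l).
Proof.
move=> fy l0 l1; split; first by apply: convex_hull_comb => // j; exact: ltW.
have [C C0 yC] := affine_free_bound fy.
pose lm := \big[Num.min/1]_j l j.
have lm0 : 0 < lm by apply: lt_bigmin.
exists (lm / C); first by rewrite divr_gt0.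
move=> x [+ /affine_hull_sub[a a1 xa]]; rewrite {}xa /eball /= combB => small.
apply: convex_hull_comb => // j.
have : `|a j - l j| <= lm.
  rewrite (le_trans (yC (fun j => a j - l j) j))// sumrB a1 l1 subrr normr0 addr0.
  by rewrite -ler_pdivlMl// mulrC ltW.
rewrite ler_norml => /andP[h _]; have : lm <= l j by exact: bigmin_le_cond.
lra.
Qed.

(** If the weight of y k vanished, moving x slightly away from y k would stay in the hull while
    giving y k the weight - t < 0, against the uniqueness of the weights. *)
Lemma relative_interior_sub p (y : 'I_p -> 'rV[R]_n) x : affine_free y ->
  relative_interior (convex_hull (range y)) x ->
  exists l : 'I_p -> R, [/\ forall j, 0 < l j, \sum_j l j = 1 & x = comb y l].
Proof.
move=> fy [cx [r r0 rx]]; have [l [l0 l1 xl]] := convex_hull_sub cx.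
exists l; split => // k; rewrite lt_neqAle l0 andbT eq_sym; apply/eqP => lk.
pose t := r / (enorm (x - y k) + 1) / 2.
have e1 : 0 < enorm (x - y k) + 1 by rewrite ltr_wpDl ?enorm_ge0.
have t0 : 0 < t by rewrite !divr_gt0.
have : convex_hull (range y) (x + t *: (x - y k)).
  apply: rx; split.
    rewrite /eball /= addrAC subrr add0r enormZ gtr0_norm// /t.
    rewrite mulrAC ltr_pdivrMr// mulrAC ltr_pdivrMr//.
    by have := enorm_ge0 (x - y k); set e := enorm _ => *; nra.
  move=> B [aB hB]; have -> : x + t *: (x - y k) = (1 - (- t)) *: x + (- t) *: y k.
    by rewrite opprK scalerDl scale1r scalerBr scaleNr addrA.
  apply: aB; apply: hB => //.
  by apply: sub_gen_smallest; exists k.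
move=> /convex_hull_sub[l' [l'0 l'1 xl']].
have := fy (fun j => l j + t * (l j - (j == k)%:R) - l' j) _ _ k.
rewrite lk eqxx sub0r add0r mulrN1 => /(_ _ _)/eqP.
rewrite subr_eq0 lt_eqF; first (move=> h; suff: false by []; apply: h); last first.
  by rewrite (lt_le_trans _ (l'0 k))// oppr_lt0.
  rewrite -combB -xl' xl /comb; apply/eqP; rewrite subr_eq0; apply/eqP.
  rewrite [RHS](_ : _ = \sum_j (l j *: y j + t *: (l j *: y j)  - t *: ((j == k)%:R *: y j))).
    by apply: eq_bigr => j _; rewrite scalerDl mulrBr scalerBl !scalerA addrA.
  rewrite sumrB big_split /= -!scaler_sumr scalerBr addrA; congr (_ + _ - _ *: _).
  rewrite (bigD1 k)//= eqxx scale1r big1 ?addr0// => i /negPf ->.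
  by rewrite scale0r.
rewrite sumrB big_split /= -mulr_sumr sumrB l1 l'1 (bigD1 k)//= big1.
  by rewrite eqxx addr0 subrr mulr0 addr0 subrr.
by move=> i /negPf ->.
Qed.

End AffineFamilies.

(** Serves the application of [banach_fixed_point] to row vectors in [vsdiff_surj]. *)
HB.instance Definition _ (R : realType) (m n : nat) := Complete.on 'M[R]_(m, n).

(** * Uniform strict differentiability *)

Section StrictDifferentiability.
Variable R : realType.

Lemma finite_delta (I : finType) (P : I -> R -> Prop) :
  (forall i d d', 0 < d' -> d' <= d -> P i d -> P i d') ->
  (forall i, exists2 d, 0 < d & P i d) ->
  exists2 d, 0 < d & forall i, P i d.
Proof.
move=> Pm Pd; have /choice[d dP] : forall i, exists d, 0 < d /\ P i d.
  by move=> i; have [d d0 Pid] := Pd i; exists d.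
have m0 : 0 < \big[Num.min/1]_i d i by apply: lt_bigmin => // i _; exact: (dP i).1.
exists (\big[Num.min/1]_i d i) => // i.
by apply: Pm (dP i).2 => //; exact: bigmin_le_cond.
Qed.

Definition is_lin N (L : 'rV[R]_N -> R) :=
  forall a x y, L (a *: x + y) = a * L x + L y.

Section IsLin.
Variables (N : nat) (L : 'rV[R]_N -> R).
Hypothesis linL : is_lin L.

Lemma is_lin0 : L 0 = 0.
Proof. by have := linL 1 0 0; rewrite scaler0 addr0; lra. Qed.

Lemma is_linZ a x : L (a *: x) = a * L x.
Proof. by have := linL a x 0; rewrite is_lin0 !addr0. Qed.

Lemma is_linD x y : L (x + y) = L x + L y.
Proof. by have := linL 1 x y; rewrite scale1r mul1r. Qed.

Lemma is_lin_sum (I : Type) (r : seq I) (F : I -> 'rV[R]_N) :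
  L (\sum_(i <- r) F i) = \sum_(i <- r) L (F i).
Proof. by elim/big_rec2: _ => [|i u v _ <-]; rewrite ?is_lin0 ?is_linD. Qed.

Lemma is_lin_delta x : L x = \sum_k x ord0 k * L (delta_mx ord0 k).
Proof.
by rewrite {1}(row_sum_delta x) is_lin_sum; apply: eq_bigr => k _; rewrite is_linZ.
Qed.

Lemma is_lin_bound : exists2 C, 0 < C & forall x, `|L x| <= C * `|x|.
Proof.
exists (1 + \sum_k `|L (delta_mx ord0 k)|); first by rewrite ltr_wpDr ?sumr_ge0.
move=> x; rewrite is_lin_delta (le_trans (ler_norm_sum _ _ _))//.
rewrite mulrDl mul1r mulr_suml ler_wpDl// ler_sum// => k _.
by rewrite normrM mulrC ler_wpM2l// coord_le_norm.
Qed.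

End IsLin.

Variables (T : Type) (clo : R -> T -> Prop).
Hypothesis clo_mono : forall d d' g, clo d g -> d <= d' -> clo d' g.

Lemma clo_minl d d' g : clo (Num.min d d') g -> clo d g.
Proof. by move/clo_mono; apply; rewrite ge_min lexx. Qed.

Lemma clo_minr d d' g : clo (Num.min d d') g -> clo d' g.
Proof. by move/clo_mono; apply; rewrite ge_min lexx orbT. Qed.

(* Strict differentiability at [x0] of the members of a family which are close
   to a base point, with a common limit value [c] and derivative [L]. *)
Definition sdiff N (F : T -> 'rV[R]_N -> R) (x0 : 'rV[R]_N) (c : R)
    (L : 'rV[R]_N -> R) : Prop :=
  is_lin L /\ forall e, 0 < e -> exists2 d, 0 < d &
    forall g, clo d g -> forall x x', `|x - x0| < d -> `|x' - x0| < d ->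
      `|F g x - c| <= e /\ `|F g x - F g x' - L (x - x')| <= e * `|x - x'|.

Section Rules.
Variables (N : nat) (x0 : 'rV[R]_N).
Implicit Types (F G : T -> 'rV[R]_N -> R) (L K : 'rV[R]_N -> R) (c : R).

Lemma sdiff_ext F G c c' L K : (forall g x, F g x = G g x) -> c = c' -> L =1 K ->
  sdiff F x0 c L -> sdiff G x0 c' K.
Proof.
move=> FG <- /funext <- [linL FL]; split => // e /FL[d d0 h]; exists d => // g cg x x' xd xd'.
by rewrite -!FG; exact: h.
Qed.

Lemma sdiff_param (h : T -> R) c :
  (forall e, 0 < e -> exists2 d, 0 < d & forall g, clo d g -> `|h g - c| <= e) ->
  sdiff (fun g _ => h g) x0 c (fun=> 0).
Proof.
move=> hc; split=> [a x y|e /hc[d d0 hd]]; first by rewrite mulr0 addr0.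
exists d => // g /hd h' x x' _ _; split => //.
by rewrite !subrr normr0 mulr_ge0// (le_trans _ h').
Qed.

Lemma sdiff_cst c : sdiff (fun _ _ => c) x0 c (fun=> 0).
Proof. by apply: sdiff_param => e e0; exists 1 => // g _; rewrite subrr normr0 ltW. Qed.

Lemma sdiff_coord k : sdiff (fun _ x => x ord0 k) x0 (x0 ord0 k) (fun x => x ord0 k).
Proof.
split=> [a x y|e e0]; first by rewrite !mxE.
exists e => // _ _ x x' xe _; have := coord_le_norm (x - x0) ord0 k.
rewrite !mxE => h; split; first by rewrite (le_trans h)// ltW.
by rewrite subrr normr0 mulr_ge0// ltW.
Qed.

Lemma sdiffD F G c c' L K : sdiff F x0 c L -> sdiff G x0 c' K ->
  sdiff (fun g x => F g x + G g x) x0 (c + c') (fun x => L x + K x).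
Proof.
move=> [linL hF] [linK hG]; split=> [a x y|e e0].
  by rewrite linL linK; ring.
have e2 : 0 < e / 2 by rewrite divr_gt0.
have [d d0 Fd] := hF _ e2; have [d' d'0 Gd] := hG _ e2.
exists (Num.min d d'); first by rewrite lt_min d0.
move=> g cg x x'; rewrite !lt_min => /andP[xd xd'] /andP[x'd x'd'].
have [F1 F2] := Fd g (clo_minl cg) x x' xd x'd.
have [G1 G2] := Gd g (clo_minr cg) x x' xd' x'd'.
split.
  rewrite (_ : _ - _ = (F g x - c) + (G g x - c')); last ring.
  by rewrite (le_trans (ler_normD _ _))//; lra.
rewrite (_ : _ - _ = (F g x - F g x' - L (x - x')) + (G g x - G g x' - K (x - x'))); last ring.
by rewrite (le_trans (ler_normD _ _))//; lra.
Qed.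

Lemma sdiffM F G c c' L K : sdiff F x0 c L -> sdiff G x0 c' K ->
  sdiff (fun g x => F g x * G g x) x0 (c * c') (fun x => c * K x + c' * L x).
Proof.
move=> [linL hF] [linK hG]; split=> [a x y|e e0].
  by rewrite linL linK; ring.
have [CL CL0 bL] := is_lin_bound linL; have [CK CK0 bK] := is_lin_bound linK.
(* M is the sum of the constants of the four error terms into which the increment of the product is
   split below, estimated with e1 <= 1. *)
pose M := CL + CK + `|c| + `|c'| + 2.
have M0 : 0 < M by rewrite ltr_wpDl// !addr_ge0// ltW.
pose e1 := Num.min 1 (e / M).
have e10 : 0 < e1 by rewrite lt_min ltr01 divr_gt0.
have e11 : e1 <= 1 by rewrite ge_min lexx.
have e1e : e1 * M <= e by rewrite -ler_pdivlMr// ge_min lexx orbT.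
have [d d0 Fd] := hF _ e10; have [d' d'0 Gd] := hG _ e10.
exists (Num.min d d'); first by rewrite lt_min d0.
move=> g cg x x'; rewrite !lt_min => /andP[xd xd'] /andP[x'd x'd'].
have [F1 F2] := Fd g (clo_minl cg) x x' xd x'd.
have [G1 G2] := Gd g (clo_minr cg) x x' xd' x'd'.
have [G1' _] := Gd g (clo_minr cg) x' x x'd' xd'.
have nF : `|F g x| <= `|c| + 1.
  by rewrite -[F g x](subrK c) addrC (le_trans (ler_normD _ _))// lerD2l (le_trans F1).
have nG : `|G g x| <= `|c'| + 1.
  by rewrite -[G g x](subrK c') addrC (le_trans (ler_normD _ _))// lerD2l (le_trans G1).
have nG' : `|G g x'| <= `|c'| + 1.
  by rewrite -[G g x'](subrK c') addrC (le_trans (ler_normD _ _))// lerD2l (le_trans G1').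
have c0 := normr_ge0 c; have c'0 := normr_ge0 c'.
split.
  rewrite (_ : _ - _ = (F g x - c) * G g x + c * (G g x - c')); last ring.
  rewrite (le_trans _ e1e)// (le_trans (ler_normD _ _))// !normrM.
  rewrite (@le_trans _ _ (e1 * (`|c'| + 1) + `|c| * e1))//.
    by rewrite lerD// ler_pM.
  by rewrite /M; nra.
set w := x - x' in F2 G2 *; set W := `|w| in F2 G2 *.
have W0 : 0 <= W by exact: normr_ge0.
rewrite (_ : _ - _ = (F g x - c) * K w + F g x * (G g x - G g x' - K w) +
  ((G g x' - c') * L w + (F g x - F g x' - L w) * G g x')); last ring.
rewrite (le_trans (ler_normD _ _))// (@le_trans _ _ (e1 * M * W))//; last by rewrite ler_wpM2r.
rewrite (@le_trans _ _ (e1 * (CK * W) + (`|c| + 1) * (e1 * W) +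
    (e1 * (CL * W) + (e1 * W) * (`|c'| + 1))))//; last by rewrite /M; nra.
by rewrite lerD// (le_trans (ler_normD _ _))// !normrM lerD// ler_pM.
Qed.

Lemma sdiffZ F a c L : sdiff F x0 c L ->
  sdiff (fun g x => a * F g x) x0 (a * c) (fun x => a * L x).
Proof.
move=> /(sdiffM (sdiff_cst a)); apply: sdiff_ext => // x.
by rewrite mulr0 addr0.
Qed.

Lemma sdiffB F G c c' L K : sdiff F x0 c L -> sdiff G x0 c' K ->
  sdiff (fun g x => F g x - G g x) x0 (c - c') (fun x => L x - K x).
Proof.
move=> hF /(sdiffZ (-1)) /(sdiffD hF).
by apply: sdiff_ext => [g x||x]; rewrite mulN1r.
Qed.

Lemma sdiff_sum (I : Type) (r : seq I) (F : I -> T -> 'rV[R]_N -> R)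
    (c : I -> R) (L : I -> 'rV[R]_N -> R) :
  (forall i, sdiff (F i) x0 (c i) (L i)) ->
  sdiff (fun g x => \sum_(i <- r) F i g x) x0 (\sum_(i <- r) c i)
    (fun x => \sum_(i <- r) L i x).
Proof.
move=> hF; elim: r => [|i r IH].
  by apply: sdiff_ext (sdiff_cst 0) => [g x||x]; rewrite big_nil.
by apply: sdiff_ext (sdiffD (hF i) IH) => [g x||x]; rewrite big_cons.
Qed.

(** Used with p the extraction of the parameters u_j, to carry the properties of a patch over to the
    space of all unknowns. *)
Lemma sdiff_comp_lin n (F : T -> 'rV[R]_n -> R) (p : 'rV[R]_N -> 'rV[R]_n) c
    (L : 'rV[R]_n -> R) :
  (forall a x y, p (a *: x + y) = a *: p x + p y) -> (forall x, `|p x| <= `|x|) ->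
  sdiff F (p x0) c L -> sdiff (fun g x => F g (p x)) x0 c (L \o p).
Proof.
move=> linp bp [linL hF]; have pB x y : p (x - y) = p x - p y.
  by rewrite addrC -scaleN1r linp scaleN1r addrC.
split=> [a x y|e e0]; first by rewrite /= linp linL.
have [d d0 Fd] := hF _ e0; exists d => // g cg x x' xd xd'.
have [||F1 F2] := Fd g cg (p x) (p x').
- by rewrite -pB (le_lt_trans (bp _)).
- by rewrite -pB (le_lt_trans (bp _)).
by split => //; rewrite /= pB (le_trans F2)// -pB ler_wpM2l ?bp// ltW.
Qed.

End Rules.

Section Vector.
Variables (N N' : nat) (F : T -> 'rV[R]_N -> 'rV[R]_N') (x0 : 'rV[R]_N).

(** The limit value is 0: only systems near a solution are considered. The matrix acts on rows from
    the right and is the same for all members of the family. *)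
Definition vsdiff (A : 'M[R]_(N, N')) : Prop :=
  forall e, 0 < e -> exists2 d, 0 < d &
    forall g, clo d g -> forall x x', `|x - x0| < d -> `|x' - x0| < d ->
      `|F g x| <= e /\ `|F g x - F g x' - (x - x') *m A| <= e * `|x - x'|.

Lemma vsdiff_coord (L : 'I_N' -> 'rV[R]_N -> R) :
  (forall k, sdiff (fun g x => F g x ord0 k) x0 0 (L k)) ->
  exists2 A : 'M[R]_(N, N'), vsdiff A & forall w k, (w *m A) ord0 k = L k w.
Proof.
move=> hF; pose A : 'M[R]_(N, N') := \matrix_(i, k) L k (delta_mx ord0 i).
have AE w k : (w *m A) ord0 k = L k w.
  by rewrite (is_lin_delta (hF k).1) mxE; apply: eq_bigr => i _; rewrite mxE.
exists A => // e e0.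
have [|k|d d0 Fd] := @finite_delta _ (fun k d => forall g, clo d g ->
    forall x x', `|x - x0| < d -> `|x' - x0| < d -> `|F g x ord0 k - 0| <= e /\
      `|F g x ord0 k - F g x' ord0 k - L k (x - x')| <= e * `|x - x'|).
- move=> k d d' d'0 d'd h g cg x x' xd xd'; apply: h.
  + exact: clo_mono d'd.
  + exact: lt_le_trans d'd.
  + exact: lt_le_trans d'd.
- exact: (hF k).2.
exists d => // g cg x x' xd xd'; split; apply: norm_le_coord.
- exact: ltW.
- by move=> i k; rewrite (ord1 i) -[F g x ord0 k]subr0; exact: (Fd k g cg x x' xd xd').1.
- by rewrite mulr_ge0// ltW.
- move=> i k; rewrite (ord1 i) [X in `|X|]mxE [X in `|X + _|]mxE [X in `|_ + X + _|]mxE.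
  rewrite [X in `|_ + X|]mxE AE; exact: (Fd k g cg x x' xd xd').2.
Qed.

(** As matrices act on rows, a right inverse bounds A from below by 1 / K; the error 1 / (2 K) costs
    at most half of this bound. *)
Lemma vsdiff_inj A B : vsdiff A -> A *m B = 1%:M ->
  exists C d, [/\ 0 < C, 0 < d & forall g, clo d g -> forall x x',
    `|x - x0| < d -> `|x' - x0| < d -> `|x - x'| <= C * `|F g x - F g x'|].
Proof.
move=> FA AB; pose K := N'%:R * `|B| + 1.
have K0 : 0 < K by rewrite ltr_wpDl ?mulr_ge0.
have [|d d0 Fd] := FA (2 * K)^-1; first by rewrite invr_gt0 mulr_gt0.
exists (2 * K), d; split => [||g cg x x' xd xd']; [by rewrite mulr_gt0|by []|].
have [_ F2] := Fd g cg x x' xd xd'.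
have h : `|x - x'| <= K * `|(x - x') *m A|.
  rewrite -{1}[x - x']mulmx1 -AB mulmxA (le_trans (norm_mulmx_le _ _))//.
  by rewrite ler_wpM2r// lerDl.
have h2 : `|(x - x') *m A| <= `|F g x - F g x'| + (2 * K)^-1 * `|x - x'|.
  rewrite -[X in `|X|](subKr (F g x - F g x')) (le_trans (ler_normB _ _))//.
  by rewrite lerD2l.
have h3 : K * ((2 * K)^-1 * `|x - x'|) = `|x - x'| / 2 by field; rewrite gt_eqF.
have := le_trans h (ler_wpM2l (ltW K0) h2); rewrite mulrDr h3.
lra.
Qed.

(** A Newton iteration with frozen derivative, carried out in the target space: a zero of the form x
    + v B is a fixed point of [Phi], whose derivative 1 - B A vanishes up to 1/2. Hence a surjective
    derivative is enough, and the lemma applies to the full system and to the upper equations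
    alike. *)
Lemma vsdiff_surj A B : vsdiff A -> B *m A = 1%:M ->
  exists C d, [/\ 0 < C, 0 < d & forall g, clo d g -> forall x,
    `|x - x0| < d -> `|F g x| < d ->
    exists2 x', `|x' - x| <= C * `|F g x| & F g x' = 0].
Proof.
move=> FA BA; pose K := N'%:R * `|B| + 1.
have K0 : 0 < K by rewrite ltr_wpDl ?mulr_ge0.
have bB (v : 'rV_N') : `|v *m B| <= K * `|v|.
  by rewrite (le_trans (norm_mulmx_le _ _))// ler_wpM2r// lerDl.
have [|d d0 Fd] := FA (2 * K)^-1; first by rewrite invr_gt0 mulr_gt0.
(* Half of the radius d is spent on x and the other half on the correction v B, whose norm is at
   most K times twice that of F g x. *)
pose d1 := Num.min d (Num.min (d / 2) (d / (4 * K))).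
have d10 : 0 < d1 by rewrite !lt_min d0 !divr_gt0// mulr_gt0.
exists (2 * K), d1; split => [||g cg x xd Fx]; [by rewrite mulr_gt0|by []|].
have {}cg : clo d g by apply: clo_mono cg _; rewrite ge_min lexx.
(* [Phi] moves 0 by the norm of F g x and halves distances, so it maps the ball of twice this radius
   into itself. *)
pose U := [set v : 'rV[R]_N' | `|v| <= 2 * `|F g x|].
pose Phi v := v - F g (x + v *m B).
have UB v : U v -> `|x + v *m B - x0| < d.
  move=> Uv; rewrite addrAC (le_lt_trans (ler_normD _ _))//.
  have xd2 : `|x - x0| < d / 2.
    by rewrite (lt_le_trans xd)// /d1 !ge_min lexx orbT.
  have Fd4 : `|F g x| < d / (4 * K).
    by rewrite (lt_le_trans Fx)// /d1 !ge_min lexx !orbT.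
  have : K * `|v| < d / 2.
    rewrite (@le_lt_trans _ _ (K * (2 * `|F g x|)))//; first by rewrite ler_wpM2l// ltW.
    rewrite (_ : d / 2 = K * (2 * (d / (4 * K)))); last by field; rewrite gt_eqF.
    by rewrite !ltr_pM2l.
  by have := bB v; lra.
have Philip v w : U v -> U w -> `|Phi v - Phi w| <= 2^-1 * `|v - w|.
  move=> Uv Uw; have [_] := Fd g cg _ _ (UB v Uv) (UB w Uw).
  rewrite opprD addrACA subrr add0r -mulmxBl -mulmxA BA mulmx1 => h.
  rewrite -normrN (_ : - (Phi v - Phi w) = F g (x + v *m B) - F g (x + w *m B) - (v - w));
    last first.
    by rewrite /Phi; apply/rowP => k; rewrite !mxE; ring.
  rewrite (le_trans h)// (le_trans (ler_wpM2l _ (bB (v - w))))// ?invr_ge0 ?mulr_ge0 ?(ltW K0)//.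
  rewrite mulrA ler_wpM2r//; by rewrite (_ : (2 * K)^-1 * K = 2^-1)//; field; rewrite gt_eqF.
have U0 : U 0 by rewrite /U /= normr0 mulr_ge0.
have Phi0 : Phi 0 = - F g x by rewrite /Phi mul0mx addr0 sub0r.
have PhiU v : U v -> U (Phi v).
  move=> Uv; have := Philip v 0 Uv U0; rewrite Phi0 opprK subr0 => h.
  rewrite /U /= -[Phi v](addrK (F g x)) (le_trans (ler_normB _ _))//.
  by move: Uv; rewrite /U /=; lra.
have Uc : closed U.
  apply: (@closed_le_fun R 'rV[R]_N'); exact: (@norm_continuous R 'rV[R]_N').
have hU : {homo Phi : v / U v >-> U v} by [].
have [|||p Up pE] := @banach_fixed_point R 'rV[R]_N' U (mkfun hU).
- exists (2^-1)%:nng => /=; split => //=; first by rewrite invf_lt1 ?ltr1n.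
  by move=> [v w] /= [Uv Uw]; exact: Philip.
- exact: Uc.
- by exists 0.
exists (x + p *m B).
  rewrite addrAC subrr add0r (le_trans (bB p))// (mulrC 2) -mulrA ler_wpM2l ?(ltW K0)//.
move: pE; rewrite /= /Phi => /eqP; rewrite -subr_eq0 opprB addrCA subrr addr0 => /eqP.
exact.
Qed.

End Vector.
End StrictDifferentiability.

Lemma near_eq_differentiable (R : numFieldType) (V W : normedModType R)
    (f g : V -> W) (x : V) :
  (\near x, f x = g x) -> differentiable f x -> differentiable g x.
Proof.
move=> fg /diff_locallyP[cf fE]; pose df := 'd f x.
have gE : g \o shift x = cst (g x) + df +o_ 0 id.
  apply/eqaddoP => e e0; move/eqaddoP: fE => /(_ e e0).
  have : \forall h \near 0, f (h + x) = g (h + x).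
    by rewrite (near_shift x) /=; near=> y; rewrite /= sub0r addrNK; near: y.
  apply: filterS2 => h /= hE.
  rewrite -![(_ + _ : _ -> _) _]/(_ + _) -![(- _ : _ -> _) _]/(- _) /= hE.
  by rewrite (nbhs_singleton fg).
apply/diff_locallyP; have dgE : 'd g x = df :> (V -> W) by exact: diff_unique.
by rewrite dgE.
Unshelve. all: by end_near. Qed.

(** * Local parametrizations of nearby embeddings *)

Section CkClosure.
Variable R : realType.

Lemma Ck_ext m n k (W : set 'rV[R]_m) (f g : 'rV[R]_m -> 'rV[R]_n) :
  open W -> (forall u, W u -> f u = g u) -> Ck k W f -> Ck k W g.
Proof.
move=> oW; elim: k f g => [|k IH] f g fg /= => [cf u Wu|[df Df]].
  have fgu : {near u, f =1 g} by apply: filterS (open_nbhs_nbhs (conj oW Wu)) => v /fg.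
  move: (cf u Wu); rewrite /prop_for /continuous_at (fg u Wu); apply: cvg_trans.
  exact: (@near_eq_cvg _ _ (nbhs u) (nbhs_filter u)).
have fgn u : W u -> \near u, f u = g u.
  by move=> Wu; apply: filterS (open_nbhs_nbhs (conj oW Wu)) => v /fg.
split=> [u Wu|v]; first exact: near_eq_differentiable (fgn u Wu) (df u Wu).
by apply: IH (Df v) => u Wu; apply: near_eq_derive; exact: fgn.
Qed.

Lemma CkW m n k (W : set 'rV[R]_m) (f : 'rV[R]_m -> 'rV[R]_n) :
  Ck k.+1 W f -> Ck k W f.
Proof.
elim: k f => [|k IH] f [df Df]; first by move=> u Wu; exact/differentiable_continuous/df.
by split => // v; apply: IH; exact: Df.
Qed.

Lemma Ck_le m n k l (W : set 'rV[R]_m) (f : 'rV[R]_m -> 'rV[R]_n) :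
  (k <= l)%N -> Ck l W f -> Ck k W f.
Proof. by move=> /subnK <-; elim: (l - k)%N => // p IH /CkW. Qed.

Lemma Ck_cst m n k (W : set 'rV[R]_m) (a : 'rV[R]_n) : Ck k W (cst a).
Proof.
elim: k a => [|k IH] a; first by move=> u _; exact: cst_continuous.
split=> [u _|v]; first exact: differentiable_cst.
by rewrite (_ : (fun u => 'D_v (cst a) u) = cst 0)//; apply/funext => u; rewrite derive_cst.
Qed.

Lemma CkD m n k (W : set 'rV[R]_m) (f g : 'rV[R]_m -> 'rV[R]_n) : open W ->
  Ck k W f -> Ck k W g -> Ck k W (fun u => f u + g u).
Proof.
move=> oW; elim: k f g => [|k IH] f g /=.
  by move=> cf cg u Wu; apply: continuousD; [exact: cf|exact: cg].
move=> [df Df] [dg Dg]; split=> [u Wu|v].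
  by apply: differentiableD; [exact: df|exact: dg].
apply: Ck_ext (IH _ _ (Df v) (Dg v)) => // u Wu.
by rewrite deriveD//; apply: diff_derivable; [exact: df|exact: dg].
Qed.

Lemma Ck_sum m n k (W : set 'rV[R]_m) (I : Type) (r : seq I)
    (f : I -> 'rV[R]_m -> 'rV[R]_n) : open W ->
  (forall i, Ck k W (f i)) -> Ck k W (fun u => \sum_(i <- r) f i u).
Proof.
move=> oW hf; elim: r => [|i r IH].
  by apply: Ck_ext (Ck_cst k W 0) => // u _; rewrite big_nil.
by apply: Ck_ext (CkD oW (hf i) IH) => // u _; rewrite big_cons.
Qed.

Lemma derive_coord m n (f : 'rV[R]_m -> 'rV[R]_n) u v i :
  derivable f u v -> 'D_v (fun u => f u ord0 i) u = ('D_v f u) ord0 i.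
Proof. by move=> df; rewrite derive_mx// mxE. Qed.

Lemma differentiable_row m n (f : 'rV[R]_m -> 'rV[R]_n) u :
  (forall i, differentiable (fun u => f u ord0 i) u) -> differentiable f u.
Proof.
move=> df; have -> : f = \sum_i (fun u => f u ord0 i *: delta_mx ord0 i).
  by apply/funext => v; rewrite fct_sumE; exact: row_sum_delta.
by apply: differentiable_sum => i; exact: differentiableZl.
Qed.

Lemma differentiable_row_coord m n (f : 'rV[R]_m -> 'rV[R]_n) u i :
  differentiable f u -> differentiable (fun u => f u ord0 i) u.
Proof.
move=> df; apply: (@differentiable_comp _ _ _ _ f (fun N : 'rV[R]_n => N ord0 i)) => //.
exact: differentiable_coord.
Qed.

(** [Ck] speaks of row-valued maps only, so the scalar factor of a product is given as a coordinate
    of such a map. *)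
Lemma differentiable_scale m p n (s : 'rV[R]_m -> 'rV[R]_p)
    (f : 'rV[R]_m -> 'rV[R]_n) a u :
  differentiable s u -> differentiable f u ->
  differentiable (fun u => s u ord0 a *: f u) u.
Proof.
move=> ds df; apply: differentiable_row => i.
rewrite (_ : (fun _ => _) = (fun u => s u ord0 a) * (fun u => f u ord0 i)).
  by apply: differentiableM; exact: differentiable_row_coord.
by apply/funext => v; rewrite mxE.
Qed.

Lemma derive_scale m p n (s : 'rV[R]_m -> 'rV[R]_p)
    (f : 'rV[R]_m -> 'rV[R]_n) a u v :
  differentiable s u -> differentiable f u ->
  'D_v (fun u => s u ord0 a *: f u) u =
    s u ord0 a *: 'D_v f u + ('D_v s u) ord0 a *: f u.
Proof.
move=> ds df; apply/rowP => i; rewrite -[LHS]derive_coord; last first.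
  by apply: diff_derivable; exact: differentiable_scale.
rewrite (_ : (fun _ => _) = (fun u => s u ord0 a) * (fun u => f u ord0 i)); last first.
  by apply/funext => w; rewrite mxE.
rewrite deriveM; try by apply: diff_derivable; exact: differentiable_row_coord.
rewrite !derive_coord; try exact: diff_derivable.
by rewrite !mxE; congr (_ + _); rewrite /GRing.scale /= mulrC.
Qed.

Lemma Ck_scale m p n k (W : set 'rV[R]_m) (s : 'rV[R]_m -> 'rV[R]_p)
    (f : 'rV[R]_m -> 'rV[R]_n) a : open W ->
  Ck k W s -> Ck k W f -> Ck k W (fun u => s u ord0 a *: f u).
Proof.
move=> oW; elim: k s f => [|k IH] s f.
  move=> cs cf u Wu; apply: (@continuousZ _ _ _ (fun u => s u ord0 a) f).
    apply: (@continuous_comp _ _ _ s (fun N : 'rV[R]_p => N ord0 a)); first exact: cs.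
    exact: coord_continuous.
  exact: cf.
move=> Cs Cf; have [ds Ds] := Cs; have [df Df] := Cf; split=> [u Wu|v].
  by apply: differentiable_scale; [exact: ds|exact: df].
apply: Ck_ext (CkD oW (IH _ _ (CkW Cs) (Df v)) (IH _ _ (Ds v) (CkW Cf))) => // u Wu.
by rewrite derive_scale//; [exact: ds|exact: df].
Qed.

Lemma derive_basis m n (f : 'rV[R]_m -> 'rV[R]_n) u w : differentiable f u ->
  'D_w f u = \sum_b w ord0 b *: 'D_(delta_mx ord0 b) f u.
Proof.
move=> df; rewrite deriveE// {1}(row_sum_delta w) linear_sum.
by apply: eq_bigr => b _; rewrite linearZ deriveE.
Qed.

Lemma derive_comp_basis m p n (s : 'rV[R]_m -> 'rV[R]_p)
    (f : 'rV[R]_p -> 'rV[R]_n) u v :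
  differentiable s u -> differentiable f (s u) ->
  'D_v (f \o s) u = \sum_a ('D_v s u) ord0 a *: 'D_(delta_mx ord0 a) f (s u).
Proof.
move=> ds df; rewrite deriveE; last exact: differentiable_comp.
by rewrite diff_comp//= -(derive_basis _ df) !deriveE.
Qed.

(** The chain rule in coordinates writes a directional derivative of f o s as a sum of products of
    coordinates of derivatives of s with partial derivatives of f composed with s, to which the
    induction hypothesis applies. *)
Lemma Ck_comp m p n k (W : set 'rV[R]_m) (V : set 'rV[R]_p)
    (s : 'rV[R]_m -> 'rV[R]_p) (f : 'rV[R]_p -> 'rV[R]_n) : open W ->
  (forall u, W u -> V (s u)) -> Ck k W s -> Ck k V f -> Ck k W (f \o s).
Proof.
move=> oW WV; elim: k f => [|k IH] f.
  by move=> cs cf u Wu; apply: continuous_comp; [exact: cs|exact/cf/WV].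
move=> Cs Cf; have [ds Ds] := Cs; have [df Df] := Cf; split=> [u Wu|v].
  by apply: differentiable_comp; [exact: ds|exact/df/WV].
apply: Ck_ext (@Ck_sum _ _ k W _ (index_enum 'I_p)
  (fun a u => ('D_v s u) ord0 a *: 'D_(delta_mx ord0 a) f (s u)) oW _) => // [u Wu|a].
  by rewrite derive_comp_basis//; [exact: ds|exact/df/WV].
apply: (Ck_scale a oW); first exact: Ds.
by apply: (IH (fun x => 'D_(delta_mx ord0 a) f x)); [exact: CkW|exact: Df].
Qed.

End CkClosure.

(** * Strict differentiability from uniform control of the partial derivatives *)

Section MeanValue.
Variable R : realType.

Lemma is_derive_line (V W : normedModType R) (f : V -> W) u w t d :
  is_derive (u + t *: w) w f d -> is_derive t 1 (fun t : R => f (u + t *: w)) d.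
Proof.
move=> [ex dE].
have E : (fun h : R => h^-1 *: (((fun t : R => f (u + t *: w)) \o shift t) (h *: 1) -
    f (u + t *: w))) = (fun h => h^-1 *: ((f \o shift (u + t *: w)) (h *: w) - f (u + t *: w))).
  apply/funext => h /=; congr (_ *: (f _ - _)).
  by rewrite [h *: 1]mulr1 scalerDl addrCA.
by split; [rewrite /derivable E|rewrite /derive E].
Qed.

Lemma segment_norm_lt (V : normedModType R) (u u' u0 : V) d t :
  0 <= t <= 1 -> `|u - u0| < d -> `|u' - u0| < d -> `|u' + t *: (u - u') - u0| < d.
Proof.
move=> /andP[t0 t1] ud u'd.
have -> : u' + t *: (u - u') - u0 = (1 - t) *: (u' - u0) + t *: (u - u0).
  transitivity ((u' - u0) + (t *: (u - u0) - t *: (u' - u0))).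
    by rewrite -scalerBr opprB addrA subrK addrAC.
  by rewrite scalerBl scale1r -[in RHS]addrA; congr (_ + _); exact: addrC.
rewrite (le_lt_trans (ler_normD _ _))// !normrZ (ger0_norm t0) ger0_norm ?subr_ge0//.
have [->|t_neq0] := eqVneq t 0; first by rewrite mul0r addr0 subr0 mul1r.
have tt : 0 < t by rewrite lt_neqAle eq_sym t_neq0.
have h1 : t * `|u - u0| < t * d by rewrite ltr_pM2l.
have h2 : (1 - t) * `|u' - u0| <= (1 - t) * d by rewrite ler_wpM2l ?subr_ge0// ltW.
lra.
Qed.

Lemma mean_value (V : normedModType R) (f : V -> R) (u u' : V) (d : R -> R) :
  (forall t, 0 <= t <= 1 -> is_derive (u' + t *: (u - u')) (u - u') f (d t)) ->
  exists2 t, 0 <= t <= 1 & f u - f u' = d t.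
Proof.
move=> df; pose phi t := f (u' + t *: (u - u')).
have dphi (t : R) : t \in `[0, 1] -> is_derive t 1 phi (d t).
  by rewrite in_itv /= => /df /is_derive_line.
have dphio (t : R) : t \in `]0, 1[ -> is_derive t 1 phi (d t).
  by move=> t01; exact/dphi/(subset_itv_oo_cc t01).
have cphi : {within `[0, 1], continuous phi}.
  by apply: derivable_within_continuous => t /dphi[].
have [t t01] := MVT_segment ler01 dphio cphi.
rewrite /phi scale1r scale0r addr0 (addrC u') subrK subr0 mulr1 => fE.
by exists t => //; rewrite in_itv in t01.
Qed.

Variables (T : Type) (clo : R -> T -> Prop).
Hypothesis clo_mono : forall d d' g, clo d g -> d <= d' -> clo d' g.

(** By the mean value theorem an increment is a directional derivative at a point of the segment,
    where all partial derivatives are already within e / (m + 1) of their limits; the denominator m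
    + 1 is nonzero even for m = 0. *)
Lemma sdiff_C1 m (F : T -> 'rV[R]_m -> R) u0 c (l : 'I_m -> R) :
  (exists2 r, 0 < r & forall g, clo r g -> forall u, `|u - u0| < r ->
     differentiable (F g) u) ->
  (forall e, 0 < e -> exists2 d, 0 < d & forall g, clo d g -> forall u, `|u - u0| < d ->
     `|F g u - c| <= e /\ forall b, `|'D_(delta_mx ord0 b) (F g) u - l b| <= e) ->
  sdiff clo F u0 c (fun w => \sum_b w ord0 b * l b).
Proof.
move=> [r r0 dF] hF; split=> [a x y|e e0].
  rewrite mulr_sumr -big_split; apply: eq_bigr => b _ /=.
  by rewrite !mxE; ring.
have em : 0 < e / m.+1%:R by rewrite divr_gt0.
have [d d0 Fd] := hF _ em; exists (Num.min r d); first by rewrite lt_min r0.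
move=> g cg x x'; rewrite !lt_min => /andP[xr xd] /andP[xr' xd'].
have [F1 _] := Fd g (clo_minr clo_mono cg) x xd; split.
  by rewrite (le_trans F1)// ler_pdivrMr ?ltr0n// ler_peMr ?(ltW e0)// ler1n.
have dseg t : 0 <= t <= 1 -> is_derive (x' + t *: (x - x')) (x - x') (F g)
    ('D_(x - x') (F g) (x' + t *: (x - x'))).
  move=> t01; apply/derivableP/diff_derivable/(dF g (clo_minl clo_mono cg)).
  exact: segment_norm_lt.
have [t t01 ->] := mean_value dseg.
set xi := x' + _; have xir : `|xi - u0| < r by exact: segment_norm_lt.
have xid : `|xi - u0| < d by exact: segment_norm_lt.
have [_ F2] := Fd g (clo_minr clo_mono cg) xi xid.
set w := x - x'.
have dw : 'D_w (F g) xi = \sum_b w ord0 b * 'D_(delta_mx ord0 b) (F g) xi.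
  have dFx := dF g (clo_minl clo_mono cg) _ xir.
  rewrite deriveE// {1}(row_sum_delta w) linear_sum; apply: eq_bigr => b _.
  by rewrite linearZ deriveE.
rewrite dw -sumrB (le_trans (ler_norm_sum _ _ _))//.
rewrite (@le_trans _ _ (\sum_(b < m) `|w| * (e / m.+1%:R)))//.
  apply: ler_sum => b _; rewrite -mulrBr normrM ler_pM//; exact: coord_le_norm.
rewrite sumr_const card_ord -[leLHS]mulr_natl mulrCA mulrC mulrA ler_wpM2r//.
by rewrite ler_pdivrMr ?ltr0n// mulrC ler_wpM2l ?(ltW e0)// ler_nat.
Qed.

End MeanValue.

Section Patch.
Variables (R : realType) (m D : nat) (M : Type).
Variables (clo : R -> (M -> 'rV[R]_D) -> Prop) (i : M -> 'rV[R]_D).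

(* A local parametrization [psi] of the manifold around [psi u0], along which
   the embeddings close to [i] are C^1-close to [i \o psi], with strictly
   differentiable first derivatives [df b]. *)
Record patch (u0 : 'rV[R]_m) (psi : 'rV[R]_m -> M)
  (df : 'I_m -> (M -> 'rV[R]_D) -> 'rV[R]_m -> 'rV[R]_D)
  (Lf : 'rV[R]_m -> 'rV[R]_D) (Ldf : 'I_m -> 'rV[R]_m -> 'rV[R]_D) : Prop := {
  patch_val : forall a, sdiff clo (fun g u => g (psi u) ord0 a) u0
    (i (psi u0) ord0 a) (fun w => Lf w ord0 a) ;
  patch_der : forall a b, sdiff clo (fun g u => df b g u ord0 a) u0
    (Lf (delta_mx ord0 b) ord0 a) (fun w => Ldf b w ord0 a) ;
  patch_is_derive : exists2 r, 0 < r & forall g, clo r g -> forall u w,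
    `|u - u0| < r -> is_derive u w (g \o psi) (\sum_b w ord0 b *: df b g u) ;
  patch_imm : exists2 c, 0 < c & forall w, c * `|w| <= enorm (Lf w) ;
  patch_nbhs : forall d, 0 < d -> exists2 d', 0 < d' &
    forall p, enorm (i p - i (psi u0)) < d' -> exists2 u, `|u - u0| < d & psi u = p }.

End Patch.

Lemma derive_comp_eq0 (R : numFieldType) (V1 V2 V3 : normedModType R)
    (f : V1 -> V2) (g : V2 -> V3) x w :
  differentiable f x -> differentiable g (f x) -> 'd f x w = 0 ->
  'D_w (g \o f) x = 0.
Proof.
move=> df dg fw; rewrite deriveE; last exact: differentiable_comp.
by rewrite diff_comp//= fw linear0.
Qed.

(** * Patches around every point, from the C^2 norm *)

Section EmbeddingPatches.
Variables (R : realType) (m D k : nat).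
Hypothesis k_ge2 : (2 <= k)%N.
Variables (M : topologicalType) (A : set (chart R m M)).
Hypothesis M_manifold : Ck_manifold k A.
Variables (J : finType) (phi : J -> chart R m M) (U : J -> set 'rV[R]_m).
Hypothesis phi_atlas : finite_atlas k A phi U.
Implicit Types (f g : M -> 'rV[R]_D) (p : M).

Definition C2close (i : M -> 'rV[R]_D) (d : R) g : Prop :=
  Emb2 A g /\ (C2norm phi U (g \- i)%R < d%:E)%E.

Lemma C2close_mono i d d' g : C2close i d g -> d <= d' -> C2close i d' g.
Proof.
by move=> [Eg h] dd'; split => //; apply: lt_le_trans h _; rewrite lee_fin.
Qed.

Lemma C2norm_bound f d (r : 'I_3) j u (vs : r.-tuple 'rV[R]_m) :
  (C2norm phi U f < d%:E)%E -> U j u ->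
  (forall v, v \in tval vs -> enorm v <= 1) ->
  enorm (iter_derive vs (f \o phi j) u) < d.
Proof.
move=> h Uu vs1; rewrite -lte_fin; apply: le_lt_trans h; rewrite /C2norm.
apply: le_trans (@le_bigmax _ _ _ 0%E (fun r : 'I_3 =>
  \big[maxe/0%E]_(j : J) ereal_sup [set diff_opnorm r (f \o phi j) u | u in U j]) r).
apply: le_trans (@le_bigmax _ _ _ 0%E (fun j : J =>
  ereal_sup [set diff_opnorm r (f \o phi j) u | u in U j]) j).
apply: (@le_trans _ _ (diff_opnorm r (f \o phi j) u)).
  by apply: ereal_sup_ubound; exists vs.
by apply: ereal_sup_ubound; exists u.
Qed.

Lemma C2norm_val f d j u : (C2norm phi U f < d%:E)%E -> U j u ->
  enorm (f (phi j u)) < d.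
Proof.
by move=> h Uu; apply: (C2norm_bound (r := ord0) (vs := [tuple]) h Uu) => v; rewrite in_nil.
Qed.

Lemma enorm_delta_mx b : enorm (delta_mx ord0 b : 'rV[R]_m) = 1.
Proof.
apply/eqP; rewrite -(@eqrXn2 _ 2) ?enorm_ge0// enorm_sqr expr1n /dot.
by rewrite (bigD1 b)//= big1 ?addr0 => [|c /negPf cb]; rewrite !mxE ?eqxx ?mulr1// cb mulr0.
Qed.

Lemma C2norm_der f d j u b : (C2norm phi U f < d%:E)%E -> U j u ->
  enorm ('D_(delta_mx ord0 b) (f \o phi j) u) < d.
Proof.
move=> h Uu.
apply: (C2norm_bound (r := Ordinal (isT : (1 < 3)%N))
  (vs := [tuple delta_mx ord0 b]) h Uu) => v.
by rewrite inE => /eqP ->; rewrite enorm_delta_mx.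
Qed.

Lemma C2norm_der2 f d j u b c : (C2norm phi U f < d%:E)%E -> U j u ->
  enorm ('D_(delta_mx ord0 c) (fun u => 'D_(delta_mx ord0 b) (f \o phi j) u) u) < d.
Proof.
move=> h Uu.
apply: (C2norm_bound (r := Ordinal (isT : (2 < 3)%N))
  (vs := [tuple delta_mx ord0 c; delta_mx ord0 b]) h Uu) => v.
by rewrite !inE => /orP[] /eqP ->; rewrite enorm_delta_mx.
Qed.

Lemma C2close_refl i d : 0 < d -> Emb2 A i -> C2close i d i.
Proof.
move=> d0 Ei; split => //; apply: (@le_lt_trans _ _ 0%E); last by rewrite lte_fin.
have -> : (i \- i)%R = cst 0 :> (M -> 'rV[R]_D) by apply/funext => p; rewrite /= subrr.
apply: bigmax_le => // r _; apply: bigmax_le => // j _.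
apply: ge_ereal_sup => _ [u Uu <-]; apply: ge_ereal_sup => _ [vs _ <-].
rewrite lee_fin (_ : iter_derive _ _ = cst 0) ?enorm0//.
elim: (tval vs) => //= v s ->; apply/funext => x; exact: derive_cst.
Qed.

Lemma C2close_dist i d g p : C2close i d g -> enorm (g p - i p) < d.
Proof.
move=> [_ h]; have : [set: M] p by [].
rewrite -(finite_atlas_cover phi_atlas) => -[j _ [u Uu <-]].
exact: C2norm_val h Uu.
Qed.

Lemma open_chart_preimage (c : chart R m M) (V : set M) : open V ->
  open (chart_dom c `&` c @^-1` V).
Proof.
move=> oV; rewrite openE => u [du Vu]; apply: filterI.
  by apply: open_nbhs_nbhs; split => //; exact: chart_dom_open.
by apply: (chart_map_cont du); apply: open_nbhs_nbhs.
Qed.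

(** Regularity is defined through the charts of A, whereas the C^2 norm is measured in the charts
    [phi j]; the transition maps relate the two. *)
Lemma Ck_embedding_chart c c' (f : M -> 'rV[R]_D) : Ck_chart k A c -> A c' -> C2 A f ->
  Ck 2 (chart_dom c `&` c @^-1` chart_img c') (f \o c).
Proof.
move=> Ac Ac' Cf; have [tr _] := Ac c' Ac'.
have oW := @open_chart_preimage c _ (chart_img_open c').
apply: Ck_ext (Ck_comp oW _ (Ck_le k_ge2 tr) (Cf c' Ac')) => // u [du [u' du' cu']] /=.
  by rewrite -cu' chart_mapK ?inE.
by rewrite -cu' chart_mapK ?inE.
Qed.

Lemma chart_img_nbhs (c : chart R m M) p d : chart_img c p -> 0 < d ->
  open (c @` (chart_dom c `&` [set u | `|u - chart_inv c p| < d])).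
Proof.
move=> cp d0.
have -> : c @` (chart_dom c `&` [set u | `|u - chart_inv c p| < d]) =
    chart_img c `&` chart_inv c @^-1` [set u | `|u - chart_inv c p| < d].
  apply/seteqP; split => [_ [u [du ud] <-]|_ [[u du <-] /=]].
    by split; [exists u|rewrite /= chart_mapK ?inE].
  by rewrite chart_mapK ?inE// => ud; exists u.
rewrite openE => q [cq qd]; apply: filterI.
  by apply: open_nbhs_nbhs; split => //; exact: chart_img_open.
apply: (chart_inv_cont cq); apply: open_nbhs_nbhs; split => //.
rewrite (_ : [set _ | _] = ball (chart_inv c p) d); first exact: ball_open.
by apply/seteqP; split => v; rewrite -ball_normE /ball_ /= distrC.
Qed.

(** Being a homeomorphism onto its image keeps i from bringing a remote part of M close to
    [i (c u0)]. *)
Lemma embedding_nbhs (i : M -> 'rV[R]_D) (c : chart R m M) u0 d : homeo_onto_image i ->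
  chart_dom c u0 -> 0 < d -> exists2 d', 0 < d' &
    forall p, enorm (i p - i (c u0)) < d' -> exists2 u, `|u - u0| < d & c u = p.
Proof.
move=> [inji _ oi] du0 d0.
have cu0 : chart_img c (c u0) by exists u0.
have [V oV iV] := oi _ (chart_img_nbhs cu0 d0).
have Vp : V (i (c u0)).
  suff : (V `&` range i) (i (c u0)) by case.
  rewrite -iV; exists (c u0) => //; exists u0 => //; split => //=.
  by rewrite chart_mapK ?inE// subrr normr0.
have : nbhs (i (c u0)) V by apply: open_nbhs_nbhs.
move=> /nbhs_ballP[e /= e0]; rewrite -ball_normE => eV.
exists e => // p pe; have : (V `&` range i) (i p).
  split; last by exists p.
  by apply: eV; rewrite /ball_ /= distrC (le_lt_trans (norm_le_enorm _)).
rewrite -iV => -[q [u [du ud] uq] /inji qp]; exists u; last by rewrite uq.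
by move: ud; rewrite /= chart_mapK ?inE.
Qed.

Lemma immersion_lower_bound (L : 'rV[R]_m -> 'rV[R]_D) :
  (forall a, is_lin (fun w => L w ord0 a)) -> (forall w, L w = 0 -> w = 0) ->
  exists2 c, 0 < c & forall w, c * `|w| <= enorm (L w).
Proof.
move=> linL injL; pose B : 'M[R]_(m, D) := \matrix_(b, a) L (delta_mx ord0 b) ord0 a.
have BE w : w *m B = L w.
  apply/rowP => a; rewrite mxE (is_lin_delta (linL a)).
  by apply: eq_bigr => b _; rewrite mxE.
have Bfree : row_free B.
  rewrite -kermx_eq0; apply/eqP/row_matrixP => b; rewrite row0; apply: injL.
  by rewrite -BE -row_mul mulmx_ker row0.
pose C := D%:R * `|pinvmx B| + 1.
have C0 : 0 < C by rewrite ltr_wpDl ?mulr_ge0.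
exists C^-1; first by rewrite invr_gt0.
move=> w; rewrite ler_pdivrMl//.
rewrite -{1}[w]mulmx1 -(mulmxVp Bfree) mulmxA BE (le_trans (norm_mulmx_le _ _))//.
by rewrite ler_pM ?mulr_ge0 ?lerDl ?norm_le_enorm.
Qed.

Lemma close_coord (X Y Z W : 'rV[R]_D) a e : W = Z - X -> enorm W < e / 2 ->
  `|X ord0 a - Y ord0 a| <= e / 2 -> `|Z ord0 a - Y ord0 a| <= e.
Proof.
move=> -> /ltW h1 h2; rewrite -(subrKA (X ord0 a)) (le_trans (ler_normD _ _))//.
rewrite [leRHS](splitr e) lerD// (le_trans _ h1)//.
by have := coord_le_enorm (Z - X) a; rewrite !mxE.
Qed.

(** The parametrization is a chart [phi j]. [sdiff_C1] applies to the embeddings and to their first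
    derivatives: of each error e, one half is the continuity of the derivatives of i up to order
    two, the other half the C^2 distance from g to i. *)
Lemma exists_patch (i : M -> 'rV[R]_D) p0 : Emb2 A i ->
  exists u0 (psi : 'rV[R]_m -> M) df Lf Ldf,
    psi u0 = p0 /\ patch (C2close i) i u0 psi df Lf Ldf.
Proof.
move=> Ei; have [Ci immi homi] := Ei.
have : [set: M] p0 by []; rewrite -(finite_atlas_cover phi_atlas) => -[j _ [u0 Uu0 ju0]].
have : [set: M] p0 by []; rewrite -(manifold_cover M_manifold) => -[c Ac cp0].
have Aj := finite_atlas_chart phi_atlas j.
have du0 : chart_dom (phi j) u0.
  by apply: (finite_atlas_sub phi_atlas); exact: subset_closure.
pose W := chart_dom (phi j) `&` phi j @^-1` chart_img c.
have oW : open W by exact: open_chart_preimage (chart_img_open c).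
have Wu0 : W u0 by split => //=; rewrite ju0.
pose F g := g \o phi j.
have CF g : C2 A g -> Ck 2 W (F g) by exact: Ck_embedding_chart.
have dF g u : C2 A g -> W u -> differentiable (F g) u by move=> /CF [h _]; exact: h.
have ddF g v u : C2 A g -> W u -> differentiable (fun u => 'D_v (F g) u) u.
  by move=> /CF [_ /(_ v) [h _]]; exact: h.
have cddF g v w u : C2 A g -> W u ->
    {for u, continuous (fun u => 'D_w (fun u => 'D_v (F g) u) u)}.
  by move=> /CF [_ /(_ v) [_ /(_ w)]]; exact.
have [r r0 rW] : exists2 r, 0 < r & forall u, `|u - u0| < r -> W u /\ U j u.
  have : nbhs u0 (W `&` U j).
    apply: open_nbhs_nbhs; split => //; apply: openI => //.
    exact: (finite_atlas_open phi_atlas).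
  move=> /nbhs_ballP[e e0]; rewrite -ball_normE => h; exists e => // u ue.
  by apply: h; rewrite /ball_ /= distrC.
have nbW u : W u -> nbhs u W by move=> Wu; apply: open_nbhs_nbhs.
have FD g u : C2 A g -> W u -> forall v,
    'D_v ((g \- i)%R \o phi j) u = 'D_v (F g) u - 'D_v (F i) u.
  move=> Cg Wu v; rewrite -deriveB//; apply: diff_derivable; exact: dF.
have FDD g u : C2 A g -> W u -> forall v w,
    'D_w (fun u => 'D_v ((g \- i)%R \o phi j) u) u =
    'D_w (fun u => 'D_v (F g) u) u - 'D_w (fun u => 'D_v (F i) u) u.
  move=> Cg Wu v w; rewrite -deriveB; try by apply: diff_derivable; exact: ddF.
  by apply: near_eq_derive; apply: filterS (nbW u Wu) => u' Wu'; rewrite FD.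
have near0 (h : 'rV[R]_m -> 'rV[R]_D) e : 0 < e -> {for u0, continuous h} ->
    exists2 d, 0 < d & forall u, `|u - u0| < d -> forall a, `|h u ord0 a - h u0 ord0 a| <= e.
  move=> e0 /cvgrPdist_lt/(_ e e0)/nbhs_ballP[d d0]; rewrite -ball_normE => hd.
  exists d => // u ud a; have /hd : ball_ Num.norm u0 d u by rewrite /ball_ /= distrC.
  move=> /ltW; apply: le_trans; rewrite distrC.
  by have := coord_le_norm (h u0 - h u) ord0 a; rewrite !mxE.
exists u0, (phi j), (fun b g u => 'D_(delta_mx ord0 b) (F g) u),
  (fun w => 'D_w (F i) u0), (fun b w => 'D_w (fun u => 'D_(delta_mx ord0 b) (F i) u) u0).
split => //; split.
- move=> a; apply: sdiff_ext (sdiff_C1 (@C2close_mono i) (F := fun g u => F g u ord0 a)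
    (u0 := u0) (c := i (phi j u0) ord0 a)
    (l := fun b => ('D_(delta_mx ord0 b) (F i) u0) ord0 a) _ _) => // [w||e e0].
  + by rewrite derive_basis ?summxE; [apply: eq_bigr => b _; rewrite mxE|exact: dF].
  + by exists r => // g [[Cg _ _] _] u /rW[Wu _]; apply: differentiable_row_coord; exact: dF.
  have e2 : 0 < e / 2 by rewrite divr_gt0.
  have [d1 d10 h1] := near0 (F i) _ e2 (differentiable_continuous (dF i u0 Ci Wu0)).
  have [b d d' d'0 dd' h u ud'|b|d2 d20 h2] :=
    @finite_delta R 'I_m (fun b d => forall u, `|u - u0| < d ->
      forall a, `|('D_(delta_mx ord0 b) (F i) u) ord0 a - ('D_(delta_mx ord0 b) (F i) u0)
        ord0 a| <= e / 2).
  + by apply: h; exact: lt_le_trans dd'.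
  + by apply: near0 => //; exact/differentiable_continuous/ddF.
  exists (Num.min r (Num.min (e / 2) (Num.min d1 d2))); first by rewrite !lt_min r0 e2 d10.
  move=> g cg u; rewrite !lt_min => /and4P[ur _ ud1 ud2].
  have {}cg := clo_minl (@C2close_mono i) (clo_minr (@C2close_mono i) cg).
  have [Wu Uu] := rW u ur; have [[Cg _ _] ng] := cg; split=> [|b].
    exact: close_coord (C2norm_val ng Uu) (h1 u ud1 a).
  rewrite derive_coord; last by apply: diff_derivable; exact: dF.
  exact: close_coord (FD g u Cg Wu _) (C2norm_der b ng Uu) (h2 b u ud2 a).
- move=> a b; apply: sdiff_ext (sdiff_C1 (@C2close_mono i)
    (F := fun g u => ('D_(delta_mx ord0 b) (F g) u) ord0 a)
    (u0 := u0) (c := ('D_(delta_mx ord0 b) (F i) u0) ord0 a)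
    (l := fun c => ('D_(delta_mx ord0 c) (fun u =>
      'D_(delta_mx ord0 b) (F i) u) u0) ord0 a) _ _) => // [w||e e0].
  + by rewrite derive_basis ?summxE; [apply: eq_bigr => b' _; rewrite mxE|exact: ddF].
  + by exists r => // g [[Cg _ _] _] u /rW[Wu _]; apply: differentiable_row_coord; exact: ddF.
  have e2 : 0 < e / 2 by rewrite divr_gt0.
  have [d1 d10 h1] := near0 (fun u => 'D_(delta_mx ord0 b) (F i) u) _ e2
    (differentiable_continuous (ddF i _ u0 Ci Wu0)).
  have [b' d d' d'0 dd' h u ud'|b'|d2 d20 h2] :=
    @finite_delta R 'I_m (fun b' d => forall u, `|u - u0| < d ->
      forall a, `|('D_(delta_mx ord0 b') (fun u => 'D_(delta_mx ord0 b) (F i) u) u) ord0 a -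
        ('D_(delta_mx ord0 b') (fun u => 'D_(delta_mx ord0 b) (F i) u) u0) ord0 a| <= e / 2).
  + by apply: h; exact: lt_le_trans dd'.
  + by apply: near0 => //; exact: cddF.
  exists (Num.min r (Num.min (e / 2) (Num.min d1 d2))); first by rewrite !lt_min r0 e2 d10.
  move=> g cg u; rewrite !lt_min => /and4P[ur _ ud1 ud2].
  have {}cg := clo_minl (@C2close_mono i) (clo_minr (@C2close_mono i) cg).
  have [Wu Uu] := rW u ur; have [[Cg _ _] ng] := cg; split=> [|b'].
    exact: close_coord (FD g u Cg Wu _) (C2norm_der b ng Uu) (h1 u ud1 a).
  rewrite derive_coord; last by apply: diff_derivable; exact: ddF.
  exact: close_coord (FDD g u Cg Wu _ _) (C2norm_der2 b b' ng Uu) (h2 b' u ud2 a).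
- exists r => // g [[Cg _ _] _] u w /rW[Wu _].
  rewrite -derive_basis; last exact: dF.
  by apply/derivableP/diff_derivable/dF.
(* Immersions are defined through the charts of A, so injectivity is carried over from c by the
   transition map s; a vector killed by the derivative of s is 0 because s has a differentiable left
   inverse near u0. *)
- apply: immersion_lower_bound => [a x y z|w].
    by rewrite !deriveE ?linearP ?mxE//; exact: dF.
  have [tr tr'] := Aj c Ac; rewrite deriveE; last exact: dF.
  pose s := chart_inv c \o phi j.
  have su0 : chart_dom c (s u0).
    by move: cp0 => [v dv cv]; rewrite /s /= ju0 -cv chart_mapK ?inE.
  have csu0 : c (s u0) = phi j u0.
    by move: cp0 => [v dv cv]; rewrite /s /= ju0 -cv chart_mapK ?inE.
  have ds : differentiable s u0 by have [h _] := Ck_le k_ge2 tr; exact: h.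
  have dfc : differentiable (i \o c) (s u0) by have [h _] := Ci c Ac; exact: h.
  have dt : differentiable (chart_inv (phi j) \o c) (s u0).
    have [h _] := Ck_le k_ge2 tr'; apply: h; split => //=.
    by rewrite csu0; exists u0.
  have FiE : \near u0, F i u0 = ((i \o c) \o s) u0.
    apply: filterS (nbW u0 Wu0) => u [_ [v dv cv]]; rewrite /F /s /=.
    by rewrite -cv chart_mapK ?inE.
  have idE : \near u0, ((chart_inv (phi j) \o c) \o s) u0 = id u0.
    apply: filterS (nbW u0 Wu0) => u [du [v dv cv]]; rewrite /s /=.
    by rewrite -cv chart_mapK ?inE// cv chart_mapK ?inE.
  have dsc : differentiable ((i \o c) \o s) u0 by exact: differentiable_comp.
  rewrite -deriveE; last exact: dF.
  rewrite (near_eq_derive _ FiE) deriveE// diff_comp//= => h0.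
  have : 'd s u0 w = 0.
    apply: (immi c (s u0) Ac su0); by rewrite h0 linear0.
  move=> dsw; have := near_eq_derive w idE; rewrite derive_id => <-.
  exact: (derive_comp_eq0 ds dt dsw).
- by move=> d d0; exact: embedding_nbhs.
Qed.

End EmbeddingPatches.

Section SquaredDistance.
Variables (R : realType) (D : nat).

Lemma is_derive_coord (V : normedModType R) (G : V -> 'rV[R]_D) v w d a :
  is_derive v w G d -> is_derive v w (fun v => G v ord0 a) (d ord0 a).
Proof.
move=> [exG dG]; split; first by move/derivable_mxP: exG; apply.
by rewrite -dG derive_mx// mxE.
Qed.

Lemma is_derive_sqdist (V : normedModType R) (G : V -> 'rV[R]_D) z v w d :
  is_derive v w G d ->
  is_derive v w (fun v => enorm (z - G v) ^+ 2) (- 2 * dot (z - G v) d).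
Proof.
move=> dG.
have dGa a : is_derive v w (fun v => (z - G v) ord0 a) (- d ord0 a).
  have := is_deriveB (is_derive_cst (z ord0 a) v w) (is_derive_coord a dG).
  rewrite sub0r; congr (is_derive _ _ _ _).
  by apply/funext => x; rewrite !mxE.
have := is_derive_sum (fun a => is_deriveM (dGa a) (dGa a)).
rewrite (_ : \sum_a _ = (fun v => enorm (z - G v) ^+ 2)); last first.
  by apply/funext => x; rewrite fct_sumE enorm_sqr.
rewrite (_ : \sum_a _ = - 2 * dot (z - G v) d)//.
rewrite /dot mulr_sumr; apply: eq_bigr => a _.
by rewrite /GRing.scale /=; ring.
Qed.

End SquaredDistance.

(** * First and second order behaviour of the squared distance along a patch *)

Section PatchTheory.
Variables (R : realType) (m D : nat) (M : Type).
Variables (clo : R -> (M -> 'rV[R]_D) -> Prop) (i : M -> 'rV[R]_D).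
Hypothesis clo_mono : forall d d' g, clo d g -> d <= d' -> clo d' g.
Hypothesis clo_refl : forall d, 0 < d -> clo d i.

Lemma sdiff_row N n (T : Type) (cl : R -> T -> Prop) (F : T -> 'rV[R]_N -> 'rV[R]_n)
    x0 (c : 'rV[R]_n) (L : 'rV[R]_N -> 'rV[R]_n) :
  (forall d d' g, cl d g -> d <= d' -> cl d' g) ->
  (forall a, sdiff cl (fun g x => F g x ord0 a) x0 (c ord0 a) (fun w => L w ord0 a)) ->
  forall e, 0 < e -> exists2 d, 0 < d & forall g, cl d g -> forall x x',
    `|x - x0| < d -> `|x' - x0| < d ->
    `|F g x - c| <= e /\ `|F g x - F g x' - L (x - x')| <= e * `|x - x'|.
Proof.
move=> cl_mono hF e e0.
have [a d d' d'0 dd' h g cg x x' xd xd'|a|d d0 Fd] :=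
  @finite_delta R 'I_n (fun a d => forall g, cl d g ->
    forall x x', `|x - x0| < d -> `|x' - x0| < d -> `|F g x ord0 a - c ord0 a| <= e /\
      `|F g x ord0 a - F g x' ord0 a - L (x - x') ord0 a| <= e * `|x - x'|).
- by apply: h; [exact: cl_mono dd'|exact: lt_le_trans dd'|exact: lt_le_trans dd'].
- exact: (hF a).2.
exists d => // g cg x x' xd xd'; split; apply: norm_le_coord.
- exact: ltW.
- by move=> j a; rewrite (ord1 j) !mxE; have [] := Fd a g cg x x' xd xd'.
- by rewrite mulr_ge0// ltW.
- by move=> j a; rewrite (ord1 j) !mxE; have [] := Fd a g cg x x' xd xd'.
Qed.

(** The center z joins the embedding as a parameter of the family, which leaves u as the only
    variable. *)
Definition cloz (z0 : 'rV[R]_D) (d : R) (gz : (M -> 'rV[R]_D) * 'rV[R]_D) :=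
  clo d gz.1 /\ enorm (gz.2 - z0) < d.

Lemma cloz_mono z0 d d' gz : cloz z0 d gz -> d <= d' -> cloz z0 d' gz.
Proof. by move=> [cg zd] dd'; split; [exact: clo_mono dd'|exact: lt_le_trans dd']. Qed.

Lemma sdiff_cloz N (F : (M -> 'rV[R]_D) -> 'rV[R]_N -> R) x0 c L z0 :
  sdiff clo F x0 c L -> sdiff (cloz z0) (fun gz => F gz.1) x0 c L.
Proof.
move=> [linL hF]; split=> // e /hF[d d0 h]; exists d => // gz [cg _]; exact: h.
Qed.

Variables (u0 : 'rV[R]_m) (psi : 'rV[R]_m -> M).
Variables (df : 'I_m -> (M -> 'rV[R]_D) -> 'rV[R]_m -> 'rV[R]_D).
Variables (Lf : 'rV[R]_m -> 'rV[R]_D) (Ldf : 'I_m -> 'rV[R]_m -> 'rV[R]_D).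
Hypothesis P : patch clo i u0 psi df Lf Ldf.
Let x0 := i (psi u0).
Let e_ b : 'rV[R]_m := delta_mx ord0 b.

Lemma patch_bilipschitz : exists c C d, [/\ 0 < c, 0 < C, 0 < d &
  forall g, clo d g -> forall u u', `|u - u0| < d -> `|u' - u0| < d ->
    c * `|u - u'| <= enorm (g (psi u) - g (psi u')) <= C * `|u - u'|].
Proof.
have [c c0 cL] := patch_imm P.
have /choice[k hk] : forall a, exists k, 0 < k /\ forall w, `|Lf w ord0 a| <= k * `|w|.
  by move=> a; have [k k0 hk] := is_lin_bound (patch_val P a).1; exists k.
pose K := \sum_a k a.
have K0 : 0 <= K by apply: sumr_ge0 => a _; rewrite ltW// (hk a).1.
have LK w : `|Lf w| <= K * `|w|.
  apply: norm_le_coord => [|j a]; first by rewrite mulr_ge0.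
  rewrite (ord1 j) (le_trans ((hk a).2 w))// ler_wpM2r// /K (bigD1 a)//= lerDl.
  by apply: sumr_ge0 => a' _; rewrite ltW// (hk a').1.
pose e := c / 2 / D.+1%:R; have e0 : 0 < e by rewrite !divr_gt0.
have [d d0 Fd] := sdiff_row (F := fun g u => g (psi u)) clo_mono (patch_val P) e0.
exists (c / 2), (D.+1%:R * (K + e)), d; split => //.
- by rewrite divr_gt0.
- by rewrite mulr_gt0// ltr_wpDl.
move=> g cg u u' ud ud'; have [_ h] := Fd g cg u u' ud ud'.
have Dn (x : 'rV[R]_D) : enorm x <= D.+1%:R * `|x|.
  by rewrite (le_trans (enorm_le_norm x))// ler_wpM2r// ler_nat.
have h1 : enorm (g (psi u) - g (psi u') - Lf (u - u')) <= c / 2 * `|u - u'|.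
  rewrite (le_trans (Dn _))// (_ : c / 2 = D.+1%:R * e); last first.
    by rewrite /e; field.
  by rewrite -mulrA ler_wpM2l.
apply/andP; split.
  have := enorm_sub (Lf (u - u')) (Lf (u - u') - (g (psi u) - g (psi u'))).
  by rewrite subKr (enormBC (Lf _)); have := cL (u - u'); lra.
rewrite (le_trans (Dn _))// -mulrA ler_wpM2l// mulrDl.
by rewrite -[X in `|X|](subrK (Lf (u - u'))) (le_trans (ler_normD _ _))// addrC lerD.
Qed.

(** Minus half of the b-th partial derivative of the squared distance from z along the patch; it
    vanishes for all b when z - g (psi u) is normal. *)
Definition Qf b g z u : R := dot (z - g (psi u)) (df b g u).

(** The derivative of [Qf b i z0] at u0, that is, minus half of a row of the Hessian: a curvature
    term weighted by z0 - x0, minus the first fundamental form. *)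
Definition LQ z0 b (w : 'rV[R]_m) : R :=
  \sum_a ((z0 - x0) ord0 a * Ldf b w ord0 a - Lf (e_ b) ord0 a * Lf w ord0 a).

Lemma sdiff_Qf z0 b : sdiff (cloz z0) (fun gz u => Qf b gz.1 gz.2 u) u0
  (dot (z0 - x0) (Lf (e_ b))) (LQ z0 b).
Proof.
pose mono := @cloz_mono z0.
have sz a : sdiff (cloz z0) (fun gz _ => gz.2 ord0 a) u0 (z0 ord0 a) (fun=> 0).
  apply: sdiff_param => e e0; exists e => // gz [_ /ltW]; apply: le_trans.
  by have := coord_le_enorm (gz.2 - z0) a; rewrite !mxE.
have := sdiff_sum mono (index_enum 'I_D) (fun a => sdiffM mono
  (sdiffB mono (sz a) (sdiff_cloz z0 (patch_val P a))) (sdiff_cloz z0 (patch_der P a b))).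
apply: sdiff_ext => [[g z] u||w] /=.
- by apply: eq_bigr => a _; rewrite !mxE.
- by apply: eq_bigr => a _; rewrite !mxE.
- by apply: eq_bigr => a _; rewrite sub0r mulrN !mxE.
Qed.

Lemma patch_Qf_near z0 e : 0 < e -> exists2 d, 0 < d &
  forall g z, clo d g -> enorm (z - z0) < d -> forall u u',
    `|u - u0| < d -> `|u' - u0| < d -> forall b,
    `|Qf b g z u - Qf b g z u' - LQ z0 b (u - u')| <= e * `|u - u'|.
Proof.
move=> e0; have [b d d' d'0 dd' h g z cg zd u u' ud ud'|b|d d0 h] :=
  @finite_delta R 'I_m (fun b d =>
  forall g z, clo d g -> enorm (z - z0) < d -> forall u u',
    `|u - u0| < d -> `|u' - u0| < d ->
    `|Qf b g z u - Qf b g z u' - LQ z0 b (u - u')| <= e * `|u - u'|).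
- by apply: h; [exact: clo_mono dd'|exact: lt_le_trans dd'|exact: lt_le_trans dd'|exact:
    lt_le_trans dd'].
- have [_ /(_ e e0)[d d0 h]] := sdiff_Qf z0 b; exists d => // g z cg zd u u' ud ud'.
  by have [] := h (g, z) (conj cg zd) u u' ud ud'.
by exists d => // g z cg zd u u' ud ud' b; exact: h.
Qed.

Lemma sum_coord_le (w x : 'rV[R]_m) e : 0 <= e -> (forall b, `|x ord0 b| <= e) ->
  `|\sum_b w ord0 b * x ord0 b| <= m.+1%:R * e * `|w|.
Proof.
move=> e0 xe; rewrite (le_trans (ler_norm_sum _ _ _))//.
rewrite (@le_trans _ _ (\sum_(b < m) `|w| * e))//.
  by apply: ler_sum => b _; rewrite normrM ler_pM// coord_le_norm.
rewrite sumr_const card_ord -[leLHS]mulr_natl (mulrC `|w|) mulrA.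
by rewrite !ler_wpM2r// ler_nat.
Qed.

Lemma patch_is_derive_sqdist : exists2 r, 0 < r & forall g z, clo r g -> forall u w,
  `|u - u0| < r -> is_derive u w (fun u => enorm (z - g (psi u)) ^+ 2)
    (- 2 * \sum_b w ord0 b * Qf b g z u).
Proof.
have [r r0 dg] := patch_is_derive P; exists r => // g z cg u w ur.
have := is_derive_sqdist z (dg g cg u w ur).
rewrite [dot _ _](_ : _ = \sum_b w ord0 b * Qf b g z u)//.
by rewrite dotC dot_suml; apply: eq_bigr => b _; rewrite dotZl dotC.
Qed.

(* The squared distance to [z] is uniformly strongly convex along the patch
   where its Hessian, the opposite of the form of [LQ], is positive definite. *)
Lemma patch_convex z0 c : 0 < c ->
  (forall w : 'rV[R]_m, \sum_b w ord0 b * LQ z0 b w <= - c * `|w| ^+ 2) ->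
  exists d, 0 < d /\ forall g z, clo d g -> enorm (z - z0) < d -> forall u u',
    `|u - u0| < d -> `|u' - u0| < d -> (forall b, Qf b g z u = 0) ->
    enorm (z - g (psi u)) ^+ 2 + c / 2 * `|u' - u| ^+ 2 <= enorm (z - g (psi u')) ^+ 2.
Proof.
move=> c0 LQc; pose e := c / 2 / m.+1%:R; have e0 : 0 < e by rewrite !divr_gt0.
have [d d0 dQ] := patch_Qf_near z0 e0.
have [r r0 dr] := patch_is_derive_sqdist.
exists (Num.min d r); split=> [|g z cg zd u u']; first by rewrite lt_min d0.
rewrite !lt_min => /andP[ud ur] /andP[ud' ur'] Q0.
have cgr := clo_minr clo_mono cg; have {}cg := clo_minl clo_mono cg.
have {}zd : enorm (z - z0) < d by move: zd; rewrite lt_min => /andP[].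
set w := u' - u; set W := `|w|.
pose h t := enorm (z - g (psi (u + t *: w))) ^+ 2.
pose k := c / 2 * W ^+ 2.
pose S t := \sum_b w ord0 b * Qf b g z (u + t *: w).
(* It suffices that h t - k t^2 is nondecreasing, which amounts to S t <= - k t. The Hessian
   contributes - c t W^2 to S t, and e is chosen so that the error takes back at most half of it. *)
have dpsi (t : R) : t \in `[0, 1] -> is_derive t 1 (fun t : R => h t - k * (t * t))
    (- 2 * S t - k * (t * 1 + t * 1)).
  rewrite in_itv /= => t01; apply: is_deriveB.
  apply: (@is_derive_line R _ _ (fun u => enorm (z - g (psi u)) ^+ 2)).
  by apply: dr => //; exact: segment_norm_lt.
have dpsio (t : R) : t \in `]0, 1[ -> is_derive t 1 (fun t : R => h t - k * (t * t))
    (- 2 * S t - k * (t * 1 + t * 1)).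
  by move=> t01; exact/dpsi/(subset_itv_oo_cc t01).
have cpsi : {within `[0, 1], continuous (fun t : R => h t - k * (t * t))}.
  by apply: derivable_within_continuous => t /dpsi[].
have [t t01] := MVT_segment ler01 dpsio cpsi.
rewrite in_itv /= in t01; have /andP[t0 t1] := t01.
have xd : `|u + t *: w - u0| < d by exact: segment_norm_lt.
have St : S t <= - k * t.
  pose x : 'rV[R]_m := \row_b (Qf b g z (u + t *: w) - Qf b g z u - LQ z0 b (u + t *: w - u)).
  have tw : u + t *: w - u = t *: w by rewrite addrC addKr.
  have LQt b : LQ z0 b (t *: w) = t * LQ z0 b w.
    by rewrite (is_linZ (sdiff_Qf z0 b).1).
  have -> : S t = t * (\sum_b w ord0 b * LQ z0 b w) + \sum_b w ord0 b * x ord0 b.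
    rewrite mulr_sumr -big_split; apply: eq_bigr => b _ /=.
    have -> : x ord0 b = Qf b g z (u + t *: w) - t * LQ z0 b w.
      by rewrite [LHS]mxE Q0 tw LQt subr0.
    ring.
  have xe b : `|x ord0 b| <= e * (t * W).
    rewrite mxE (le_trans (dQ g z cg zd _ _ xd ud b))// tw normrZ ger0_norm//.
  have /ler_normlW h1 := sum_coord_le w (mulr_ge0 (ltW e0) (mulr_ge0 t0 (normr_ge0 w))) xe.
  have h2 := ler_wpM2l t0 (LQc w).
  have h3 : m.+1%:R * (e * (t * W)) * W = k * t.
    by rewrite /e /k; field.
  move: h1; rewrite -/W h3 => h1; rewrite (le_trans (lerD h2 h1))// /k -/W.
  by rewrite -subr_ge0; apply: le_trans (_ : 0 <= 0) _ => //; rewrite le_eqVlt; apply/orP;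
    left; apply/eqP; field.
have -> : h 1 = enorm (z - g (psi u')) ^+ 2 by rewrite /h scale1r /w (addrC u) subrK.
have -> : h 0 = enorm (z - g (psi u)) ^+ 2 by rewrite /h scale0r addr0.
by rewrite -/k => hE; lra.
Qed.

Lemma patch_critical : exists2 r, 0 < r & forall g z, clo r g -> forall u,
  `|u - u0| < r ->
  (forall u', `|u' - u0| < r -> enorm (z - g (psi u)) <= enorm (z - g (psi u'))) ->
  forall b, Qf b g z u = 0.
Proof.
have [r r0 dr] := patch_is_derive_sqdist; exists r => // g z cg u ur umin b.
pose s := r - `|u - u0|; have s0 : 0 < s by rewrite subr_gt0.
pose h (t : R) := enorm (z - g (psi (u + t *: e_ b))) ^+ 2.
have in_r (t : R) : t \in `]- s, s[ -> `|u + t *: e_ b - u0| < r.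
  rewrite in_itv /= -ltr_norml => ts; rewrite addrAC (le_lt_trans (ler_normD _ _))//.
  rewrite -ltrBrDl -/s normrZ (le_lt_trans _ ts)// ler_piMr//.
  apply: norm_le_coord => // j b'; rewrite mxE; case: (_ && _) => /=; by rewrite ?normr1 ?normr0.
have dh (t : R) : t \in `]- s, s[ -> is_derive t 1 h
    (- 2 * \sum_b' e_ b ord0 b' * Qf b' g z (u + t *: e_ b)).
  move=> ts; apply: (@is_derive_line R _ _ (fun u => enorm (z - g (psi u)) ^+ 2)).
  by apply: dr => //; exact: in_r.
have s00 : 0 \in `]- s, s[ by rewrite in_itv /= s0 oppr_lt0 s0.
have ss : - s <= s by rewrite ge0_cp ?ltW.
have dh0 t : t \in `]- s, s[ -> derivable h t 1 by case/dh.
have hmin t : t \in `]- s, s[ -> h 0 <= h t.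
  move=> ts; rewrite /h scale0r addr0 ler_pXn2r ?nnegrE ?enorm_ge0//.
  by apply: umin; exact: in_r.
have [_ h0] := derive1_at_min ss dh0 s00 hmin.
have [_] := dh 0 s00; rewrite h0 scale0r addr0 => /esym/eqP.
rewrite mulf_eq0 oppr_eq0 pnatr_eq0 /= (bigD1 b)//= big1 ?addr0 => [|b' bb'].
  by rewrite /e_ mxE !eqxx mul1r => /eqP.
by rewrite /e_ mxE (negPf bb') andbF mul0r.
Qed.

Lemma patch_Lf w : Lf w = \sum_b w ord0 b *: Lf (e_ b).
Proof.
apply/rowP => a; rewrite summxE (is_lin_delta (patch_val P a).1).
by apply: eq_bigr => b _; rewrite mxE.
Qed.

(** For a center on the manifold the curvature term vanishes and only the first fundamental form is
    left. This gives unique projections near the manifold. *)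
Lemma patch_hessian_immersion : exists2 c, 0 < c &
  forall w : 'rV[R]_m, \sum_b w ord0 b * LQ x0 b w <= - c * `|w| ^+ 2.
Proof.
have [c c0 cL] := patch_imm P; exists (c ^+ 2); first by rewrite exprn_gt0.
move=> w; have -> : \sum_b w ord0 b * LQ x0 b w = - enorm (Lf w) ^+ 2.
  rewrite enorm_sqr {1}(patch_Lf w) dot_suml -sumrN; apply: eq_bigr => b _.
  rewrite dotZl /LQ subrr -mulrN; congr (_ * _); rewrite -sumrN.
  by apply: eq_bigr => a _; rewrite mxE mul0r sub0r.
rewrite mulNr lerN2 -exprMn ler_pXn2r ?nnegrE ?enorm_ge0 ?mulr_ge0//.
exact: ltW.
Qed.

(** Along u0 + t w the growth of the squared distance is at least k t^2 |w|^2. By the mean value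
    theorem it is also a first derivative at a fraction s of the step, that is, - 2 s t^2 times the
    form of [LQ] at w, up to an error that e makes at most k / 4 in the bracket. Bounding s by 1
    gives the constant k / 4. *)
Lemma patch_hessian_growth z0 d1 alpha : 0 < d1 -> 0 < alpha ->
  (forall b, Qf b i z0 u0 = 0) ->
  (forall u, enorm (i (psi u) - x0) < d1 ->
    enorm (x0 - z0) ^+ 2 + alpha * enorm (i (psi u) - x0) ^+ 2 <= enorm (i (psi u) - z0) ^+ 2) ->
  exists2 c, 0 < c & forall w : 'rV[R]_m, \sum_b w ord0 b * LQ z0 b w <= - c * `|w| ^+ 2.
Proof.
move=> d10 al0 Q0 growth.
have [c [C [d2 [c0 C0 d20 bl]]]] := patch_bilipschitz.
pose k := alpha * c ^+ 2; have k0 : 0 < k by rewrite mulr_gt0// exprn_gt0.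
pose e := k / 4 / m.+1%:R; have e0 : 0 < e by rewrite !divr_gt0.
have [d3 d30 dQ] := patch_Qf_near z0 e0.
have [r r0 dr] := patch_is_derive_sqdist.
exists (k / 4); first by rewrite divr_gt0.
move=> w; have [->|w0] := eqVneq w 0.
  by rewrite normr0 expr0n mulr0 big1// => b _; rewrite mxE mul0r.
set W := `|w|; have W0 : 0 < W by rewrite normr_gt0.
pose del := Num.min (Num.min d2 (d1 / C)) (Num.min d3 r).
have del0 : 0 < del by rewrite !lt_min d20 d30 r0 divr_gt0.
pose t := del / 2 / W; have t0 : 0 < t by rewrite !divr_gt0.
have tW : t * W = del / 2 by rewrite /t divfK// gt_eqF.
have tWdel : t * W < del by rewrite tW ltr_pdivrMr// ltr_pMr// ltr1n.
pose u := u0 + t *: w.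
have uu0 : u - u0 = t *: w by rewrite /u addrC addKr.
have ud : `|u - u0| < del by rewrite uu0 normrZ gtr0_norm.
have u0d : `|u0 - u0| < del by rewrite subrr normr0.
have [ud2 udC ud3 ur] : [/\ `|u - u0| < d2, `|u - u0| < d1 / C, `|u - u0| < d3 & `|u - u0| < r].
  by move: ud; rewrite /del !lt_min => /andP[/andP[-> ->] /andP[-> ->]].
have u0d2 : `|u0 - u0| < d2 by rewrite subrr normr0.
have /andP[bl1 bl2] := bl i (clo_refl d20) u u0 ud2 u0d2.
have gu : enorm (i (psi u) - x0) < d1.
  by rewrite (le_lt_trans bl2)// mulrC -ltr_pdivlMr.
have := growth u gu; rewrite (enormBC x0) (enormBC (i (psi u)) z0) => gr.
have dseg s : 0 <= s <= 1 -> is_derive (u0 + s *: (u - u0)) (u - u0)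
    (fun u => enorm (z0 - i (psi u)) ^+ 2)
    (- 2 * \sum_b (u - u0) ord0 b * Qf b i z0 (u0 + s *: (u - u0))).
  move=> s01; apply: dr; first exact: clo_refl.
  by apply: segment_norm_lt => //; rewrite subrr normr0.
have [s s01 sE] := mean_value dseg; have /andP[s0 s1] := s01.
set v := u0 + s *: (u - u0) in sE.
have vu0 : v - u0 = (s * t) *: w by rewrite /v addrC addKr uu0 scalerA.
have vd : `|v - u0| < d3 by apply: segment_norm_lt => //; rewrite subrr normr0.
have u0d3 : `|u0 - u0| < d3 by rewrite subrr normr0.
have z0d3 : enorm (z0 - z0) < d3 by rewrite subrr enorm0.
pose x : 'rV[R]_m := \row_b (Qf b i z0 v - Qf b i z0 u0 - LQ z0 b (v - u0)).
have st0 : 0 <= s * t by rewrite mulr_ge0// ltW.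
have xe b : `|x ord0 b| <= e * (s * t * W).
  rewrite mxE (le_trans (dQ i z0 (clo_refl d30) z0d3 _ _ vd u0d3 b))//.
  by rewrite vu0 normrZ ger0_norm.
pose L := \sum_b w ord0 b * LQ z0 b w.
have SE : \sum_b (u - u0) ord0 b * Qf b i z0 v = t * (s * t * L + \sum_b w ord0 b * x ord0 b).
  rewrite mulrDr !mulr_sumr -big_split; apply: eq_bigr => b _ /=.
  have -> : x ord0 b = Qf b i z0 v - s * t * LQ z0 b w.
    by rewrite [LHS]mxE Q0 vu0 (is_linZ (sdiff_Qf z0 b).1) subr0.
  rewrite uu0 mxE; ring.
have e1 : 0 <= e * (s * t * W) by exact: mulr_ge0 (ltW e0) (mulr_ge0 st0 (ltW W0)).
have h1 := sum_coord_le w e1 xe; rewrite -/W in h1.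
have h3 : m.+1%:R * (e * (s * t * W)) * W = k / 4 * (s * t) * W ^+ 2.
  by rewrite /e; field.
rewrite h3 in h1.
have h4 : alpha * (c * (t * W)) ^+ 2 <= enorm (z0 - i (psi u)) ^+ 2 - enorm (z0 - x0) ^+ 2.
  rewrite (@le_trans _ _ (alpha * enorm (i (psi u) - x0) ^+ 2))//; last by lra.
  have cW : 0 <= c * (t * W) by exact: mulr_ge0 (ltW c0) (mulr_ge0 (ltW t0) (ltW W0)).
  rewrite ler_pM2l//; apply: lerXn2r; rewrite ?nnegrE ?enorm_ge0//.
  by move: bl1; rewrite uu0 normrZ gtr0_norm.
rewrite sE SE in h4; set E := \sum_b w ord0 b * x ord0 b in h1 h4.
have h5 : t * (k * t * W ^+ 2) <= t * (2 * (- (s * t * L) - E)).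
  rewrite (_ : t * (k * t * W ^+ 2) = alpha * (c * (t * W)) ^+ 2); last by rewrite /k; ring.
  by rewrite [leRHS](_ : _ = - 2 * (t * (s * t * L + E))); last by ring.
rewrite ler_pM2l// in h5.
have h6 : - E <= k / 4 * (s * t) * W ^+ 2 by rewrite (le_trans (ler_norm _))// normrN.
have h7 : t * (k * W ^+ 2) <= t * (2 * s * (- L + k / 4 * W ^+ 2)).
  rewrite (_ : t * (k * W ^+ 2) = k * t * W ^+ 2); last by ring.
  rewrite (le_trans h5)// [leRHS](_ : _ = 2 * (- (s * t * L) + k / 4 * (s * t) * W ^+ 2));
    last by ring.
  by rewrite ler_pM2l// lerD2l.
rewrite ler_pM2l// in h7.
have kW : 0 < k * W ^+ 2 by rewrite mulr_gt0// exprn_gt0.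
(* The sign is needed before s can be replaced by 1. *)
have h8 : 0 <= - L + k / 4 * W ^+ 2.
  rewrite leNgt; apply/negP => neg.
  have : 2 * s * (- L + k / 4 * W ^+ 2) <= 0 by rewrite mulr_ge0_le0 ?mulr_ge0// ltW.
  lra.
have h9 : 2 * s * (- L + k / 4 * W ^+ 2) <= 2 * (- L + k / 4 * W ^+ 2).
  by rewrite ler_wpM2r// ler_piMr.
rewrite -/L; lra.
Qed.

End PatchTheory.

(** Averaging [seb_center_dot] over the points with the weights l, then Cauchy-Schwarz. A small
    barycenter error thus gives a small gradient, and error 0 gives a critical point. *)
Lemma seb_center_le_comb (R : realType) D (A : set 'rV[R]_D) z d c n
    (y : 'I_n -> 'rV[R]_D) l : is_seb_center A c -> A `<=` ecball z d ->
  (forall j, A (y j)) -> (forall j, enorm (y j - z) = d) ->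
  (forall j, 0 <= l j) -> \sum_j l j = 1 ->
  enorm (c - z) <= 2 * enorm (comb y l - z).
Proof.
move=> cA Az Ay yd l0 l1; set w := c - z.
have h : enorm w ^+ 2 <= 2 * dot (comb y l - z) w.
  have -> : comb y l - z = \sum_j l j *: (y j - z).
    under eq_bigr do rewrite scalerBr.
    by rewrite sumrB -scaler_suml l1 scale1r.
  rewrite -[leLHS]mul1r -[X in X * _ <= _]l1 mulr_suml dot_suml mulr_sumr; apply: ler_sum => j _.
  by rewrite dotZl [leRHS]mulrCA ler_wpM2l//; exact: seb_center_dot cA Az (Ay j) (yd j).
have [->|w0] := eqVneq w 0; first by rewrite enorm0 mulr_ge0 ?enorm_ge0.
have W0 : 0 < enorm w by apply: enorm_gt0; exact/eqP.
rewrite -(ler_pM2r W0) -expr2 (le_trans h)// -mulrA ler_pM2l//.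
exact: dot_le_enorm.
Qed.

Lemma finite_set_isolated (R : realType) D (S : set 'rV[R]_D) z0 : finite_set S ->
  exists2 k, 0 < k & forall z, S z -> enorm (z - z0) < k -> z = z0.
Proof.
move=> /finite_seqP[s ->]; elim: s => [|a s [k k0 h]].
  by exists 1 => // z.
have [->|az] := eqVneq a z0.
  exists k => // z; rewrite /= inE => /predU1P[->//|zs]; exact: h.
exists (Num.min k (enorm (a - z0))).
  by rewrite lt_min k0 enorm_gt0//; apply/eqP; rewrite subr_eq0.
move=> z; rewrite /= inE lt_min => /predU1P[->|zs] /andP[h1 h2]; first by rewrite ltxx in h2.
exact: h.
Qed.

Lemma sdiff_value (R : realType) (T : Type) (cl : R -> T -> Prop) N
    (F : T -> 'rV[R]_N -> R) x0 c L g : (forall d, 0 < d -> cl d g) ->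
  sdiff cl F x0 c L -> F g x0 = c.
Proof.
move=> clg [_ hF]; apply/eqP; rewrite -subr_eq0 -normr_eq0 eq_le normr_ge0 andbT.
apply/ler_addgt0Pr => e e0; rewrite add0r; have [d dd h] := hF e e0.
by have [||->] := h g (clg d dd) x0 x0; rewrite ?subrr ?normr0.
Qed.

Lemma open_eball (R : realType) D (c : 'rV[R]_D) r : open (eball c r).
Proof.
rewrite (_ : eball c r = (fun x => enorm (c - x)) @^-1` [set s | s < r]).
  by apply: open_comp => [x _|]; [exact: continuous_enormB|exact: open_lt].
by apply/seteqP; split => x; rewrite /eball /= enormBC.
Qed.

Definition P3_at (R : realType) D (S : set 'rV[R]_D) z : Prop :=
  forall x0, proj_set S z x0 ->
    exists delta alpha : R, 0 < delta /\ 0 < alpha /\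
      forall y, (S `&` eball x0 delta) y ->
        enorm (x0 - z) ^+ 2 + alpha * enorm (y - x0) ^+ 2 <= enorm (y - z) ^+ 2.

Definition P1_at (R : realType) D (S : set 'rV[R]_D) z : Prop :=
  (exists s : seq 'rV[R]_D, proj_set S z = [set` s] /\ affinely_independent s) /\
  relative_interior (convex_hull (proj_set S z)) z.

Lemma P1_atP (R : realType) D (S : set 'rV[R]_D) z : P1_at S z <->
  exists n (x : 'I_n -> 'rV[R]_D) l, [/\ affine_free x, proj_set S z = range x &
    [/\ forall j, 0 < l j, \sum_j l j = 1 & z = comb x l]].
Proof.
split=> [[[s [pE sfree]] zrel]|[n [x [l [xfree pE [l0 l1 zE]]]]]]; last first.
  split; last by rewrite pE zE; exact: relative_interior_comb.
  have sE (j : 'I_n) : nth 0 [seq x j | j <- enum 'I_n] j = x j.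
    by rewrite (nth_map j) ?size_enum_ord// nth_ord_enum.
  exists [seq x j | j <- enum 'I_n]; split; last first.
    by apply/(affinely_independentP _ sE) => //; rewrite size_map size_enum_ord.
  rewrite pE; apply/seteqP; split => [_ [j _ <-]|y /mapP[j _ ->]]; last by exists j.
  by apply/mapP; exists j; rewrite ?mem_enum.
pose x (j : 'I_(size s)) := nth 0 s j.
have pE' : proj_set S z = range x.
  rewrite pE; apply/seteqP; split => [y /= ys|_ [j _ <-]]; last exact: mem_nth.
  have ys' : (index y s < size s)%N by rewrite index_mem.
  by exists (Ordinal ys') => //; rewrite /x nth_index.
have xfree : affine_free x by apply/(affinely_independentP (s := s)).
rewrite pE' in zrel; have [l [l0 l1 zE]] := relative_interior_sub xfree zrel.
by exists (size s), x, l.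
Qed.

(** The common indexing carries the correspondence between projections; disjointness of the balls
    enters only in [paired_unique], where it turns the pairing into exactly one point per ball. *)
Definition paired (R : realType) D (eta : R) (A B : set 'rV[R]_D) : Prop :=
  exists n (x y : 'I_n -> 'rV[R]_D),
    [/\ injective x, A = range x, B = range y & forall j, enorm (y j - x j) < eta].

Lemma paired_unique (R : realType) D (eta : R) (A B : set 'rV[R]_D) :
  (forall x x', A x -> A x' -> x <> x' -> eball x eta `&` eball x' eta = set0) ->
  paired eta A B -> B `<=` \bigcup_(x in A) eball x eta /\
    forall x, A x -> exists! y, (B `&` eball x eta) y.
Proof.
move=> disj [n [x [y [xinj AE BE yx]]]]; rewrite AE BE in disj *; split.
  by move=> _ [j _ <-]; exists (x j); [exists j|exact: yx].
move=> _ [j _ <-]; exists (y j); split; first by split; [exists j|exact: yx].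
move=> _ [[j' _ <-] yxj]; have [->//|jj'] := eqVneq j' j.
have xx : x j <> x j' by move=> /xinj jE; rewrite jE eqxx in jj'.
have : (eball (x j) eta `&` eball (x j') eta) (y j') by split=> //; exact: yx.
by rewrite (disj (x j) (x j')).
Qed.

Lemma finite_set_delta (R : realType) (T : choiceType) (S : set T) (P : T -> R -> Prop) :
  finite_set S -> (forall z d d', 0 < d' -> d' <= d -> P z d -> P z d') ->
  (forall z, S z -> exists2 d, 0 < d & P z d) ->
  exists2 d, 0 < d & forall z, S z -> P z d.
Proof.
move=> /finite_seqP[s ->] mono; elim: s => [|a s IH] Pd; first by exists 1.
have [|d d0 h] := IH; first by move=> z zs; apply: Pd; rewrite /= inE zs orbT.
have [|d' d'0 h'] := Pd a; first by rewrite /= inE eqxx.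
have m0 : 0 < Num.min d d' by rewrite lt_min d0.
exists (Num.min d d') => // z; rewrite /= inE => /predU1P[->|zs].
  by apply: mono h' => //; rewrite ge_min lexx orbT.
by apply: mono (h z zs) => //; rewrite ge_min lexx.
Qed.

(** * Critical points of nearby embeddings *)

Section Unknowns.
Variables (R : realType) (m D n : nat).

(* At a critical point with [n] projections: the coordinates of the center z,
   of the parameters u_j and weights l_j of the projections, and the squared
   radius. The indices in [upper] also number the equations which remain when
   the barycenter equation for z is dropped. *)
Definition unknown : finType := ('I_D + 'I_n * 'I_m + 'I_n + unit)%type.
Definition upper : finType := ('I_n * 'I_m + 'I_n + unit)%type.

Definition upper_unknown (k : upper) : unknown :=
  match k with
  | inl (inl p) => inl (inl (inr p))
  | inl (inr j) => inl (inr j)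
  | inr t => inr t
  end.

Notation X_ := 'rV[R]_#|{: unknown}|.

Definition ucoord (X : X_) (k : unknown) : R := X ord0 (enum_rank k).
Definition cz (X : X_) : 'rV[R]_D := \row_a ucoord X (inl (inl (inl a))).
Definition cu j (X : X_) : 'rV[R]_m := \row_b ucoord X (inl (inl (inr (j, b)))).
Definition cl (X : X_) j : R := ucoord X (inl (inr j)).
Definition cr (X : X_) : R := ucoord X (inr tt).

Definition mkX z (u : 'I_n -> 'rV[R]_m) (l : 'I_n -> R) r : X_ :=
  \row_k match enum_val k with
  | inl (inl (inl a)) => (z : 'rV[R]_D) ord0 a
  | inl (inl (inr p)) => u p.1 ord0 p.2
  | inl (inr j) => l j
  | inr _ => r
  end.

Lemma cz_mkX z u l r : cz (mkX z u l r) = z.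
Proof. by apply/rowP => a; rewrite mxE /ucoord mxE enum_rankK. Qed.

Lemma cu_mkX z u l r j : cu j (mkX z u l r) = u j.
Proof. by apply/rowP => b; rewrite mxE /ucoord mxE enum_rankK. Qed.

Lemma cl_mkX z u l r : cl (mkX z u l r) = l.
Proof. by apply/funext => j; rewrite /cl /ucoord mxE enum_rankK. Qed.

Lemma cr_mkX z u l r : cr (mkX z u l r) = r.
Proof. by rewrite /cr /ucoord mxE enum_rankK. Qed.

Lemma cz_lin a X Y : cz (a *: X + Y) = a *: cz X + cz Y.
Proof. by apply/rowP => b; rewrite !mxE /ucoord !mxE. Qed.

Lemma cu_lin j a X Y : cu j (a *: X + Y) = a *: cu j X + cu j Y.
Proof. by apply/rowP => b; rewrite !mxE /ucoord !mxE. Qed.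

Lemma czB X Y : cz (X - Y) = cz X - cz Y.
Proof. by apply/rowP => b; rewrite !mxE /ucoord !mxE. Qed.

Lemma cuB j X Y : cu j (X - Y) = cu j X - cu j Y.
Proof. by apply/rowP => b; rewrite !mxE /ucoord !mxE. Qed.

Lemma clB X Y j : cl (X - Y) j = cl X j - cl Y j.
Proof. by rewrite /cl /ucoord !mxE. Qed.

Lemma crB X Y : cr (X - Y) = cr X - cr Y.
Proof. by rewrite /cr /ucoord !mxE. Qed.

Lemma ucoord_le X k : `|ucoord X k| <= `|X|.
Proof. exact: coord_le_norm. Qed.

Lemma cz_le X : `|cz X| <= `|X|.
Proof. by apply: norm_le_coord => // j a; rewrite mxE ucoord_le. Qed.

Lemma cu_le j X : `|cu j X| <= `|X|.
Proof. by apply: norm_le_coord => // j' a; rewrite mxE ucoord_le. Qed.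

Lemma norm_unknown_le X e : 0 <= e -> `|cz X| <= e -> (forall j, `|cu j X| <= e) ->
  (forall j, `|cl X j| <= e) -> `|cr X| <= e -> `|X| <= e.
Proof.
move=> e0 hz hu hl hr; apply: norm_le_coord => // i k; rewrite (ord1 i).
rewrite -(enum_valK k); case: (enum_val k) => [[[a|[j b]]|j]|[]].
- by apply: le_trans hz; have := coord_le_norm (cz X) ord0 a; rewrite mxE.
- by apply: le_trans (hu j); have := coord_le_norm (cu j X) ord0 b; rewrite mxE.
- exact: hl.
- exact: hr.
Qed.

Lemma eq_unknown X Y : cz X = cz Y -> (forall j, cu j X = cu j Y) ->
  cl X =1 cl Y -> cr X = cr Y -> X = Y.
Proof.
move=> hz hu hl hr; apply/rowP => k; rewrite -(enum_valK k).
case: (enum_val k) => [[[a|[j b]]|j]|[]].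
- by have /rowP/(_ a) := hz; rewrite !mxE.
- by have /rowP/(_ b) := hu j; rewrite !mxE.
- exact: hl.
- exact: hr.
Qed.

End Unknowns.

Arguments upper_unknown {m D n}.

Lemma near0_scale_lt (R : realType) (a b : R) : 0 < b ->
  \forall s \near (0 : R)^'+, s * a < b.
Proof.
move=> b0; have a1 : 0 < `|a| + 1 by rewrite ltr_wpDl.
near=> s; have s0 : 0 < s by near: s; exact: nbhs_right_gt.
have sb : s < b / (`|a| + 1) by near: s; apply: nbhs_right_lt; rewrite divr_gt0.
move: sb; rewrite ltr_pdivlMr// => sb; apply: le_lt_trans sb.
by rewrite ler_pM2l// (le_trans (ler_norm a))// lerDl.
Unshelve. all: by end_near. Qed.

Section EmbeddingFamily.
Variables (R : realType) (m D : nat) (M : topologicalType).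
Hypothesis M_compact : compact [set: M].
Hypothesis M_nonempty : [set: M] !=set0.
(* [clo d g] stands for: [g] is an embedding at C^2-distance less than [d] from [i]. *)
Variables (clo : R -> (M -> 'rV[R]_D) -> Prop) (i : M -> 'rV[R]_D).
Hypothesis clo_mono : forall d d' g, clo d g -> d <= d' -> clo d' g.
Hypothesis clo_refl : forall d, 0 < d -> clo d i.
Hypothesis clo_dist : forall d g p, clo d g -> enorm (g p - i p) < d.
Hypothesis clo_continuous : forall d g, clo d g -> continuous g.
Hypothesis clo_patch : forall p0, exists (u0 : 'rV[R]_m) (psi : 'rV[R]_m -> M) df Lf Ldf,
  psi u0 = p0 /\ patch clo i u0 psi df Lf Ldf.

(** * Perturbation of distances and projections, and regions without mu-critical points *)

Lemma range_compact d g : clo d g -> compact (range g).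
Proof.
move=> cg; apply: continuous_compact => //.
exact/continuous_subspaceT/(clo_continuous cg).
Qed.

Lemma range_nonempty (g : M -> 'rV[R]_D) : range g !=set0.
Proof. by have [p _] := M_nonempty; exists (g p); exists p. Qed.

Lemma dist_set_near d g z z0 : clo d g -> 
  dist_set (range g) z <= dist_set (range i) z0 + d + enorm (z - z0).
Proof.
move=> cg; have ci : clo (`|d| + 1) i by apply: clo_refl; rewrite ltr_wpDl.
have [_ [[p _ <-] <-]] := proj_set_exists z0 (range_compact ci) (range_nonempty i).
rewrite (le_trans (dist_set_le z (y := g p) _))//.
have := enormB_le z z0 (g p); have := enormB_le z0 (i p) (g p).
by have := clo_dist p cg; rewrite (enormBC (g p)); lra.
Qed.

Lemma dist_set_near_ge d g z z0 : clo d g ->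
  dist_set (range i) z0 <= dist_set (range g) z + d + enorm (z - z0).
Proof.
move=> cg.
have [_ [[p _ <-] <-]] := proj_set_exists z (range_compact cg) (range_nonempty g).
rewrite (le_trans (dist_set_le z0 (y := i p) _))//.
have := enormB_le z0 z (i p); have := enormB_le z (g p) (i p).
by have := clo_dist p cg; rewrite (enormBC z0 z); lra.
Qed.

(** Projections for nearby g and z are near-projections for i and z0, so [near_proj_set] applies;
    the quarter of k is spent twice on moving the center and twice on moving the embedding. *)
Lemma proj_set_near z0 V : open V -> proj_set (range i) z0 `<=` V ->
  exists2 d, 0 < d & forall g z p, clo d g -> enorm (z - z0) < d ->
    enorm (z - g p) <= dist_set (range g) z -> V (i p).
Proof.
move=> oV pV.
have [k k0 kV] := near_proj_set (range_compact (clo_refl ltr01)) oV pV.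
exists (k / 4); first by rewrite divr_gt0.
move=> g z p cg zd pz; apply: kV; first by exists p.
have := enormB_le z0 z (i p); have := enormB_le z (g p) (i p).
have := clo_dist p cg; have := dist_set_near z z0 cg.
by rewrite (enormBC z0 z); lra.
Qed.

Section PatchAtPoint.
Variables (u0 : 'rV[R]_m) (psi : 'rV[R]_m -> M).
Variables (df : 'I_m -> (M -> 'rV[R]_D) -> 'rV[R]_m -> 'rV[R]_D).
Variables (Lf : 'rV[R]_m -> 'rV[R]_D) (Ldf : 'I_m -> 'rV[R]_m -> 'rV[R]_D).
Hypothesis P : patch clo i u0 psi df Lf Ldf.

Lemma patch_minimizer z0 c : 0 < c ->
  (forall w : 'rV[R]_m, \sum_b w ord0 b * LQ i u0 psi Lf Ldf z0 b w <= - c * `|w| ^+ 2) ->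
  exists2 d, 0 < d & forall g z, clo d g -> enorm (z - z0) < d -> forall u,
    `|u - u0| < d ->
    (proj_set (range g) z (g (psi u)) -> forall b, Qf psi df b g z u = 0) /\
    ((forall b, Qf psi df b g z u = 0) -> forall u', `|u' - u0| < d ->
      enorm (z - g (psi u)) ^+ 2 + c / 2 * `|u' - u| ^+ 2 <= enorm (z - g (psi u')) ^+ 2).
Proof.
move=> c0 hess; have [d1 [d10 h1]] := patch_convex clo_mono P c0 hess.
have [r r0 hr] := patch_critical P.
exists (Num.min d1 r); first by rewrite lt_min d10.
move=> g z cg; rewrite lt_min => /andP[zd _] u; rewrite lt_min => /andP[ud ur]; split.
  move=> [_ pz]; apply: (hr g z (clo_minr clo_mono cg) u ur) => u' _.
  by rewrite pz; apply: dist_set_le; exists (psi u').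
move=> Q0 u'; rewrite lt_min => /andP[ud' _].
exact: (h1 g z (clo_minl clo_mono cg) zd u u' ud ud').
Qed.

Lemma patch_proj_unique z0 c : 0 < c ->
  (forall w : 'rV[R]_m, \sum_b w ord0 b * LQ i u0 psi Lf Ldf z0 b w <= - c * `|w| ^+ 2) ->
  exists2 d, 0 < d & forall g z u u', clo d g -> enorm (z - z0) < d ->
    `|u - u0| < d -> `|u' - u0| < d -> proj_set (range g) z (g (psi u)) ->
    proj_set (range g) z (g (psi u')) -> u = u'.
Proof.
move=> c0 hess; have [d d0 h] := patch_minimizer c0 hess;
  exists d => // g z u u' cg zd ud ud' pu pu'.
have [h1 h2] := h g z cg zd u ud; have := h2 (h1 pu) u' ud'.
rewrite pu.2 pu'.2 gerDl pmulr_rle0 ?divr_gt0// => h3.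
have : `|u' - u| ^+ 2 == 0 by rewrite eq_le h3 sqr_ge0.
by rewrite sqrf_eq0 normr_eq0 subr_eq0 => /eqP.
Qed.

End PatchAtPoint.

(** Near the manifold strong convexity on one patch makes the projection unique, so the smallest
    enclosing ball is a point and the gradient has norm 1. *)
Lemma not_mu_critical_near_image p0 : exists2 d, 0 < d &
  forall g z mu, clo d g -> enorm (z - i p0) < d -> mu < 1 -> ~ mu_critical mu (range g) z.
Proof.
have [u0 [psi [df [Lf [Ldf [up0 P]]]]]] := clo_patch p0.
have [c c0 hess] := patch_hessian_immersion P.
have [d1 d10 uniq] := patch_proj_unique P c0 hess.
have [d2 d20 nb] := patch_nbhs P d10; rewrite up0 in nb uniq.
have ci := clo_refl ltr01.
have Sp0 : range i (i p0) by exists p0.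
have dz0 : dist_set (range i) (i p0) = 0.
  apply/eqP; rewrite eq_le; have := dist_set_le (i p0) Sp0; rewrite subrr enorm0 => -> /=.
  have [y [_ <-]] := proj_set_exists (i p0) (range_compact ci) (range_nonempty i).
  exact: enorm_ge0.
have pV : proj_set (range i) (i p0) `<=` eball (i p0) d2.
  by move=> y [_]; rewrite dz0 /eball /= enormBC => ->.
have [d3 d30 loc] := proj_set_near (@open_eball _ _ _ _) pV.
exists (Num.min d1 d3); first by rewrite lt_min d10.
move=> g z mu cg; rewrite lt_min => /andP[zd1 zd3] mu1.
have cg1 := clo_minl clo_mono cg; have cg3 := clo_minr clo_mono cg.
have cS := range_compact cg; have S0 := range_nonempty g.
move=> /(mu_criticalP cS S0)[Sz].
have [y py] := proj_set_exists z cS S0.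
have par y' : proj_set (range g) z y' -> exists2 u, `|u - u0| < d1 & g (psi u) = y'.
  move=> [[p _ <-] pz]; have := loc g z p cg3 zd3; rewrite pz lexx => /(_ isT)/nb[u ud <-].
  by exists u.
have -> : proj_set (range g) z = [set y].
  apply/seteqP; split => [y' py'|_ ->//] /=.
  have [u ud uy] := par y py; have [u' ud' uy'] := par y' py'.
  rewrite -uy -uy' (uniq g z u u' cg1 zd1 ud ud')// ?uy ?uy'//.
rewrite seb_center1 enormBC py.2; have := dist_set_gt0 cS S0 Sz; set d := dist_set _ _ => d0.
by rewrite leNgt -[ltRHS]mul1r ltr_pM2r// mu1.
Qed.

(** By [seb_center_dot] all projections of z0 have a positive slope in the direction w of the
    center. This is an open condition, hence it persists for nearby g and z, and [seb_center_gap]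
    then bounds mu from below. *)
Lemma not_mu_critical_near_regular z0 : ~ range i z0 -> ~ critical (range i) z0 ->
  exists2 d, 0 < d & forall g z mu, clo d g -> enorm (z - z0) < d -> mu <= d ->
    ~ mu_critical mu (range g) z.
Proof.
move=> Sz0 nc; have ci := clo_refl ltr01.
have cS := range_compact ci; have S0 := range_nonempty i.
have cP := proj_set_compact (x := z0) cS; have P0 := proj_set_exists z0 cS S0.
set c0 := seb_center (proj_set (range i) z0); set w := c0 - z0.
have w0 : w <> 0.
  move=> w0; apply: nc; split => //; rewrite /grad_dist memNset// -/c0.
  by rewrite -(opprB c0) -/w w0 oppr0 scaler0.
have W0 := enorm_gt0 w0; set W := enorm w in W0.
have slope y : proj_set (range i) z0 y -> W ^+ 2 / 4 < dot y w - dot z0 w.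
  move=> py; have := seb_center_dot (seb_centerP cP P0) (z := z0) (d :=
    dist_set (range i) z0) _ py.
  rewrite enormBC py.2 => /(_ _ erefl); rewrite -/w -/W dotBl => /(_ _)/le_trans h.
  have : 0 < W ^+ 2 by rewrite exprn_gt0.
  have {}h : W ^+ 2 <= 2 * (dot y w - dot z0 w).
    by apply: h => // y' py'; rewrite /ecball /= enormBC py'.2.
  lra.
pose V := [set y | W ^+ 2 / 4 < dot y w - dot z0 w].
have oV : open V.
  rewrite (_ : V = (fun y => dot y w) @^-1` [set s | W ^+ 2 / 4 + dot z0 w < s]).
    by apply: open_comp => [x _|]; [exact: continuous_dot|exact: open_gt].
  by apply/seteqP; split => y; rewrite /V /= ltrBrDr.
have [d1 d10 loc] := proj_set_near oV slope.
pose k := W ^+ 2 / 8; have k0 : 0 < k by rewrite divr_gt0// exprn_gt0.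
pose r0 := dist_set (range i) z0 + 2.
have r00 : 0 < r0 by rewrite ltr_wpDl// (ltW (dist_set_gt0 cS S0 Sz0)).
(* The slope is at least 2 k before perturbation; d2 makes moving the embedding and moving the
   center cost k / 4 each. With d3 the bound of [seb_center_gap] would read k^2 <= k^2 / 2. *)
pose d2 := k / (4 * W); have d20 : 0 < d2 by rewrite divr_gt0// mulr_gt0.
pose d3 := k ^+ 2 / (4 * r0 ^+ 2 * W ^+ 2).
have d30 : 0 < d3 by rewrite divr_gt0 ?mulr_gt0 ?exprn_gt0.
exists (Num.min (Num.min d1 1) (Num.min d2 d3)).
  by rewrite !lt_min d10 d20 d30 ltr01.
move=> g z mu cg; rewrite !lt_min !le_min => /andP[/andP[zd1 zd_1] /andP[zd2 zd3]].
move=> /andP[/andP[_ mu1] /andP[_ mu3]].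
have cgl := clo_minl clo_mono cg; have cgr := clo_minr clo_mono cg.
have cg1 := clo_minl clo_mono cgl; have cg_1 := clo_minr clo_mono cgl.
have cg2 := clo_minl clo_mono cgr.
have cSg := range_compact cg; have Sg0 := range_nonempty g.
move=> /(mu_criticalP cSg Sg0)[Sz cz].
have d0 := dist_set_gt0 cSg Sg0 Sz.
have mu0 : 0 <= mu.
  by rewrite -(pmulr_lge0 _ d0) (le_trans _ cz)// enorm_ge0.
have rz : dist_set (range g) z <= r0.
  by have := dist_set_near z z0 cg_1; rewrite /r0; lra.
have Ad y : proj_set (range g) z y -> enorm (y - z) = dist_set (range g) z.
  by move=> [_]; rewrite enormBC.
have Ak y : proj_set (range g) z y -> k <= dot (y - z) w.
  move=> [[p _ <-] pz]; have := loc g z p cg1 zd1; rewrite pz lexx => /(_ isT).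
  rewrite /V /= => h.
  have gp := dot_le_enorm (i p - g p) w; have zz := dot_le_enorm (z - z0) w.
  rewrite !dotBl -/W in gp zz *.
  have gp' : enorm (i p - g p) * W <= d2 * W.
    by rewrite ler_wpM2r ?(ltW W0)// enormBC ltW// clo_dist.
  have zz' : enorm (z - z0) * W <= d2 * W by rewrite ler_wpM2r ?(ltW W0)// ltW.
  have d2W : d2 * W = k / 4 by rewrite /d2; field; rewrite gt_eqF.
  rewrite d2W in gp' zz'; move: h; rewrite (_ : W ^+ 2 / 4 = 2 * k); last by rewrite /k; field.
  lra.
have mu01 : 0 <= mu <= 1 by rewrite mu0.
have := seb_center_gap (seb_centerP (proj_set_compact (x := z) cSg) (proj_set_exists z cSg Sg0))
  (proj_set_exists z cSg Sg0) Ad k0 Ak mu01 cz.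
apply/negP; rewrite -ltNge -/W.
rewrite (@le_lt_trans _ _ (2 * d3 * r0 ^+ 2 * W ^+ 2))//.
  rewrite ler_wpM2r ?sqr_ge0// ler_pM ?sqr_ge0 ?mulr_ge0//.
    by rewrite ler_pM2l.
  by rewrite ler_pXn2r ?nnegrE ?(ltW r00) ?(ltW d0).
have -> : 2 * d3 * r0 ^+ 2 * W ^+ 2 = k ^+ 2 / 2.
  by rewrite /d3; field; rewrite !gt_eqF.
have : 0 < k ^+ 2 by rewrite exprn_gt0.
lra.
Qed.

(** All images lie in one ball of radius r around 0, so the center of the projections has norm at
    most 2 r while the distance is at most |z| + r; with mu <= 1/2 this forces |z| <= 5 r. *)
Lemma not_mu_critical_far : exists r, forall g z mu, clo 1 g -> r < enorm z ->
  mu <= 1 / 2 -> ~ mu_critical mu (range g) z.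
Proof.
have ci := clo_refl ltr01; have [_ [[p0 _ <-] _]] :=
  proj_set_exists 0 (range_compact ci) (range_nonempty i).
have := @compact_EVT_max M R (fun p => enorm (0 - i p)) _ M_nonempty M_compact.
case.
  by apply: continuous_subspaceT; apply: continuous_dist; exact: clo_continuous ci.
move=> p1 _ pmax; pose r := enorm (i p1) + 1.
have gr g p : clo 1 g -> enorm (g p) <= r.
  move=> cg; have := clo_dist p cg; have := enorm_sub (g p) (i p).
  have := pmax p; rewrite inE => /(_ I); rewrite !sub0r !enormN /r; lra.
exists (5 * r) => g z mu cg zr mu2.
have cS := range_compact cg; have S0 := range_nonempty g.
move=> /(mu_criticalP cS S0)[Sz cz]; have d0 := dist_set_gt0 cS S0 Sz.
set c := seb_center _ in cz.
have [y py] := proj_set_exists z cS S0; have [[p _ yp] pz] := py.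
have [r' [Ar' r'min]] := seb_centerP (proj_set_compact (x := z) cS) (proj_set_exists z cS S0).
have r'r : r' <= r.
  by apply: (r'min 0) => _ [[q _ <-] _]; rewrite /ecball /= subr0 gr.
have := Ar' y py; rewrite /ecball /= -/c => yc.
have := enorm_sub c y; have := gr g p cg; rewrite yp enormBC => yr cy.
have dz : dist_set (range g) z <= enorm z + r.
  by rewrite -pz; have := enormD z (- y); rewrite enormN; lra.
have := enorm_sub z c; rewrite (enormBC z) => zc.
have : mu * dist_set (range g) z <= 1 / 2 * (enorm z + r).
  rewrite (@le_trans _ _ (1 / 2 * dist_set (range g) z))//; first by rewrite ler_wpM2r// ltW.
  by rewrite ler_wpM2l.
lra.
Qed.

(** * The system of equations at one critical point of i *)

Section CriticalPoint.
Variables (z0 : 'rV[R]_D) (n : nat) (x : 'I_n -> 'rV[R]_D) (l0 : 'I_n -> R).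
Hypothesis z0_out : ~ range i z0.
Hypothesis x_free : affine_free x.
Hypothesis x_proj : proj_set (range i) z0 = range x.
Hypothesis l0_gt0 : forall j, 0 < l0 j.
Hypothesis l0_sum : \sum_j l0 j = 1.
Hypothesis z0_comb : z0 = comb x l0.
Variables (u0 : 'I_n -> 'rV[R]_m) (psi : 'I_n -> 'rV[R]_m -> M).
Variables (df : 'I_n -> 'I_m -> (M -> 'rV[R]_D) -> 'rV[R]_m -> 'rV[R]_D).
Variables (Lf : 'I_n -> 'rV[R]_m -> 'rV[R]_D) (Ldf : 'I_n -> 'I_m -> 'rV[R]_m -> 'rV[R]_D).
Hypothesis P : forall j, patch clo i (u0 j) (psi j) (df j) (Lf j) (Ldf j).
Hypothesis x_psi : forall j, i (psi j (u0 j)) = x j.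
Variable c : R.
Hypothesis c_gt0 : 0 < c.
Hypothesis hess : forall j (w : 'rV[R]_m),
  \sum_b w ord0 b * LQ i (u0 j) (psi j) (Lf j) (Ldf j) z0 b w <= - c * `|w| ^+ 2.

Let ci := clo_refl ltr01.
Let d0 := dist_set (range i) z0.
Let e_ b : 'rV[R]_m := delta_mx ord0 b.

Lemma crit_dist_gt0 : 0 < d0.
Proof. exact: dist_set_gt0 (range_compact ci) (range_nonempty i) z0_out. Qed.

Lemma crit_dist j : enorm (z0 - x j) = d0.
Proof.
have : range x (x j) by exists j.
by rewrite -x_proj => -[].
Qed.

Lemma crit_nbhs r : 0 < r -> exists2 d, 0 < d & forall j p,
  enorm (i p - x j) < d -> exists2 u, `|u - u0 j| < r & psi j u = p.
Proof.
move=> r0; apply: finite_delta => [j d d' d'0 dd' h p pd|j].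
  by apply: h; exact: lt_le_trans dd'.
by have [d dd h] := patch_nbhs (P j) r0; exists d => // p; rewrite -x_psi; exact: h.
Qed.

Lemma crit_localization r : 0 < r -> exists2 d, 0 < d & forall g z p,
  clo d g -> enorm (z - z0) < d -> enorm (z - g p) <= dist_set (range g) z ->
  exists j, exists2 u, `|u - u0 j| < r & psi j u = p.
Proof.
move=> /crit_nbhs[d' d'0 nb].
pose V := \bigcup_j eball (x j) d'.
have oV : open V by apply: bigcup_open => j _; exact: open_eball.
have pV : proj_set (range i) z0 `<=` V.
  rewrite x_proj => _ [j _ <-]; exists j => //.
  by rewrite /eball /= subrr enorm0.
have [d dd loc] := proj_set_near oV pV; exists d => // g z p cg zd pz.
by have [j _ /nb h] := loc g z p cg zd pz; exists j.
Qed.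

Lemma crit_minimizer : exists2 d, 0 < d & forall j g z, clo d g ->
  enorm (z - z0) < d -> forall u, `|u - u0 j| < d ->
    (proj_set (range g) z (g (psi j u)) -> forall b, Qf (psi j) (df j) b g z u = 0) /\
    ((forall b, Qf (psi j) (df j) b g z u = 0) -> forall u', `|u' - u0 j| < d ->
      enorm (z - g (psi j u)) ^+ 2 + c / 2 * `|u' - u| ^+ 2 <= enorm (z - g (psi j u')) ^+ 2).
Proof.
apply: finite_delta => [j d d' d'0 dd' h g z cg zd u ud|j]; last first.
  by have [d dd h] := patch_minimizer (P j) c_gt0 (hess j); exists d.
have [h1 h2] := h g z (clo_mono cg dd') (lt_le_trans zd dd') u (lt_le_trans ud dd').
by split => // Q0 u' ud'; apply: h2 => //; exact: lt_le_trans dd'.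
Qed.

Lemma crit_bilipschitz : exists C d, [/\ 0 < C, 0 < d & forall j g u u', clo d g ->
  `|u - u0 j| < d -> `|u' - u0 j| < d ->
  enorm (g (psi j u) - g (psi j u')) <= C * `|u - u'|].
Proof.
have /choice[C CP] : forall j, exists C, 0 < C /\ exists2 d, 0 < d & forall g u u', clo d g ->
    `|u - u0 j| < d -> `|u' - u0 j| < d -> enorm (g (psi j u) - g (psi j u')) <= C * `|u - u'|.
  move=> j; have [c' [C [d [_ C0 dd h]]]] := patch_bilipschitz clo_mono (P j).
  exists C; split => //; exists d => // g u u' cg ud ud'.
  by have /andP[] := h g cg u u' ud ud'.
have [j d d' d'0 dd' h g u u' cg ud ud'|j|d dd h] :=
  @finite_delta R 'I_n (fun j d => forall g u u', clo d g ->
    `|u - u0 j| < d -> `|u' - u0 j| < d -> enorm (g (psi j u) - g (psi j u')) <= C j * `|u - u'|).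
- by apply: h; [exact: clo_mono dd'|exact: lt_le_trans dd'|exact: lt_le_trans dd'].
- by have [_] := CP j.
exists (1 + \sum_j C j), d; split => // [|j g u u' cg ud ud'].
  by rewrite ltr_wpDr// sumr_ge0// => j _; rewrite ltW// (CP j).1.
rewrite (le_trans (h j g u u' cg ud ud'))// ler_wpM2r// (bigD1 j)//= addrCA lerDl addr_ge0//.
by apply: sumr_ge0 => j' _; rewrite ltW// (CP j').1.
Qed.

Lemma crit_Qf j b : Qf (psi j) (df j) b i z0 (u0 j) = 0.
Proof.
have [d dd h] := crit_minimizer.
have zz : enorm (z0 - z0) < d by rewrite subrr enorm0.
have uu : `|u0 j - u0 j| < d by rewrite subrr normr0.
have [+ _] := h j i z0 (clo_refl dd) zz (u0 j) uu.
by apply; rewrite x_psi x_proj; exists j.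
Qed.

Lemma crit_normal j w : dot (z0 - x j) (Lf j w) = 0.
Proof.
rewrite (patch_Lf (P j)) dotC dot_suml big1// => b _; rewrite dotZl dotC.
have cl : forall d, 0 < d -> cloz clo z0 d (i, z0).
  by move=> d dd; split; [exact: clo_refl|rewrite /= subrr enorm0].
by rewrite -x_psi -(sdiff_value cl (sdiff_Qf clo_mono (P j) z0 b)) /= crit_Qf mulr0.
Qed.

(** Equations and unknowns share an index type to make the system visibly square: the radius
    equations carry the indices of the weights, and the normalization of the weights that of the
    squared radius. *)
Definition sys g (X : 'rV[R]_#|{: unknown m D n}|) (k : unknown m D n) : R :=
  match k with
  | inl (inl (inl a)) => (cz X - comb (fun j => g (psi j (cu j X))) (cl X)) ord0 a
  | inl (inl (inr p)) => Qf (psi p.1) (df p.1) p.2 g (cz X) (cu p.1 X)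
  | inl (inr j) => enorm (cz X - g (psi j (cu j X))) ^+ 2 - cr X
  | inr _ => \sum_j cl X j - 1
  end.

(** The derivative of [sys] at [X0]. The variation of u_j is absent from the radius equations
    because z0 - x j is normal to the manifold ([crit_normal]). *)
Definition dsys (W : 'rV[R]_#|{: unknown m D n}|) (k : unknown m D n) : R :=
  match k with
  | inl (inl (inl a)) => cz W ord0 a -
      \sum_j (l0 j * Lf j (cu j W) ord0 a + x j ord0 a * cl W j)
  | inl (inl (inr p)) => \sum_a ((z0 - x p.1) ord0 a * Ldf p.1 p.2 (cu p.1 W) ord0 a +
      Lf p.1 (e_ p.2) ord0 a * (cz W ord0 a - Lf p.1 (cu p.1 W) ord0 a))
  | inl (inr j) => 2 * dot (z0 - x j) (cz W) - cr W
  | inr _ => \sum_j cl W j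
  end.

Definition X0 : 'rV[R]_#|{: unknown m D n}| := mkX z0 u0 l0 (d0 ^+ 2).

Lemma sys_X0 k : sys i X0 k = 0.
Proof.
case: k => [[[a|[j b]]|j]|t] /=; rewrite ?cz_mkX ?cl_mkX ?cr_mkX ?cu_mkX.
- rewrite (_ : comb _ _ = z0); first by rewrite subrr mxE.
  by rewrite [RHS]z0_comb; apply: eq_bigr => j _; rewrite cu_mkX x_psi.
- by rewrite crit_Qf.
- by rewrite x_psi crit_dist subrr.
- by rewrite l0_sum subrr.
Qed.

Lemma sdiff_sys k : sdiff clo (fun g X => sys g X k) X0 0 (fun W => dsys W k).
Proof.
have sz a : sdiff clo (fun _ X => cz X ord0 a) X0 (z0 ord0 a) (fun W => cz W ord0 a).
  apply: sdiff_ext (sdiff_coord clo X0 (enum_rank (inl (inl (inl a)) : unknown m D n))) =>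
    [g X||W].
  + by rewrite mxE.
  + by rewrite mxE enum_rankK.
  + by rewrite mxE.
have sl j : sdiff clo (fun _ X => cl X j) X0 (l0 j) (fun W => cl W j).
  apply: sdiff_ext (sdiff_coord clo X0 (enum_rank (inl (inr j) : unknown m D n))) => //.
  by rewrite mxE enum_rankK.
have sr : sdiff clo (fun _ X => cr X) X0 (d0 ^+ 2) (fun W => cr W).
  apply: sdiff_ext (sdiff_coord clo X0 (enum_rank (inr tt : unknown m D n))) => //.
  by rewrite mxE enum_rankK.
have sf j a : sdiff clo (fun g X => g (psi j (cu j X)) ord0 a) X0 (x j ord0 a)
    (fun W => Lf j (cu j W) ord0 a).
  have := patch_val (P j) a; rewrite x_psi -[u0 j](cu_mkX z0 u0 l0 (d0 ^+ 2)).
  exact: (@sdiff_comp_lin _ _ clo _ X0 _ _ (cu j) _ _ (cu_lin j) (@cu_le _ _ _ _ j)).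
have sd j b a : sdiff clo (fun g X => df j b g (cu j X) ord0 a) X0
    (Lf j (e_ b) ord0 a) (fun W => Ldf j b (cu j W) ord0 a).
  have := patch_der (P j) a b; rewrite -[u0 j](cu_mkX z0 u0 l0 (d0 ^+ 2)).
  exact: (@sdiff_comp_lin _ _ clo _ X0 _ _ (cu j) _ _ (cu_lin j) (@cu_le _ _ _ _ j)).
case: k => [[[a|[j b]]|j]|t].
- have := sdiffB clo_mono (sz a) (sdiff_sum clo_mono (index_enum 'I_n)
    (fun j => sdiffM clo_mono (sl j) (sf j a))).
  apply: sdiff_ext => [g X||W] //=.
  + by rewrite !mxE summxE; congr (_ - _); apply: eq_bigr => j _; rewrite mxE.
  + rewrite {1}z0_comb summxE; apply/eqP; rewrite subr_eq0; apply/eqP.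
    by apply: eq_bigr => j _; rewrite mxE.
- have := sdiff_sum clo_mono (index_enum 'I_D)
    (fun a => sdiffM clo_mono (sdiffB clo_mono (sz a) (sf j a)) (sd j b a)).
  apply: sdiff_ext => [g X||W] //=.
  + by apply: eq_bigr => a _; rewrite !mxE.
  + by rewrite -[RHS](crit_normal j (e_ b)); apply: eq_bigr => a _; rewrite !mxE.
  + by apply: eq_bigr => a _; rewrite !mxE.
- have := sdiffB clo_mono (sdiff_sum clo_mono (index_enum 'I_D)
    (fun a => sdiffM clo_mono (sdiffB clo_mono (sz a) (sf j a)) (sdiffB clo_mono (sz a)
      (sf j a)))) sr.
  apply: sdiff_ext => [g X||W] //=.
  + by rewrite enorm_sqr; congr (_ - _); apply: eq_bigr => a _; rewrite !mxE.
  + rewrite -(crit_dist j) enorm_sqr; apply/eqP; rewrite subr_eq0; apply/eqP.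
    by apply: eq_bigr => a _; rewrite !mxE.
  + congr (_ - _); rewrite -[dot _ (cz W)]subr0 -[X in _ - X](crit_normal j (cu j W))
      -dotBr /dot mulr_sumr.
    by apply: eq_bigr => a _; rewrite !mxE; ring.
- have := sdiffB clo_mono (sdiff_sum clo_mono (index_enum 'I_n) sl) (sdiff_cst clo X0 1).
  by apply: sdiff_ext => [g X||W] //=; rewrite ?l0_sum ?subrr ?subr0.
Qed.

Lemma crit_weight_min : exists2 w, 0 < w & forall j, w <= l0 j.
Proof.
by apply: finite_delta => [j d d' _ h|j]; [exact: le_trans|exists (l0 j)].
Qed.

Lemma cu_X0_le X j : `|cu j X - u0 j| <= `|X - X0|.
Proof. by rewrite -[u0 j](cu_mkX z0 u0 l0 (d0 ^+ 2)) -cuB cu_le. Qed.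

Lemma cl_X0_le X j : `|cl X j - l0 j| <= `|X - X0|.
Proof. by rewrite -[l0 j]/(l0 j) -{1}(cl_mkX z0 u0 l0 (d0 ^+ 2)) -clB ucoord_le. Qed.

Lemma cz_X0_le X : enorm (cz X - z0) <= D.+1%:R * `|X - X0|.
Proof.
have -> : cz X - z0 = cz (X - X0) by rewrite czB cz_mkX.
rewrite (le_trans (enorm_le_norm _))//.
by rewrite ler_pM// ?ler_nat// cz_le.
Qed.

(** Any projection of z lies on some patch j, and strong convexity along this patch bounds its
    squared distance below by [cr X], with equality only at u_j. Hence the y j are exactly the
    projections. *)
Lemma sys_valid eta : 0 < eta -> exists2 d, 0 < d & forall g X, clo d g ->
  `|X - X0| < d -> (forall k, sys g X (upper_unknown k) = 0) ->
  let y j := g (psi j (cu j X)) in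
  [/\ ~ range g (cz X) /\ proj_set (range g) (cz X) = range y, affine_free y,
    (forall j, 0 < cl X j) /\ \sum_j cl X j = 1, forall j, enorm (y j - x j) < eta
    & P3_at (range g) (cz X)].
Proof.
move=> eta0.
have [dm dm0 hm] := crit_minimizer; have [C [db [C0 db0 hb]]] := crit_bilipschitz.
have dmb0 : 0 < Num.min dm db by rewrite lt_min dm0.
have [dn dn0 hn] := crit_nbhs dmb0; have [dl dl0 hl] := crit_localization dm0.
have [da da0 ha] := affine_free_near x_free; have [lm lm0 hlm] := crit_weight_min.
have d00 := crit_dist_gt0.
(* e' bounds the displacement of the projections: da preserves affine independence, and dn / 4 keeps
   the points near y j within reach of patch j, as needed for (P3). *)
pose e' := Num.min (Num.min eta da) (dn / 4).
have e'0 : 0 < e' by rewrite !lt_min eta0 da0 divr_gt0.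
have e'eta : e' <= eta by rewrite /e' !ge_min lexx.
have e'da : e' <= da by rewrite /e' !ge_min lexx !orbT.
have e'dn : e' <= dn / 4 by rewrite /e' !ge_min lexx !orbT.
clearbody e'.
pose r := Num.min (Num.min dm dl) (Num.min (d0 / 4) e').
have r0 : 0 < r by rewrite !lt_min dm0 dl0 e'0 divr_gt0.
pose d := Num.min (Num.min db lm) (Num.min (r / (2 * (1 + C))) (r / D.+1%:R)).
have C1 : 0 < 1 + C by rewrite addr_gt0.
have d_gt0 : 0 < d by rewrite !lt_min db0 lm0 !divr_gt0// mulr_gt0.
have ddb : d <= db by rewrite /d !ge_min lexx.
have dlm : d <= lm by rewrite /d !ge_min lexx !orbT.
have drC : d <= r / (2 * (1 + C)) by rewrite /d !ge_min lexx !orbT.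
have drD : d <= r / D.+1%:R by rewrite /d !ge_min lexx !orbT.
have dr : d <= r by rewrite (le_trans drD)// ler_pdivrMr// ler_peMr ?ler1n// ltW.
have rdm : r <= dm by rewrite /r !ge_min lexx.
have rdl : r <= dl by rewrite /r !ge_min lexx !orbT.
have rd0 : r <= d0 / 4 by rewrite /r !ge_min lexx !orbT.
have re' : r <= e' by rewrite /r !ge_min lexx !orbT.
exists d => // g X cg Xd S y; set z := cz X.
have zr : enorm (z - z0) < r.
  rewrite (le_lt_trans (cz_X0_le X))// (@lt_le_trans _ _ (D.+1%:R * d)) ?ltr_pM2l//.
  by rewrite mulrC -ler_pdivlMr.
have ud j : `|cu j X - u0 j| < d by exact: le_lt_trans (cu_X0_le X j) Xd.
have u0d j e : 0 < e -> `|u0 j - u0 j| < e by rewrite subrr normr0.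
have Q j b : Qf (psi j) (df j) b g z (cu j X) = 0 by exact: (S (inl (inl (j, b)))).
have yr j : enorm (z - y j) ^+ 2 = cr X by apply/eqP; rewrite -subr_eq0; apply/eqP;
  exact: (S (inl (inr j))).
have yx j : enorm (y j - x j) < e'.
  have := enormB_le (y j) (i (psi j (cu j X))) (x j).
  have := clo_dist (psi j (cu j X)) cg.
  have := hb j i (cu j X) (u0 j) (clo_refl db0) (lt_le_trans (ud j) ddb) (u0d j db db0).
  rewrite x_psi -/(y j) => h1 h2 h3.
  have h4 : C * `|cu j X - u0 j| <= C * d by rewrite ler_pM2l// ltW.
  have h5 : (1 + C) * d <= r / 2.
    rewrite mulrC -ler_pdivlMr// (le_trans drC)// invfM mulrA //.
  lra.
have cgdm : clo dm g by apply: clo_mono cg _; exact: le_trans dr rdm.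
have cgdl : clo dl g by apply: clo_mono cg _; exact: le_trans dr rdl.
have zdm : enorm (z - z0) < dm by exact: lt_le_trans zr rdm.
have zdl : enorm (z - z0) < dl by exact: lt_le_trans zr rdl.
have udm j : `|cu j X - u0 j| < dm.
  by apply: lt_le_trans (ud j) _; exact: le_trans dr rdm.
have cS := range_compact cg; have S0 := range_nonempty g.
have conv j u' : `|u' - u0 j| < dm ->
    cr X + c / 2 * `|u' - cu j X| ^+ 2 <= enorm (z - g (psi j u')) ^+ 2.
  by move=> ud'; rewrite -(yr j); exact: (hm j g z cgdm zdm _ (udm j)).2 (Q j) u' ud'.
have crle : cr X <= dist_set (range g) z ^+ 2.
  have [_ [[p _ <-] pz]] := proj_set_exists z cS S0.
  have [|j [u' ud' up]] := hl g z p cgdl zdl; rewrite ?pz//.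
  rewrite -pz -up (le_trans _ (conv j u' ud'))// lerDl mulr_ge0 ?sqr_ge0//.
  by rewrite divr_ge0// ltW.
have dist_ge0 : 0 <= dist_set (range g) z.
  by have [q [_ <-]] := proj_set_exists z cS S0; exact: enorm_ge0.
have ry j : range g (y j) by exists (psi j (cu j X)).
have crE j : enorm (z - y j) = dist_set (range g) z.
  apply/eqP; rewrite eq_le dist_set_le// andbT.
  by rewrite -(@ler_pXn2r _ 2) ?nnegrE ?enorm_ge0// yr.
have pE : proj_set (range g) z = range y.
  apply/seteqP; split => [_ [[p _ <-] pz]|_ [j _ <-]]; last by split; [exact: ry|exact: crE].
  have [|j [u' ud' up]] := hl g z p cgdl zdl; rewrite ?pz//.
  have := conv j u' ud'; rewrite up pz -(crE j) yr gerDl pmulr_rle0 ?divr_gt0// => h.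
  have : `|u' - cu j X| ^+ 2 == 0 by rewrite eq_le h sqr_ge0.
  rewrite sqrf_eq0 normr_eq0 subr_eq0 => /eqP uE.
  by exists j => //; rewrite /y -uE up.
split => //.
- split=> // Sz; have := dist_set_le z Sz; rewrite subrr enorm0 => h.
  by have := dist_set_near_ge z z0 cg; rewrite -/d0; lra.
- by apply: ha => j; exact: ltW (lt_le_trans (yx j) e'da).
- split=> [j|]; last by apply/eqP; rewrite -subr_eq0; apply/eqP; exact: (S (inr tt)).
  have := cl_X0_le X j; rewrite ler_norml => /andP[h _].
  by have := hlm j; lra.
- by move=> j; exact: lt_le_trans (yx j) e'eta.
(* Strong convexity gives growth c / 2 in the parameter, and the Lipschitz bound C of the patch
   converts it into growth in the ambient space. *)
- rewrite -/z /P3_at pE => _ [j _ <-]; exists (dn / 4), (c / 2 / C ^+ 2).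
  split; first by rewrite divr_gt0.
  split; first by rewrite !divr_gt0// exprn_gt0.
  move=> _ [[p _ <-]]; rewrite /eball /= => py.
  have [] := hn j p.
    have := enormB_le (i p) (g p) (x j); have := enormB_le (g p) (y j) (x j).
    by have := clo_dist p cg; have := yx j; rewrite (enormBC (i p) (g p)); lra.
  move=> u'; rewrite lt_min => /andP[udm' udb'] up.
  have := conv j u' udm'; rewrite -(yr j) up (enormBC z) (enormBC z (g p)).
  apply: le_trans; rewrite lerD2l -(mulrA _ _ (enorm _ ^+ 2)) ler_pM2l ?divr_gt0//.
  rewrite ler_pdivrMl ?exprn_gt0// -exprMn ler_pXn2r ?nnegrE ?enorm_ge0 ?mulr_ge0 ?(ltW C0)//.
  rewrite -up; apply: hb => //; first exact: clo_mono cg ddb.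
  exact: lt_le_trans (ud j) ddb.
Qed.

(** The point is that no patch is without a projection. The center of the smallest ball is a convex
    combination of the projections and is close to z0, so affine independence forces its weights
    close to the l0 j, which are positive; a patch without projection would have weight 0. *)
Lemma sys_complete r : 0 < r -> exists2 d, 0 < d & forall g z mu, clo d g ->
  enorm (z - z0) < d -> mu <= d -> mu_critical mu (range g) z ->
  exists X, [/\ `|X - X0| < r, cz X = z, forall k, sys g X (upper_unknown k) = 0 &
    enorm (z - comb (fun j => g (psi j (cu j X))) (cl X)) <= mu * dist_set (range g) z].
Proof.
move=> r0.
have [dm dm0 hm] := crit_minimizer; have [C [db [C0 db0 hb]]] := crit_bilipschitz.
have [Ca Ca0 ha] := affine_free_bound x_free; have [lm lm0 hlm] := crit_weight_min.
have d00 := crit_dist_gt0.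
(* The error allowed on the barycenter: [affine_free_bound] turns it into an error on the weights of
   at most lm / 2, for positivity, and r / 2, for closeness to [X0]. *)
pose t := Num.min (lm / 2) (r / 2) / Ca.
have t0 : 0 < t by rewrite divr_gt0// lt_min !divr_gt0.
have Ct : Ca * t = Num.min (lm / 2) (r / 2) by rewrite /t mulrC divfK// gt_eqF.
clearbody t.
pose r1 := Num.min (Num.min dm db) (Num.min (r / 2) (t / (4 * C))).
have t4C : 0 < t / (4 * C) by apply: divr_gt0 => //; rewrite mulr_gt0.
have r10 : 0 < r1 by rewrite !lt_min dm0 db0 t4C divr_gt0.
have r1dm : r1 <= dm by rewrite /r1 !ge_min lexx.
have r1db : r1 <= db by rewrite /r1 !ge_min lexx !orbT.
have r1r : r1 <= r / 2 by rewrite /r1 !ge_min lexx !orbT.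
have r1t : C * r1 <= t / 4.
  rewrite mulrC -ler_pdivlMr// (_ : t / 4 / C = t / (4 * C)); last by field; rewrite gt_eqF.
  by rewrite /r1 !ge_min lexx !orbT.
have [dl dl0 hl] := crit_localization r10.
have [r2 r2E] : exists r2, r2 = d0 + 2 by exists (d0 + 2).
have r20 : 0 < r2 by rewrite r2E addr_gt0.
pose d := Num.min (Num.min (Num.min dm db) (Num.min dl 1))
  (Num.min (r / 2) (Num.min (t / (4 * (2 + r2))) (r / (8 * r2)))).
have d_gt0 : 0 < d by rewrite !lt_min dm0 db0 dl0 ltr01 !divr_gt0// !mulr_gt0// addr_gt0.
have ddm : d <= dm by rewrite /d !ge_min lexx.
have ddb : d <= db by rewrite /d !ge_min lexx !orbT.
have ddl : d <= dl by rewrite /d !ge_min lexx !orbT.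
have d1 : d <= 1 by rewrite /d !ge_min lexx !orbT.
have dr : d <= r / 2 by rewrite /d !ge_min lexx !orbT.
have dt : d * (2 + r2) <= t / 4.
  rewrite -ler_pdivlMr ?addr_gt0// (_ : t / 4 / (2 + r2) = t / (4 * (2 + r2))); last by field;
    rewrite gt_eqF ?addr_gt0.
  by rewrite /d !ge_min lexx !orbT.
have dr2 : d * (8 * r2) <= r.
  by rewrite -ler_pdivlMr ?mulr_gt0// /d !ge_min lexx !orbT.
exists d => // g z mu cg zd mud.
have cS := range_compact cg; have S0 := range_nonempty g.
move=> /(mu_criticalP cS S0)[Sz cz_le].
set dist := dist_set (range g) z in cz_le *.
have dist0 : 0 < dist by exact: dist_set_gt0.
have h1 := dist_set_near z z0 cg; have h2 := dist_set_near_ge z z0 cg.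
rewrite -/d0 -/dist in h1 h2.
have distr2 : dist <= r2 by rewrite r2E; lra.
have cgdm := clo_mono cg ddm; have zdm := lt_le_trans zd ddm.
(* Patch j gets the parameter of its projection if there is one and u0 j by default; that the
   default never occurs is known only once the weights are shown positive. *)
have /choice[u uP] : forall j, exists u, `|u - u0 j| < r1 /\
    ((exists2 u, `|u - u0 j| < r1 & proj_set (range g) z (g (psi j u))) ->
      proj_set (range g) z (g (psi j u))).
  move=> j; have [[u ur pu]|no] := pselect (exists2 u, `|u - u0 j| < r1 &
    proj_set (range g) z (g (psi j u))); first by exists u.
  by exists (u0 j); split => //; rewrite subrr normr0.
pose J : pred 'I_n := fun j => `[< exists2 u,
  `|u - u0 j| < r1 & proj_set (range g) z (g (psi j u)) >].
pose y j := g (psi j (u j)).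
have Jy j : J j -> proj_set (range g) z (y j) by move/asboolP/(uP j).2.
have pE : proj_set (range g) z = [set y j | j in [set j | J j]].
  apply/seteqP; split => [y' py'|_ [j Jj <-]]; last exact: Jy.
  have [[p _ py] pz] := py'.
  have [|j [u' ur' up]] := hl g z p (clo_mono cg ddl) (lt_le_trans zd ddl).
    by rewrite py pz.
  have py2 : proj_set (range g) z (g (psi j u')) by rewrite up py.
  have Jj : J j by apply/asboolP; exists u'.
  exists j => //; have udm : `|u j - u0 j| < dm by exact: lt_le_trans (uP j).1 r1dm.
  have [hQ hc] := hm j g z cgdm zdm (u j) udm.
  have := hc (hQ (Jy j Jj)) u' (lt_le_trans ur' r1dm).
  rewrite (Jy j Jj).2 py2.2 gerDl pmulr_rle0 ?divr_gt0// => h.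
  have : `|u' - u j| ^+ 2 == 0 by rewrite eq_le h sqr_ge0.
  rewrite sqrf_eq0 normr_eq0 subr_eq0 => /eqP uE.
  by rewrite /y -uE up.
have sc := seb_centerP (proj_set_compact (x := z) cS) (proj_set_exists z cS S0).
set c0 := seb_center _ in sc cz_le; rewrite pE in sc.
have Jex : exists j, J j.
  by have := proj_set_exists z cS S0; rewrite pE => -[_ [j Jj _]]; exists j.
have [l [l_ge0 l1 lJ cE]] := seb_center_comb Jex sc.
have yx j : enorm (y j - x j) <= d + C * r1.
  have := enormB_le (y j) (i (psi j (u j))) (x j).
  have := clo_dist (psi j (u j)) cg; rewrite -/(y j).
  have := hb j i (u j) (u0 j) (clo_refl db0) (lt_le_trans (uP j).1 r1db).
  rewrite subrr normr0 => /(_ db0); rewrite x_psi => k1 k2 k3.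
  have k4 : C * `|u j - u0 j| <= C * r1 by rewrite ler_pM2l// ltW// (uP j).1.
  lra.
have mud2 : mu * dist <= d * r2.
  by rewrite (@le_trans _ _ (d * dist))// ?ler_pM2r// ler_pM2l.
have comb_err : enorm (comb x (fun j => l j - l0 j)) <= t.
  rewrite -combB -z0_comb.
  have -> : comb x l - z0 = comb (fun j => x j - y j) l + (c0 - z) + (z - z0).
    rewrite cE /comb; under [X in _ = X + _ + _]eq_bigr do rewrite scalerBr.
    by rewrite sumrB (addrA _ _ (- z)) subrK addrA subrK.
  have k1 : enorm (comb (fun j => x j - y j) l) <= d + C * r1.
    rewrite (le_trans (enorm_sum_le _ _))// -[leRHS]mul1r -[X in X * _]l1 mulr_suml.
    apply: ler_sum => j _; rewrite enormZ ger0_norm// ler_wpM2l// enormBC; exact: yx.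
  rewrite (le_trans (enormD _ _))// (le_trans (lerD (enormD _ _) (lexx _)))//.
  by move: dt; rewrite mulrDr; lra.
have ll0 j : `|l j - l0 j| <= Num.min (lm / 2) (r / 2).
  rewrite -Ct (le_trans (ha (fun j => l j - l0 j) j))// sumrB l1 l0_sum subrr normr0 addr0.
  by rewrite ler_pM2l.
have l_gt0 j : 0 < l j.
  have := ll0 j; rewrite le_min ler_norml => /andP[/andP[k1 _] _].
  by have := hlm j; lra.
have JT j : J j by apply/negPn/negP => /lJ lj0; have := l_gt0 j; rewrite lj0 ltxx.
exists (mkX z u l (dist ^+ 2)); split.
- apply: (@le_lt_trans _ _ (r / 2)); last by rewrite ltr_pdivrMr// ltr_pMr// ltr1n.
  have r2_0 : 0 <= r / 2 by rewrite divr_ge0// ltW.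
  apply: norm_unknown_le => // [|j|j|].
  + rewrite czB !cz_mkX (le_trans (norm_le_enorm _))// ltW// (lt_le_trans zd)//.
  + by rewrite cuB !cu_mkX; exact: ltW (lt_le_trans (uP j).1 r1r).
  + by rewrite clB !cl_mkX; apply: le_trans (ll0 j) _; rewrite ge_min lexx orbT.
  + rewrite crB !cr_mkX.
    rewrite (_ : dist ^+ 2 - d0 ^+ 2 = (dist - d0) * (dist + d0)); last by ring.
    have k1 : `|dist - d0| <= 2 * d by rewrite ler_norml; apply/andP; split; lra.
    have k2 : `|dist + d0| <= 2 * r2.
      by rewrite ger0_norm ?addr_ge0 ?(ltW dist0) ?(ltW d00)//; rewrite r2E in distr2 *; lra.
    rewrite normrM (le_trans (ler_pM _ _ k1 k2))//.
    by move: dr2; lra.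
- by rewrite cz_mkX.
- move=> [[[j b]|j]|t'] /=; rewrite ?cz_mkX ?cu_mkX ?cl_mkX ?cr_mkX.
  + by have [hQ _] := hm j g z cgdm zdm (u j) (lt_le_trans (uP j).1 r1dm); exact/hQ/Jy.
  + by rewrite -/(y j) (Jy j (JT j)).2 subrr.
  + by rewrite l1 subrr.
- rewrite cl_mkX (_ : (fun j => _) = y); first by rewrite -cE enormBC.
  by apply/funext => j; rewrite cu_mkX.
Qed.

Lemma crit_size_gt0 : (0 < n)%N.
Proof.
rewrite lt0n; apply/eqP => n0; have := l0_sum; rewrite big1 => [/eqP|j _].
  by rewrite eq_sym oner_eq0.
by have : (j < 0)%N := eq_ind _ (fun k => (j < k)%N) (ltn_ord j) _ n0.
Qed.

Lemma Lf0 j : Lf j 0 = 0.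
Proof. by apply/rowP => a; rewrite (is_lin0 (patch_val (P j) a).1) mxE. Qed.

Lemma Ldf0 j b : Ldf j b 0 = 0.
Proof. by apply/rowP => a; rewrite (is_lin0 (patch_der (P j) a b).1) mxE. Qed.

Lemma dsys_LQ W j b : cz W = 0 -> dsys W (inl (inl (inr (j, b)))) =
  LQ i (u0 j) (psi j) (Lf j) (Ldf j) z0 b (cu j W).
Proof.
move=> W0; rewrite /= W0 /LQ x_psi; apply: eq_bigr => a _.
by rewrite [(0 : 'rV_D) _ _]mxE sub0r mulrN.
Qed.

(* In dual form: the derivative of the upper equations is onto. *)
Lemma upper_dual (h : upper m n -> R) :
  (forall W, \sum_k dsys W (upper_unknown k) * h k = 0) -> forall k, h k = 0.
Proof.
move=> H; have {}H W : \sum_j \sum_b dsys W (inl (inl (inr (j, b)))) * h (inl (inl (j, b))) +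
    \sum_j dsys W (inl (inr j)) * h (inl (inr j)) + dsys W (inr tt) * h (inr tt) = 0.
  rewrite -[RHS](H W) !big_sumType (big_pred1 tt) => [|[]//].
  by congr (_ + _ + _); rewrite pair_bigA; apply: eq_bigr => -[].
have LQ0 j b : LQ i (u0 j) (psi j) (Lf j) (Ldf j) z0 b 0 = 0.
  by rewrite /LQ big1// => a _; rewrite Lf0 Ldf0 !mxE mulr0 mulr0 subr0.
(* Successive test directions: the weights isolate the normalization; the u_j, with the multipliers
   themselves as values, bring in the definite form of [hess]; finally rho and z give an affine
   relation between the x j. *)
have hT : h (inr tt) = 0.
  have := H (mkX 0 (fun=> 0) (fun=> 1) 0).
  rewrite big1 => [|j _]; last first.
    by rewrite big1// => b _; rewrite dsys_LQ ?cz_mkX// cu_mkX LQ0 mul0r.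
  rewrite big1 => [|j _]; last by rewrite /= cz_mkX cr_mkX dotC dot0l mulr0 subr0 mul0r.
  rewrite /= cl_mkX sumr_const card_ord !add0r => /eqP; rewrite mulf_eq0 pnatr_eq0.
  by rewrite -leqn0 leqNgt crit_size_gt0 => /eqP.
have hu j b : h (inl (inl (j, b))) = 0.
  pose al j : 'rV[R]_m := \row_b h (inl (inl (j, b))).
  have := H (mkX 0 al (fun=> 0) 0).
  rewrite [X in _ + X + _]big1 => [|j' _];
    last by rewrite /= cz_mkX cr_mkX dotC dot0l mulr0 subr0 mul0r.
  rewrite hT mulr0 !addr0 => S0.
  have S1 : \sum_j c * `|al j| ^+ 2 <= 0.
    suff : 0 <= \sum_j - c * `|al j| ^+ 2.
      by under eq_bigr do rewrite mulNr; rewrite sumrN oppr_ge0.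
    rewrite -[leLHS]S0; apply: ler_sum => j' _; apply: le_trans (hess j' (al j')).
    rewrite le_eqVlt; apply/orP; left; apply/eqP; apply: eq_bigr => b' _.
    by rewrite dsys_LQ ?cz_mkX// cu_mkX mulrC [in RHS]mxE.
  have S2 j' : 0 <= c * `|al j'| ^+ 2 by rewrite mulr_ge0 ?sqr_ge0// ltW.
  have /eqP : \sum_j c * `|al j| ^+ 2 = 0 by apply/eqP; rewrite eq_le S1 sumr_ge0.
  rewrite psumr_eq0// => /allP/(_ j (mem_index_enum _)) /=.
  rewrite mulf_eq0 gt_eqF//= sqrf_eq0 normr_eq0 => /eqP/rowP/(_ b).
  by rewrite !mxE.
have {}H W : \sum_j dsys W (inl (inr j)) * h (inl (inr j)) = 0.
  rewrite -[RHS](H W) hT mulr0 addr0 [X in _ = X + _]big1 ?add0r// => j _.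
  by rewrite big1// => b _; rewrite hu mulr0.
pose be j := h (inl (inr j)).
have be1 : \sum_j be j = 0.
  rewrite -[RHS](H (mkX 0 (fun=> 0) (fun=> 0) (- 1))); apply: eq_bigr => j _ /=.
  by rewrite cz_mkX cr_mkX dotC dot0l mulr0 sub0r opprK mul1r.
have be2 : \sum_j be j *: (z0 - x j) = 0.
  set v := LHS; have : dot v v = 0.
    have := H (mkX v (fun=> 0) (fun=> 0) 0); rewrite [in X in X -> _]/= cz_mkX cr_mkX.
    under eq_bigr do rewrite subr0 -mulrA (mulrC _ (be _)) -dotZl.
    by rewrite -mulr_sumr -dot_suml -/v => /eqP; rewrite mulf_eq0 pnatr_eq0 => /eqP.
  by rewrite -enorm_sqr => /eqP; rewrite sqrf_eq0 => /eqP/enorm_eq0.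
have be0 : forall j, be j = 0.
  apply: (x_free be1); move: be2; under eq_bigr do rewrite scalerBr.
  by rewrite sumrB -scaler_suml be1 scale0r sub0r => /eqP; rewrite oppr_eq0 => /eqP.
by move=> [[[j b]|j]|[]]; [exact: hu|exact: be0|exact: hT].
Qed.

Definition sysv g X : 'rV[R]_#|{: unknown m D n}| := \row_k sys g X (enum_val k).

Definition sysu g X : 'rV[R]_#|{: upper m n}| :=
  \row_k sys g X (upper_unknown (enum_val k)).

Lemma sysv_le g X k : `|sys g X k| <= `|sysv g X|.
Proof.
by rewrite -[k]enum_rankK; have := coord_le_norm (sysv g X) ord0 (enum_rank k); rewrite mxE.
Qed.

Lemma sysu_le g X : `|sysu g X| <= `|sysv g X|.
Proof. by apply: norm_le_coord => // j k; rewrite mxE sysv_le. Qed.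

Lemma sysu_eq0 g X : sysu g X = 0 -> forall k, sys g X (upper_unknown k) = 0.
Proof. by move=> /rowP S k; have := S (enum_rank k); rewrite !mxE enum_rankK. Qed.

Lemma sysv_X0 : sysv i X0 = 0.
Proof. by apply/rowP => k; rewrite !mxE sys_X0. Qed.

Lemma sysv_comb_le g X :
  enorm (cz X - comb (fun j => g (psi j (cu j X))) (cl X)) <= D%:R * `|sysv g X|.
Proof.
rewrite (le_trans (enorm_le_norm _))// ler_wpM2l//; apply: norm_le_coord => // j a.
by rewrite (ord1 j); exact: (sysv_le g X (inl (inl (inl a)))).
Qed.

Lemma vsdiff_sysv : exists2 B, vsdiff clo sysv X0 B &
  forall W k, (W *m B) ord0 k = dsys W (enum_val k).
Proof.
apply: (@vsdiff_coord _ _ clo clo_mono _ _ sysv X0 (fun k W => dsys W (enum_val k))) => k.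
by apply: sdiff_ext (sdiff_sys (enum_val k)) => // g X; rewrite mxE.
Qed.

Lemma vsdiff_sysu : exists B B', vsdiff clo sysu X0 B /\ B' *m B = 1%:M.
Proof.
have [|B dB BE] := @vsdiff_coord _ _ clo clo_mono _ _ sysu X0
  (fun k W => dsys W (upper_unknown (enum_val k))) => [k|].
  by apply: sdiff_ext (sdiff_sys (upper_unknown (enum_val k))) => // g X; rewrite mxE.
exists B; suff /row_fullP[B' B'B] : row_full B by exists B'.
rewrite /row_full -mxrank_tr; apply: inj_row_free => v vB.
apply/rowP => k; rewrite [RHS]mxE -(enum_valK k).
apply: (upper_dual (h := fun k => v ord0 (enum_rank k))) => W.
have := congr1 (fun N => (W *m N^T) ord0 ord0) vB.
rewrite trmx0 mulmx0 [RHS]mxE trmx_mul trmxK mulmxA mxE => S0; rewrite -[RHS]S0.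
rewrite (reindex_onto enum_val enum_rank) => [|k' _]; last exact: enum_rankK.
apply: eq_big => [k'|k' _]; first by rewrite enum_valK eqxx.
by rewrite enum_valK BE mxE.
Qed.

Hypothesis i_P2 : P2 (range i).
Hypothesis i_P4 : P4 (range i).

(** With z fixed, definiteness of the Hessians kills the u_j, affine independence then kills the
    weights, and any one radius equation kills rho. *)
Lemma dsys_inj_fiber W : cz W = 0 -> (forall k, dsys W k = 0) -> W = 0.
Proof.
move=> W0 S.
have uW j : cu j W = 0.
  have := hess j (cu j W); rewrite big1 => [|b _]; last by rewrite -dsys_LQ// S mulr0.
  rewrite mulNr oppr_ge0 pmulr_rle0// => h.
  have : `|cu j W| ^+ 2 == 0 by rewrite eq_le h sqr_ge0.
  by rewrite sqrf_eq0 normr_eq0 => /eqP.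
have lW : forall j, cl W j = 0.
  apply: x_free; first exact: (S (inr tt)).
  apply/rowP => a; rewrite summxE [RHS]mxE.
  have /eqP := S (inl (inl (inl a))); rewrite /= W0 mxE sub0r oppr_eq0 => /eqP.
  move=> S'; rewrite -[RHS]S'; apply: eq_bigr => j _.
  by rewrite uW Lf0 !mxE mulr0 add0r mulrC.
have j0 : 'I_n := Ordinal crit_size_gt0.
apply: eq_unknown => [|j|j|].
- by rewrite W0; apply/rowP => a; rewrite !mxE /ucoord mxE.
- by rewrite uW; apply/rowP => a; rewrite !mxE /ucoord mxE.
- by rewrite lW /cl /ucoord mxE.
- have /eqP := S (inl (inr j0)); rewrite /= W0 dotC dot0l mulr0 sub0r oppr_eq0 => /eqP ->.
  by rewrite /cr /ucoord mxE.
Qed.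

(* If the derivative of the system kills a vector W that moves the center z,
   correcting X0 + t W along the upper equations yields points z' whose
   projections are known and whose gradient is o(t), although they are at
   distance about t from z0: this contradicts (P4). *)
Lemma dsys_inj W : (forall k, dsys W k = 0) -> W = 0.
Proof.
move=> S; have [W0|Wn0] := eqVneq (cz W) 0; first exact: dsys_inj_fiber.
exfalso; have zw0 : 0 < enorm (cz W) by apply: enorm_gt0; exact/eqP.
have w0 : 0 < `|W|.
  rewrite normr_gt0; apply: contra_neq Wn0 => ->.
  by apply/rowP => a; rewrite !mxE /ucoord mxE.
have d00 := crit_dist_gt0.
have [B dB BE] := vsdiff_sysv; have [Bu [B' [dBu B'Bu]]] := vsdiff_sysu.
have WB : W *m B = 0 by apply/rowP => k; rewrite BE S mxE.
have [C [d1 [C0 d10 solve]]] := vsdiff_surj clo_mono dBu B'Bu.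
have [d2 d20 valid] := sys_valid ltr01.
have [CP [mu0 [CP0 [/andP[mu00 mu01] hP4]]]] := i_P4.
have [k k0 iso] := finite_set_isolated z0 i_P2.
pose D1 : R := D.+1%:R; have D10 : 0 < D1 by rewrite ltr0n.
pose nB := #|{: unknown m D n}|%:R * `|B|; have nB0 : 0 <= nB by rewrite mulr_ge0.
(* K1 e s bounds the residual of the system at the corrected point. Km converts it into a gradient
   bound, the distance to the manifold being at least d0 / 2. K2 adds the displacement due to the
   correction and the bound of (P4); e is chosen so that K2 e |W| < |cz W|. *)
pose K1 := 1 + (1 + nB) * C; have K10 : 0 < K1 by rewrite addr_gt0// mulr_gt0// ltr_pwDl.
pose Km := 4 * D1 * K1 / d0; have Km0 : 0 < Km by rewrite divr_gt0// !mulr_gt0.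
pose K2 := D1 * C + CP * Km; have K20 : 0 < K2 by apply: addr_gt0; apply: mulr_gt0.
pose e := Num.min 1 (enorm (cz W) / (2 * K2 * `|W|)).
have e0 : 0 < e by rewrite lt_min ltr01 divr_gt0// !mulr_gt0.
have e1 : e <= 1 by rewrite ge_min lexx.
have eK : K2 * e * `|W| < enorm (cz W).
  have : e <= enorm (cz W) / (2 * K2 * `|W|) by rewrite ge_min lexx orbT.
  rewrite ler_pdivlMr ?mulr_gt0// => h; apply: lt_le_trans h.
  rewrite (_ : K2 * e * `|W| = 1 * (e * K2 * `|W|)); last by ring.
  rewrite (_ : e * (2 * K2 * `|W|) = 2 * (e * K2 * `|W|)); last by ring.
  by rewrite ltr_pM2r ?ltr1n// !mulr_gt0.
clearbody e.
have [d3 d30 hB] := dB e e0.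
near (0 : R)^'+ => s.
have s0 : 0 < s by near: s; exact: nbhs_right_gt.
have sd1 : s * 1 < d1 by near: s; exact: near0_scale_lt.
have sd2 : s * (1 + C) < d2 by near: s; exact: near0_scale_lt.
have sd3 : s * (1 + C) < d3 by near: s; exact: near0_scale_lt.
have smu : s * (Km * e) < mu0 by near: s; exact: near0_scale_lt.
have sk : s * (D1 * (1 + C) + CP * (Km * e)) < k by near: s; exact: near0_scale_lt.
have sd0 : s * (D1 * (1 + C)) < d0 / 2 by near: s; apply: near0_scale_lt; rewrite divr_gt0.
rewrite mulr1 in sd1.
pose t := s / `|W|; have t0 : 0 < t by rewrite divr_gt0.
pose Xt := X0 + t *: W; have XtX0 : Xt - X0 = t *: W by rewrite /Xt addrC addKr.
have nXt : `|Xt - X0| = s by rewrite XtX0 normrZ gtr0_norm// /t divfK// gt_eqF.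
have sC : s <= s * (1 + C) by rewrite ler_peMr ?(ltW s0)// lerDl ltW.
have Xt3 : `|Xt - X0| < d3 by rewrite nXt (le_lt_trans sC).
have X03 : `|X0 - X0| < d3 by rewrite subrr normr0.
(* W lies in the kernel of the derivative and [X0] is a solution, so only the error of strict
   differentiability remains. *)
have Ft : `|sysv i Xt| <= e * s.
  have [_] := hB i (clo_refl d30) Xt X0 Xt3 X03.
  by rewrite sysv_X0 subr0 nXt XtX0 -scalemxAl WB scaler0 subr0.
have es : e * s <= s by rewrite ler_piMl// ltW.
have Fu : `|sysu i Xt| <= e * s := le_trans (sysu_le i Xt) Ft.
have [||X' XX' SX'] := solve i (clo_refl d10) Xt.
- by rewrite nXt.
- by rewrite (le_lt_trans Fu)// (le_lt_trans es).
have {}XX' : `|X' - Xt| <= C * (e * s) by rewrite (le_trans XX')// ler_pM2l.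
have X'0 : `|X' - X0| <= s * (1 + C).
  rewrite -(subrKA Xt) (le_trans (ler_normD _ _))// nXt mulrDr mulr1 addrC lerD2l.
  by rewrite (le_trans XX')// mulrC ler_pM2r.
have [[zout pE] yfree [l_gt0 l1] _ _] := valid i X' (clo_refl d20) (le_lt_trans X'0 sd2)
  (sysu_eq0 SX').
set z := cz X' in zout pE *; pose y := fun j : 'I_n => i (psi j (cu j X')).
have {}pE : proj_set (range i) z = range y := pE.
have zz0 : enorm (z - z0) <= s * (D1 * (1 + C)).
  by rewrite (le_trans (cz_X0_le X'))// mulrCA ler_pM2l.
have FX' : `|sysv i X'| <= K1 * (e * s).
  have [_] := hB i (clo_refl d30) X' Xt (le_lt_trans X'0 sd3) Xt3.
  set v := _ *m B => h; have hv : `|v| <= nB * `|X' - Xt| by exact: norm_mulmx_le.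
  rewrite -(subrK (sysv i Xt) (sysv i X')) (le_trans (ler_normD _ _))//.
  rewrite -(subrK v (sysv i X' - _)) (le_trans (lerD (ler_normD _ _) (lexx _)))//.
  have h2 : e * `|X' - Xt| <= C * (e * s).
    by rewrite (le_trans _ XX')// ler_piMl.
  have h3 : nB * `|X' - Xt| <= nB * (C * (e * s)) by rewrite ler_wpM2l.
  rewrite /K1 mulrDl mul1r -mulrA mulrDl mul1r; lra.
have ci' := range_compact ci; have S0 := range_nonempty i.
have distE : d0 / 2 <= dist_set (range i) z.
  have [_ [[p _ <-] <-]] := proj_set_exists z ci' S0.
  have := enormB_le z0 z (i p); have : d0 <= enorm (z0 - i p) by apply: dist_set_le; exists p.
  by rewrite (enormBC z0 z); lra.
have sc := seb_centerP (proj_set_compact (x := z) ci') (proj_set_exists z ci' S0).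
have zc : enorm (seb_center (proj_set (range i) z) - z) <= 2 * (D1 * (K1 * (e * s))).
  apply: (le_trans (seb_center_le_comb (y := y) (l := cl X') (d :=
    dist_set (range i) z) sc _ _ _ _ _)) => //.
  - by move=> y' [_ yz]; rewrite /ecball /= enormBC yz.
  - by move=> j; rewrite pE; exists j.
  - move=> j; have : proj_set (range i) z (y j) by rewrite pE; exists j.
    by rewrite enormBC => -[].
  - by move=> j; exact: ltW.
  - rewrite ler_pM2l// enormBC (le_trans (sysv_comb_le i X'))//.
    by rewrite ler_pM// ler_nat.
pose mu := Km * e * s.
have mu_ge0 : 0 <= mu by apply: mulr_ge0; [apply: mulr_ge0|]; exact: ltW.
have mu_lt : mu < mu0 by rewrite /mu mulrC.
have mc : mu_critical mu (range i) z.
  apply: mu_critical_intro => //; apply: (le_trans zc).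
  apply: le_trans (ler_wpM2l mu_ge0 distE); rewrite /mu /Km.
  by rewrite le_eqVlt; apply/orP; left; apply/eqP; field; rewrite gt_eqF.
have mu_int : 0 <= mu < mu0 by rewrite mu_ge0.
have [zs zs_crit zzs] := hP4 mu mu_int z mc.
(* (P4) provides some critical point near z; s is so small that isolation, from (P2), identifies it
   with z0. *)
have zsE : zs = z0.
  apply: iso => //; apply: le_lt_trans (enormB_le zs z z0) _.
  rewrite addrC (enormBC zs z); apply: le_lt_trans (lerD zz0 zzs) _.
  by move: sk; rewrite mulrDr (_ : s * (CP * _) = CP * mu)//; rewrite /mu; ring.
have tz : t * enorm (cz W) <= enorm (z - z0) + D1 * (C * (e * s)).
  have -> : t * enorm (cz W) = enorm (cz Xt - z0).
    have -> : cz Xt - z0 = cz (Xt - X0) by rewrite czB cz_mkX.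
    by rewrite XtX0 -[t *: W]addr0 cz_lin (_ : cz 0 = 0) ?addr0 ?enormZ ?gtr0_norm//;
      apply/rowP => a; rewrite !mxE /ucoord mxE.
  rewrite (le_trans (enormB_le _ z _))// addrC lerD2l /z -czB.
  rewrite (le_trans (enorm_le_norm _))// ler_pM ?ler_nat//.
  by rewrite (le_trans (cz_le _))// distrC.
move: tz; rewrite zsE in zzs.
have -> : t * enorm (cz W) = s * (enorm (cz W) / `|W|) by rewrite /t mulrAC mulrA.
have : s * (K2 * e) < s * (enorm (cz W) / `|W|) by rewrite ltr_pM2l// ltr_pdivlMr.
rewrite /K2 (_ : s * _ = D1 * (C * (e * s)) + CP * mu); last by rewrite /mu; ring.
lra.
Unshelve. all: by end_near. Qed.

(** z' comes from the zero X' of the system for g reached from [X0]. A mu-critical z gives by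
    [sys_complete] a vector X at which only the barycenter equation fails, by O(mu), and local
    injectivity compares X with X'. For mu = 0 this is uniqueness of z'. *)
Lemma critical_local eta : 0 < eta -> exists r C d, [/\ 0 < r <= eta, 0 < C, 0 < d &
  forall g, clo d g -> exists z', [/\ critical (range g) z', enorm (z' - z0) < r,
    P3_at (range g) z',
    (exists y l, [/\ affine_free y, proj_set (range g) z' = range y,
      (forall j : 'I_n, enorm (y j - x j) < eta) &
      [/\ forall j, 0 < l j, \sum_j l j = 1 & z' = comb y l]]) &
    forall z mu, enorm (z - z0) < r -> mu <= d -> mu_critical mu (range g) z ->
      enorm (z - z') <= C * mu]].
Proof.
move=> eta0; have d00 := crit_dist_gt0.
have [B dB BE] := vsdiff_sysv.
have Bunit : B \in unitmx.
  rewrite -row_free_unit; apply: inj_row_free => W WB; apply: dsys_inj => k.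
  by rewrite -[k]enum_rankK -BE WB mxE.
have [C1 [d1 [C10 d10 inj]]] := vsdiff_inj dB (mulmxV Bunit).
have [C2 [d2 [C20 d20 solve]]] := vsdiff_surj clo_mono dB (mulVmx Bunit).
have [dv dv0 valid] := sys_valid eta0.
have [dc dc0 complete] := sys_complete d10.
pose D1 : R := D.+1%:R; have D10 : 0 < D1 by rewrite ltr0n.
pose r := Num.min eta (Num.min dc 1); have r0 : 0 < r by rewrite !lt_min eta0 dc0 ltr01.
have reta : r <= eta by rewrite ge_min lexx.
have rdc : r <= dc by rewrite /r !ge_min lexx orbT.
have rc1 : r <= 1 by rewrite /r !ge_min lexx !orbT.
clearbody r.
pose q := Num.min (Num.min d1 dv) (r / D1).
have q0 : 0 < q by rewrite !lt_min d10 dv0 divr_gt0.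
have qd1 : q <= d1 by rewrite /q !ge_min lexx.
have qdv : q <= dv by rewrite /q !ge_min lexx orbT.
have qr : q <= r / D1 by rewrite /q !ge_min lexx !orbT.
clearbody q.
(* The residual of g at [X0] must be admissible for [solve], and small enough that the correction,
   C2 times larger, stays below q. *)
pose e := Num.min (d2 / 2) (q / (2 * C2)).
have e0 : 0 < e by rewrite lt_min !divr_gt0// mulr_gt0.
have ed2 : e <= d2 / 2 by rewrite /e ge_min lexx.
have eq2 : e <= q / (2 * C2) by rewrite /e ge_min lexx orbT.
clearbody e.
have [d3 d30 hB] := dB e e0.
have [r2 r2E] : exists r2, r2 = d0 + 2 by exists (d0 + 2).
have r20 : 0 < r2 by rewrite r2E addr_gt0.
pose d := Num.min (Num.min (Num.min d1 d2) (Num.min dv dc)) (Num.min d3 1).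
have dd : 0 < d by rewrite !lt_min d10 d20 dv0 dc0 d30 ltr01.
have dd1 : d <= d1 by rewrite /d !ge_min lexx.
have dd2 : d <= d2 by rewrite /d !ge_min lexx !orbT.
have ddv : d <= dv by rewrite /d !ge_min lexx !orbT.
have ddc : d <= dc by rewrite /d !ge_min lexx !orbT.
have dd3 : d <= d3 by rewrite /d !ge_min lexx !orbT.
have d_1 : d <= 1 by rewrite /d !ge_min lexx !orbT.
clearbody d.
exists r, (D1 * (C1 * r2)), d; split => //; first by rewrite r0.
  by rewrite !mulr_gt0.
move=> g cg; have cS := range_compact cg; have S0 := range_nonempty g.
have X0X0 a : 0 < a -> `|X0 - X0| < a by rewrite subrr normr0.
have Fe : `|sysv g X0| <= e := (hB g (clo_mono cg dd3) X0 X0 (X0X0 _ d30) (X0X0 _ d30)).1.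
have [|X' XX' SX'] := solve g (clo_mono cg dd2) X0 (X0X0 _ d20).
  by lra.
have X'q : `|X' - X0| < q.
  apply: le_lt_trans XX' _; apply: (@le_lt_trans _ _ (q / 2)); last by lra.
  rewrite mulrC -ler_pdivlMr// (le_trans Fe)// (le_trans eq2)// invfM mulrA //.
have SX'0 k : sys g X' k = 0.
  by have /rowP/(_ (enum_rank k)) := SX'; rewrite !mxE enum_rankK.
have [[zout pE] yfree [l_gt0 l1] yx hP3] := valid g X' (clo_mono cg ddv) (lt_le_trans X'q qdv)
  (fun k => SX'0 (upper_unknown k)).
set z' := cz X' in zout pE hP3 *; pose y := fun j : 'I_n => g (psi j (cu j X')).
have {}pE : proj_set (range g) z' = range y := pE.
have z'E : z' = comb y (cl X').
  apply/eqP; rewrite -subr_eq0; apply/eqP/rowP => a; rewrite [RHS]mxE.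
  exact: (SX'0 (inl (inl (inl a)))).
exists z'; split.
- apply/critical_mu0; apply: mu_critical_intro => //; rewrite mul0r.
  have sc := seb_centerP (proj_set_compact (x := z') cS) (proj_set_exists z' cS S0).
  apply: (le_trans (seb_center_le_comb (y := y) (l := cl X') (d :=
    dist_set (range g) z') sc _ _ _ _ _)) => //.
  + by move=> y' [_ yz]; rewrite /ecball /= enormBC yz.
  + by move=> j; rewrite pE; exists j.
  + move=> j; have : proj_set (range g) z' (y j) by rewrite pE; exists j.
    by rewrite enormBC => -[].
  + by move=> j; exact: ltW.
  + by rewrite -z'E subrr enorm0 mulr0.
- rewrite (le_lt_trans (cz_X0_le X'))// mulrC -ltr_pdivlMr//.
  exact: lt_le_trans X'q qr.
- exact: hP3.
- by exists y, (cl X').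
- move=> z mu zr mud mc.
  have [X [Xd1 Xz Su cE]] := complete g z mu (clo_mono cg ddc) (lt_le_trans zr rdc)
    (le_trans mud ddc) mc.
  have [Sz] := mu_criticalP cS S0 mc; set dist := dist_set _ _ in cE *.
  have dist0 : 0 < dist by exact: dist_set_gt0.
  move=> /(le_trans (enorm_ge0 _)); rewrite pmulr_lge0// => mu_ge0.
  have distr2 : dist <= r2.
    rewrite (le_trans (dist_set_near z z0 cg))// -/d0 r2E -addrA lerD2l.
    rewrite (_ : 2 = 1 + 1)// lerD// (le_trans _ rc1)//.
    exact: ltW.
  have SX : `|sysv g X| <= mu * dist.
    apply: norm_le_coord => [|j k]; first by rewrite mulr_ge0// ltW.
    rewrite mxE; case: (enum_val k) => [[[a|p]|j']|t'].
    - by rewrite /sys (le_trans (coord_le_enorm _ _))// Xz.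
    - by rewrite (Su (inl (inl p))) normr0 mulr_ge0// ltW.
    - by rewrite (Su (inl (inr j'))) normr0 mulr_ge0// ltW.
    - by rewrite (Su (inr t')) normr0 mulr_ge0// ltW.
  have XX'' : `|X - X'| <= C1 * (mu * r2).
    rewrite (le_trans (inj g (clo_mono cg dd1) X X' Xd1 (lt_le_trans X'q qd1)))//.
    by rewrite ler_pM2l// SX' subr0 (le_trans SX)// ler_wpM2l.
  rewrite -Xz /z' -czB (le_trans (enorm_le_norm _))//.
  rewrite (_ : D1 * _ * mu = D1 * (C1 * (mu * r2))); last by ring.
  by apply: ler_pM => //; [rewrite ler_nat|exact: le_trans (cz_le _) XX''].
Qed.

End CriticalPoint.

(** * From local counterparts to a bijection of critical sets *)

Hypothesis i_P1 : P1 (range i).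
Hypothesis i_P2 : P2 (range i).
Hypothesis i_P3 : P3 (range i).
Hypothesis i_P4 : P4 (range i).

Lemma critical_near_critical eta z0 : 0 < eta -> critical (range i) z0 ->
  exists r C d, [/\ 0 < r <= eta, 0 < C, 0 < d &
    forall g, clo d g -> exists z', [/\ critical (range g) z', enorm (z' - z0) < r,
      P1_at (range g) z' /\ P3_at (range g) z',
      paired eta (proj_set (range i) z0) (proj_set (range g) z') &
      forall z mu, enorm (z - z0) < r -> mu <= d -> mu_critical mu (range g) z ->
        enorm (z - z') <= C * mu]].
Proof.
move=> eta0 z0c; have [n [x [l0 [xfree pE [l00 l01 z0E]]]]] := (P1_atP _ _).1 (i_P1 z0c).
have /choice[p pP] : forall j, exists p, i p = x j.
  move=> j; have : proj_set (range i) z0 (x j) by rewrite pE; exists j.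
  by move=> [[p _ <-] _]; exists p.
have /choice[u0 /choice[psi /choice[df /choice[Lf /choice[Ldf pa]]]]] := fun j => clo_patch (p j).
have x_psi j : i (psi j (u0 j)) = x j by rewrite (pa j).1 pP.
have [|j|c c0 hess] := @finite_delta R 'I_n (fun j c => forall w : 'rV[R]_m,
    \sum_b w ord0 b * LQ i (u0 j) (psi j) (Lf j) (Ldf j) z0 b w <= - c * `|w| ^+ 2).
- move=> j c c' _ c'c h w; apply: le_trans (h w) _.
  by rewrite ler_wpM2r ?sqr_ge0// lerN2.
- have px : proj_set (range i) z0 (x j) by rewrite pE; exists j.
  have [dl [al [dl0 [al0 growth]]]] := i_P3 z0c px.
  apply: (patch_hessian_growth clo_mono clo_refl (pa j).2 dl0 al0) => [|u].
    have [r r0 h] := patch_critical (pa j).2.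
    apply: (h i z0 (clo_refl r0)) => [|u' _]; first by rewrite subrr normr0.
    by rewrite x_psi px.2; apply: dist_set_le; exists (psi j u').
  by rewrite x_psi => ud; apply: growth; split => //; exists (psi j u).
have [r [C [d [r0 C0 d0 h]]]] := critical_local z0c.1 xfree pE l00 l01 z0E
  (fun j => (pa j).2) x_psi c0 hess i_P2 i_P4 eta0.
exists r, C, d; split => // g cg; have [z' [z'c z'r z'3 [y [l [yfree pE' yx lP]]] z'4]] := h g cg.
exists z'; split => //; first by split => //; apply/P1_atP; exists n, y, l.
by exists n, x, y; split => //; exact: affine_free_inj.
Qed.

(** Outside a fixed ball there are no mu-critical points. In the ball each point is on the manifold,
    critical or regular, and has in each case a neighborhood with its own d; compactness, in
    near-covering form, gives a common d. *)
Lemma mu_critical_near_critical (r : 'rV[R]_D -> R) :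
  (forall z0, critical (range i) z0 -> 0 < r z0) ->
  exists2 d, 0 < d & forall g z mu, clo d g -> mu <= d -> mu_critical mu (range g) z ->
    exists2 z0, critical (range i) z0 & enorm (z - z0) < r z0.
Proof.
move=> r0; have [R0 far] := not_mu_critical_far.
pose Q (d : R) z := forall g mu, clo d g -> mu <= d -> mu_critical mu (range g) z ->
  exists2 z0, critical (range i) z0 & enorm (z - z0) < r z0.
have Qmono d d' z : d' <= d -> Q d z -> Q d' z.
  by move=> dd' h g mu cg mud; apply: h; [exact: clo_mono dd'|exact: le_trans dd'].
have cov : \forall d \near (0 : R)^'+, ecball 0 R0 `<=` Q d.
  apply: ((compact_near_coveringP _).1 (@ecball_compact R D 0 R0)) => z1 _.
  suff [d d0 h] : exists2 d, 0 < d & forall z, enorm (z - z1) < d -> Q d z.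
    exists (eball z1 d, [set d' | d' <= d]) => /=.
      by split; [exact: nbhs_eball|exact: nbhs_right_le].
    by move=> [z d'] /= [zd d'd]; exact: Qmono d'd (h z zd).
  have [[p0 _ pz1]|Sz1] := pselect (range i z1).
    have [d d0 h] := not_mu_critical_near_image p0.
    exists (Num.min d (1 / 2)); first by rewrite lt_min d0 divr_gt0.
    move=> z; rewrite lt_min -pz1 => /andP[zd _] g mu cg; rewrite le_min => /andP[_ mu2].
    move=> mc; exfalso; apply: (h g z mu (clo_minl clo_mono cg) zd _ mc); lra.
  have [z1c|z1n] := pselect (critical (range i) z1).
    by exists (r z1); [exact: r0|move=> z zr g mu _ _ _; exists z1].
  have [d d0 h] := not_mu_critical_near_regular Sz1 z1n.
  by exists d => // z zd g mu cg mud mc; exfalso; exact: h mc.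
near (0 : R)^'+ => d.
have d0 : 0 < d by near: d; exact: nbhs_right_gt.
have d2 : d <= 1 / 2 by near: d; apply: nbhs_right_le; rewrite divr_gt0.
have dQ : ecball 0 R0 `<=` Q d by near: d; exact: cov.
exists d => // g z mu cg mud mc; have [zR|zR] := leP (enorm z) R0.
  by apply: (dQ z _ g mu) => //; rewrite /ecball /= subr0.
exfalso; apply: (far g z mu _ zR (le_trans mud d2) mc).
by apply: clo_mono cg _; apply: le_trans d2 _; lra.
Unshelve. all: by end_near. Qed.

Lemma embedding_stability eps : 0 < eps -> exists2 d, 0 < d & forall g, clo d g ->
  [/\ P1 (range g), P2 (range g), P3 (range g) & P4 (range g)] /\
  exists Psi : 'rV[R]_D -> 'rV[R]_D,
    [/\ set_bij (critical (range i)) (critical (range g)) Psi,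
        forall z0, critical (range i) z0 -> eball z0 eps (Psi z0) &
        forall z0, critical (range i) z0 ->
          paired eps (proj_set (range i) z0) (proj_set (range g) (Psi z0))].
Proof.
move=> eps0; set Z := critical (range i).
have [k k0 sep] : exists2 k, 0 < k & forall z0, Z z0 -> forall z1, Z z1 ->
    enorm (z1 - z0) < k -> z1 = z0.
  apply: (finite_set_delta (P := fun z0 k =>
    forall z1, Z z1 -> enorm (z1 - z0) < k -> z1 = z0)) => //.
    by move=> z d d' _ dd' h z1 Zz1 zd; apply: h => //; exact: lt_le_trans dd'.
  by move=> z0 _; exact: finite_set_isolated.
(* With k / 2 two critical points sharing a counterpart would be less than k apart, hence equal:
   this is injectivity of [Psi]. *)
pose eta := Num.min eps (k / 2).
have eta0 : 0 < eta by rewrite lt_min eps0 divr_gt0.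
have etae : eta <= eps by rewrite ge_min lexx.
have etak : eta <= k / 2 by rewrite ge_min lexx orbT.
clearbody eta.
have /choice[r /choice[C loc]] : forall z0, exists r C, Z z0 -> [/\ 0 < r <= eta, 0 < C &
    exists2 d, 0 < d & forall g, clo d g -> exists z', [/\ critical (range g) z',
      enorm (z' - z0) < r,
      P1_at (range g) z' /\ P3_at (range g) z',
      paired eta (proj_set (range i) z0) (proj_set (range g) z') &
      forall z mu, enorm (z - z0) < r -> mu <= d -> mu_critical mu (range g) z ->
        enorm (z - z') <= C * mu]].
  move=> z0; have [Zz0|nZ] := pselect (Z z0); last by exists 0, 0.
  have [r [C [d [r0 C0 d0 h]]]] := critical_near_critical eta0 Zz0.
  by exists r, C => _; split => //; exists d.
have [dc dc0 cov] : exists2 d, 0 < d & forall g z mu, clo d g -> mu <= d ->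
    mu_critical mu (range g) z -> exists2 z0, Z z0 & enorm (z - z0) < r z0.
  by apply: mu_critical_near_critical => z0 /loc[/andP[]].
(* Bounding the constants by the inverse of d lets one minimum over the finite set Z provide both
   the radius and the constant of (P4). *)
have [d d0 dP] : exists2 d, 0 < d & forall z0, Z z0 -> C z0 <= d^-1 /\ forall g, clo d g ->
    exists z', [/\ critical (range g) z', enorm (z' - z0) < r z0,
      P1_at (range g) z' /\ P3_at (range g) z',
      paired eta (proj_set (range i) z0) (proj_set (range g) z') &
      forall z mu, enorm (z - z0) < r z0 -> mu <= d -> mu_critical mu (range g) z ->
        enorm (z - z') <= C z0 * mu].
  apply: (finite_set_delta (P := fun z0 d => C z0 <= d^-1 /\ forall g, clo d g ->
    exists z', [/\ critical (range g) z', enorm (z' - z0) < r z0,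
      P1_at (range g) z' /\ P3_at (range g) z',
      paired eta (proj_set (range i) z0) (proj_set (range g) z') &
      forall z mu, enorm (z - z0) < r z0 -> mu <= d -> mu_critical mu (range g) z ->
        enorm (z - z') <= C z0 * mu])) => //.
    move=> z0 d d' d'0 d'd [Cd h]; split.
      by apply: le_trans Cd _; rewrite lef_pV2 ?posrE// (lt_le_trans d'0).
    move=> g cg; have [z' [? ? ? ? h']] := h g (clo_mono cg d'd); exists z'; split => //.
    by move=> z mu zr mud; apply: h' => //; exact: le_trans d'd.
  move=> z0 /loc[_ C0 [d d0 h]]; exists (Num.min d (C z0)^-1);
    first by rewrite lt_min d0 invr_gt0.
  split.
    rewrite -[leLHS]invrK lef_pV2 ?posrE ?lt_min ?d0 ?invr_gt0//.
    by rewrite ge_min lexx orbT.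
  move=> g cg; have [z' [? ? ? ? h']] := h g (clo_minl clo_mono cg); exists z'; split => //.
  by move=> z mu zr mud; apply: h' => //; apply: le_trans mud _; rewrite ge_min lexx.
exists (Num.min dc d); first by rewrite lt_min dc0.
move=> g cg; have cgc := clo_minl clo_mono cg; have cgd := clo_minr clo_mono cg.
have /choice[Psi PsiP] : forall z0, exists z', Z z0 -> [/\ critical (range g) z',
  enorm (z' - z0) < r z0,
      P1_at (range g) z' /\ P3_at (range g) z',
      paired eta (proj_set (range i) z0) (proj_set (range g) z') &
      forall z mu, enorm (z - z0) < r z0 -> mu <= d -> mu_critical mu (range g) z ->
        enorm (z - z') <= C z0 * mu].
  move=> z0; have [Zz0|nZ] := pselect (Z z0); last by exists 0.
  by have [z' h] := (dP z0 Zz0).2 g cgd; exists z'.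
(* The linear estimate with mu = 0 puts z at distance 0 from [Psi z0]. *)
have surj z : critical (range g) z -> exists2 z0, Z z0 & z = Psi z0.
  move=> /critical_mu0 zc; have [z0 Zz0 zr] := cov g z 0 cgc (ltW dc0) zc.
  exists z0 => //; have [_ _ _ _ h] := PsiP z0 Zz0.
  have := h z 0 zr (ltW d0) zc; rewrite mulr0 => h0.
  by apply/eqP; rewrite -subr_eq0; apply/eqP/enorm_eq0/eqP; rewrite eq_le h0 enorm_ge0.
have Psi_near z0 : Z z0 -> enorm (Psi z0 - z0) < eta.
  by move=> Zz0; have [/andP[_ re] _ _] := loc z0 Zz0; have [_ h _ _ _] := PsiP z0 Zz0;
    exact: lt_le_trans re.
split.
  split.
  - by move=> z /surj[z0 Zz0 ->]; have [_ _ []] := PsiP z0 Zz0.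
  - apply: sub_finite_set (finite_image Psi i_P2) => z /surj[z0 Zz0 ->].
    by exists z0.
  - by move=> z x0 /surj[z0 Zz0 ->]; have [_ _ [_ h _ _]] := PsiP z0 Zz0; exact: h.
  - exists d^-1, (Num.min (Num.min dc d) (1 / 2)); rewrite invr_gt0 d0; split => //.
    split.
      by rewrite !lt_min dc0 d0 divr_gt0//= gt_min; apply/orP; right; lra.
    move=> mu /andP[mu0]; rewrite !lt_min => /andP[/andP[muc mud] _] z mc.
    have [z0 Zz0 zr] := cov g z mu cgc (ltW muc) mc.
    have [c1 _ _ _ h] := PsiP z0 Zz0; exists (Psi z0) => //.
    apply: le_trans (h z mu zr (ltW mud) mc) _.
    by apply: ler_wpM2r => //; exact: (dP z0 Zz0).1.
exists Psi; split.
- split.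
  + by move=> z0 Zz0; have [] := PsiP z0 Zz0.
  + move=> z0 z1 /set_mem Zz0 /set_mem Zz1 PsiE; apply: (sep z1 Zz1 z0 Zz0).
    apply: le_lt_trans (enormB_le z0 (Psi z0) z1) _.
    have := Psi_near z0 Zz0; have := Psi_near z1 Zz1.
    by rewrite -PsiE (enormBC z0 (Psi z0)); lra.
  + by move=> z /surj[z0 Zz0 ->]; exists z0.
- by move=> z0 Zz0; exact: lt_le_trans (Psi_near z0 Zz0) etae.
- move=> z0 Zz0; have [_ _ _ [n [x [y [h1 h2 h3 h4]]]] _] := PsiP z0 Zz0.
  by exists n, x, y; split => // j; exact: lt_le_trans (h4 j) etae.
Qed.

End EmbeddingFamily.

Theorem theorem1p4 (R : realType) (m D k : nat)
    (m_ge1 : (1 <= m)%N) (D_ge2 : (2 <= D)%N) (k_ge2 : (2 <= k)%N)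
    (M : topologicalType) (A : set (chart R m M))
    (M_manifold : Ck_manifold k A)
    (M_compact : compact [set: M]) (M_nonempty : [set: M] !=set0)
    (J : finType) (phi : J -> chart R m M) (U : J -> set 'rV[R]_m)
    (phi_atlas : finite_atlas k A phi U)
    (i : M -> 'rV[R]_D) (i_emb : Emb2 A i)
    (i_P1 : P1 (range i)) (i_P2 : P2 (range i))
    (i_P3 : P3 (range i)) (i_P4 : P4 (range i))
    (eps : R) (eps_gt0 : 0 < eps)
    (eps_small : forall z0 x x' : 'rV[R]_D, critical (range i) z0 ->
       proj_set (range i) z0 x -> proj_set (range i) z0 x' -> x <> x' ->
       eball x eps `&` eball x' eps = set0) :
  exists N : set (M -> 'rV[R]_D), Emb2_nbhs A phi U i N /\
    forall i', N i' ->
      [/\ P1 (range i'), P2 (range i'), P3 (range i') & P4 (range i')] /\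
      exists Psi : 'rV[R]_D -> 'rV[R]_D,
        [/\ set_bij (critical (range i)) (critical (range i')) Psi,
            forall z0, critical (range i) z0 -> eball z0 eps (Psi z0) &
            forall z0, critical (range i) z0 ->
              proj_set (range i') (Psi z0)
                `<=` \bigcup_(x in proj_set (range i) z0) eball x eps /\
              forall x, proj_set (range i) z0 x ->
                exists! y, (proj_set (range i') (Psi z0) `&` eball x eps) y].
Proof.
have [d d0 dP] := embedding_stability M_compact M_nonempty (@C2close_mono _ _ _ _ A _ phi U i)
  (fun d d0 => C2close_refl phi U d0 i_emb) (@C2close_dist _ _ _ _ _ A _ phi U phi_atlas i)
  (fun d g (cg : C2close A phi U i d g) => let: And3 _ _ (And3 _ cont _) := cg.1 in cont)
  (fun p0 => exists_patch k_ge2 M_manifold phi_atlas p0 i_emb) i_P1 i_P2 i_P3 i_P4 eps_gt0.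
exists (C2close A phi U i d); split.
  by split=> [f []//|]; exists d => // f Ef fi; split.
move=> g /dP[PP [Psi [bijP nearP pairP]]]; split=> //; exists Psi; split=> // z0 z0c.
exact: paired_unique (fun x x' => eps_small z0 x x' z0c) (pairP z0 z0c).
Qed.
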